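(* Let $K$ be a quadratic number field, or a cyclotomic number field $K=\mathbb{Q}(\xi_n)$ with $n>2$ and $n\not\equiv 2\bmod 4$. Let $d=[K:\mathbb{Q}]$, let $\mathcal{O}$ be the ring of integers of $K$, let $k\geqslant 2$ be an integer, and let $(\mathbb{X},\mathbb{Z}^d)$ be the topological dynamical system of $k$-free integers of $K$. Then the normaliser is $\mathcal{R}(\mathbb{X})=\mathcal{S}(\mathbb{X})\rtimes\mathcal{E}$ with $\mathcal{S}(\mathbb{X})=\mathbb{Z}^d$ and $\mathcal{E}\simeq\mathcal{O}^{\times}\rtimes\mathrm{Aut}_{\mathbb{Q}}(K)$, where $\mathrm{Aut}_{\mathbb{Q}}(K)=\mathrm{Gal}(K/\mathbb{Q})$.
   Context: A non-zero $x\in\mathcal{O}$ is $k$-free if the principal ideal $(x)$ is not divisible by the $k$-th power of any (non-zero) prime ideal of $\mathcal{O}$; $0$ is not $k$-free. Fix a $\mathbb{Z}$-basis of $\mathcal{O}$ (for $K=\mathbb{Q}(\xi_n)$, with $\xi_n$ a primitive $n$-th root of unity, take $1,\xi_n,\dots,\xi_n^{d-1}$, where $d=\varphi(n)$), and let $\iota\colon\mathcal{O}\to\mathbb{Z}^d$ be the resulting coordinate isomorphism. Let $V'_k\subset\mathbb{Z}^d$ be the image under $\iota$ of the set of $k$-free elements of $\mathcal{O}$. Subsets of $\mathbb{Z}^d$ are identified with elements of $\{0,1\}^{\mathbb{Z}^d}$ (product topology) via characteristic functions, and $\mathbb{X}=\overline{\{t+V'_k:t\in\mathbb{Z}^d\}}$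 is the orbit closure of $V'_k$, on which $\mathbb{Z}^d$ acts continuously and faithfully by translations. (For $\mathcal{B}=\{\iota(\mathfrak{p}^k):\mathfrak{p}\text{ a non-zero prime ideal of }\mathcal{O}\}$ this is the corresponding $\mathcal{B}$-free system.) Let $\mathrm{Aut}(\mathbb{X})$ be the group of all self-homeomorphisms of $\mathbb{X}$, and view $\mathcal{G}=\mathbb{Z}^d$ as the subgroup of translations. The centraliser is $\mathcal{S}(\mathbb{X})=\{H\in\mathrm{Aut}(\mathbb{X}): GH=HG\text{ for all }G\in\mathcal{G}\}$ and the normaliser is $\mathcal{R}(\mathbb{X})=\{H\in\mathrm{Aut}(\mathbb{X}):H\mathcal{G}H^{-1}=\mathcal{G}\}$. The equality $\mathcal{S}(\mathbb{X})=\mathbb{Z}^d$ means that the centraliser consists of the translations only. In $\mathcal{O}^\times\rtimes\mathrm{Aut}_{\mathbb{Q}}(K)$, field automorphisms act on the unit group $\mathcal{O}^\times$ in the natural way. *)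

(* Defs.v *)
From HB Require Import structures.
From mathcomp Require Import all_boot all_order all_algebra all_fingroup all_field.
From mathcomp Require Import all_classical all_reals all_analysis.

Set Implicit Arguments.
Unset Strict Implicit.
Unset Printing Implicit Defensive.

Import Order.TTheory GRing.Theory Num.Theory.

Local Open Scope classical_set_scope.
Local Open Scope ring_scope.

(* MathComp's subgroup notions (normaliser, semidirect product) are confined to
   finite groups, so the ones needed are stated here for any [groupType]. *)
Section Groups.
Variable gT : groupType.
Implicit Types (N E R G : set gT) (x y : gT).
Local Open Scope group_scope.

Definition is_subgroup G :=
  [/\ G 1, forall x y, G x -> G y -> G (x * y) & forall x, G x -> G x^-1].

Definition centraliser_of G : set gT := [set x | forall y, G y -> y * x = x * y].

Definition normaliser_of G : set gT :=
  [set x | (fun y => x * y * x^-1) @` G = G].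

Definition is_normal N R :=
  [/\ is_subgroup N, N `<=` R & forall x y, R x -> N y -> N (x * y * x^-1)].

Definition is_sdprod R N E :=
  [/\ is_subgroup R, is_subgroup E, is_normal N R, N `&` E = [set 1]
    & R = [set z | exists2 x, N x & exists2 y, E y & z = x * y]].

Definition is_isomorphic_to G (hT : groupType) :=
  exists phi : hT -> gT,
    [/\ {morph phi : x y / x * y}, injective phi & range phi = G].

End Groups.

Section ExternalSemidirectProduct.
Local Open Scope group_scope.

Record groupAct (N H : groupType) := GroupAct {
  gact :> H -> N -> N;
  gact1 : forall x, gact 1 x = x;
  gactM : forall g h x, gact (g * h) x = gact g (gact h x);
  gactMx : forall g x y, gact g (x * y) = gact g x * gact g y }.

Variables (N H : groupType) (a : groupAct N H).

Definition sdprod_type of groupAct N H : Type := (N * H)%type.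
Local Notation T := (sdprod_type a).
HB.instance Definition _ := Choice.copy T (N * H)%type.

Definition sd_one : T := (1, 1).
Definition sd_mul (x y : T) : T := (x.1 * a x.2 y.1, x.2 * y.2).
Definition sd_inv (x : T) : T := (a x.2^-1 x.1^-1, x.2^-1).

Fact gactx1 h : a h 1 = 1.
Proof. by apply: (mulgI (a h 1)); rewrite -gactMx !mulg1. Qed.

Fact sd_mulA : associative sd_mul.
Proof. by move=> x y z; rewrite /sd_mul /= gactMx gactM !mulgA. Qed.
Fact sd_mul1 : left_id sd_one sd_mul.
Proof. by case=> x h; rewrite /sd_mul /= gact1 !mul1g. Qed.
Fact sd_mulr1 : right_id sd_one sd_mul.
Proof. by case=> x h; rewrite /sd_mul /= gactx1 !mulg1. Qed.
Fact sd_mulV : left_inverse sd_one sd_inv sd_mul.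
Proof. by case=> x h; rewrite /sd_mul /= -gactMx !mulVg gactx1. Qed.
Fact sd_mulrV : right_inverse sd_one sd_inv sd_mul.
Proof.
by case=> x h; rewrite /sd_mul /= -gactM !mulgV gact1 mulgV.
Qed.

HB.instance Definition _ :=
  isGroup.Build T sd_mulA sd_mul1 sd_mulr1 sd_mulV sd_mulrV.

End ExternalSemidirectProduct.

(* The library's [{unit R}] is restricted to finite rings. *)
Section UnitGroup.
Variable R : unitRingType.

Definition unit_group : Type := {x : R | x \is a GRing.unit}.
HB.instance Definition _ := [isSub of unit_group for sval].
HB.instance Definition _ := [Choice of unit_group by <:].

Definition ug_one : unit_group := exist _ 1 (unitr1 R).
Fact ug_mul_subproof (x y : unit_group) : val x * val y \is a GRing.unit.
Proof. by rewrite unitrMr (valP x, valP y). Qed.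
Definition ug_mul x y : unit_group := exist _ (val x * val y) (ug_mul_subproof x y).
Fact ug_inv_subproof (x : unit_group) : (val x)^-1 \is a GRing.unit.
Proof. by rewrite unitrV (valP x). Qed.
Definition ug_inv x : unit_group := exist _ (val x)^-1 (ug_inv_subproof x).

Fact ug_mulA : associative ug_mul.
Proof. by move=> x y z; apply: val_inj; rewrite /= mulrA. Qed.
Fact ug_mul1 : left_id ug_one ug_mul.
Proof. by move=> x; apply: val_inj; rewrite /= mul1r. Qed.
Fact ug_mulr1 : right_id ug_one ug_mul.
Proof. by move=> x; apply: val_inj; rewrite /= mulr1. Qed.
Fact ug_mulV : left_inverse ug_one ug_inv ug_mul.
Proof. by move=> x; apply: val_inj; rewrite /= mulVr ?(valP x). Qed.
Fact ug_mulrV : right_inverse ug_one ug_inv ug_mul.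
Proof. by move=> x; apply: val_inj; rewrite /= divrr ?(valP x). Qed.

HB.instance Definition _ :=
  isGroup.Build unit_group ug_mulA ug_mul1 ug_mulr1 ug_mulV ug_mulrV.

End UnitGroup.

Section HomeoGroup.
Variable T : topologicalType.

Record homeo := Homeo {
  homeo_fun :> T -> T;
  homeo_inv : T -> T;
  homeoK : cancel homeo_fun homeo_inv;
  homeoVK : cancel homeo_inv homeo_fun;
  homeo_cts : continuous homeo_fun;
  homeoV_cts : continuous homeo_inv }.

HB.instance Definition _ := gen_eqMixin homeo.
HB.instance Definition _ := gen_choiceMixin homeo.

Lemma homeoP (f g : homeo) : f =1 g -> f = g.
Proof.
case: f g => f f' fK f'K cf cf' [g g' gK g'K cg cg'] /= fg.
have efg : f = g by apply/funext.
subst g; have efg' : f' = g'.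
  by apply/funext => x; rewrite -{1}(g'K x) fK.
by subst g'; congr Homeo; apply: Prop_irrelevance.
Qed.

Definition homeo_one : homeo :=
  @Homeo id id (fun=> erefl) (fun=> erefl) (fun=> cvg_id) (fun=> cvg_id).
Definition homeo_mul (f g : homeo) : homeo :=
  @Homeo (f \o g) (homeo_inv g \o homeo_inv f)
    (can_comp (@homeoK f) (@homeoK g)) (can_comp (@homeoVK g) (@homeoVK f))
    (fun x => continuous_comp (@homeo_cts g x) (@homeo_cts f (g x)))
    (fun x => continuous_comp (@homeoV_cts f x)
                              (@homeoV_cts g (homeo_inv f x))).
Definition homeo_opp (f : homeo) : homeo :=
  Homeo (@homeoVK f) (@homeoK f) (@homeoV_cts f) (@homeo_cts f).

Fact homeo_mulA : associative homeo_mul.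
Proof. by move=> f g h; apply: homeoP. Qed.
Fact homeo_mul1 : left_id homeo_one homeo_mul.
Proof. by move=> f; apply: homeoP. Qed.
Fact homeo_mulr1 : right_id homeo_one homeo_mul.
Proof. by move=> f; apply: homeoP. Qed.
Fact homeo_mulV : left_inverse homeo_one homeo_opp homeo_mul.
Proof. by move=> f; apply: homeoP => x /=; rewrite homeoK. Qed.
Fact homeo_mulrV : right_inverse homeo_one homeo_opp homeo_mul.
Proof. by move=> f; apply: homeoP => x /=; rewrite homeoVK. Qed.

HB.instance Definition _ :=
  isGroup.Build homeo homeo_mulA homeo_mul1 homeo_mulr1 homeo_mulV homeo_mulrV.

End HomeoGroup.

(* [ring_quotient] only has proper ideals; the unit ideal is also needed as a
   possible cofactor in a divisibility of ideals. *)
Section Ideals.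
Variable R : comNzRingType.
Implicit Types (I J M : set R) (x : R).

Definition is_ideal I := I 0 /\ forall a x y, I x -> I y -> I (a * x + y).

Definition ideal_mul I J : set R :=
  [set x | exists n (u v : 'I_n -> R),
     (forall i, I (u i) /\ J (v i)) /\ x = \sum_i u i * v i].

Definition ideal_exp I (k : nat) : set R := iter k (ideal_mul I) setT.

Definition principal_ideal x : set R := range (fun a => a * x).

Definition ideal_dvd I J := exists2 M, is_ideal M & J = ideal_mul I M.

Definition k_free (k : nat) x :=
  x != 0 /\
  forall P : prime_idealr R, (exists2 y, P y & y != 0) ->
    ~ ideal_dvd (ideal_exp [set y | P y] k) (principal_ideal x).

End Ideals.

Definition is_quadratic (K : fieldExtType rat) : Prop := \dim {:K} = 2%N.

Definition is_cyclotomic (K : fieldExtType rat) (n : nat) : Prop :=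
  exists2 xi : K, n.-primitive_root xi & <<1; xi>>%VS = {:K}%VS.

Section RingOfIntegers.
Variable K : fieldExtType rat.

Definition integral_elt : {pred K} :=
  fun x => `[< integralOver (intr : int -> K) x >].

Fact integral_elt_subring : subring_closed integral_elt.
Proof.
split=> [|x y /asboolP xO /asboolP yO|x y /asboolP xO /asboolP yO];
  apply/asboolP.
- exact: (@integral1 _ _ (intr : {rmorphism int -> K})).
- exact: (@integral_sub _ _ (intr : {rmorphism int -> K})).
- exact: (@integral_mul _ _ (intr : {rmorphism int -> K})).
Qed.
HB.instance Definition _ :=
  GRing.isSubringClosed.Build K integral_elt integral_elt_subring.

Definition ring_of_integers : Type := {x : K | x \in integral_elt}.
HB.instance Definition _ := [isSub of ring_of_integers for sval].
HB.instance Definition _ := [Choice of ring_of_integers by <:].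
HB.instance Definition _ :=
  [SubChoice_isSubComNzRing of ring_of_integers by <:].

Local Notation O := ring_of_integers.

Definition int_unit : {pred O} := fun x => `[< exists y : O, y * x = 1 >].
Definition int_inv (x : O) : O :=
  if pselect (exists y : O, y * x = 1) is left e then projT1 (cid e) else x.

Fact int_mulVx : {in int_unit, left_inverse 1 int_inv *%R}.
Proof.
move=> x /asboolP xU; rewrite /int_inv; case: pselect => // e.
exact: projT2 (cid e).
Qed.
Fact int_unitPl x y : y * x = 1 -> x \in int_unit.
Proof. by move=> yx; apply/asboolP; exists y. Qed.
Fact int_inv_out : {in [predC int_unit], int_inv =1 id}.
Proof.
move=> x; rewrite inE => /asboolPn xU; rewrite /int_inv.
by case: pselect.
Qed.
HB.instance Definition _ :=
  GRing.ComNzRing_hasMulInverse.Build O int_mulVx int_unitPl int_inv_out.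

Definition lattice_elt d (b : 'I_d -> O) (z : 'rV[int]_d) : O :=
  \sum_(i < d) b i *~ z 0 i.

Definition is_Zbasis d (b : 'I_d -> O) :=
  forall x : O, exists! z : 'rV[int]_d, x = lattice_elt b z.

(* For a Z-basis [b], [lattice_elt b] is the inverse of the coordinate
   isomorphism, so that this is the image of the [k]-free elements under the
   latter. *)
Definition k_free_lattice d (b : 'I_d -> O) (k : nat) : set 'rV[int]_d :=
  [set z | k_free k (lattice_elt b z)].

End RingOfIntegers.

(* The library's ['Gal(E / F)] requires a [splittingFieldType]; the following
   group is defined for every number field. *)
Section FieldAutomorphisms.
Variable K : fieldExtType rat.

Definition field_aut : Type := {f : 'End(K) | kAut 1 fullv f}.
HB.instance Definition _ := [isSub of field_aut for sval].
HB.instance Definition _ := [Choice of field_aut by <:].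

Fact aut_one_subproof : kAut 1 {:K} (\1%VF : 'End(K)).
Proof. by rewrite kAutfE kHom1. Qed.
Definition aut_one : field_aut := exist _ (\1%VF : 'End(K)) aut_one_subproof.
Fact aut_mul_subproof (f g : field_aut) : kAut 1 {:K} (val f \o val g)%VF.
Proof.
have := valP f; have := valP g; rewrite !kAutfE => hg hf.
exact: comp_kHom.
Qed.
Definition aut_mul f g : field_aut := exist _ (val f \o val g)%VF (aut_mul_subproof f g).
Fact aut_inv_subproof (f : field_aut) : kAut 1 {:K} (val f)^-1%VF.
Proof. by have := valP f; rewrite !kAutfE => hf; apply: inv_kHomf. Qed.
Definition aut_inv f : field_aut := exist _ (val f)^-1%VF (aut_inv_subproof f).

Fact aut_lker0 (f : field_aut) : lker (val f) == 0%VS.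
Proof. by apply: (@kAutf_lker0 _ _ 1%AS); rewrite -kAutfE (valP f). Qed.

Fact aut_mulA : associative aut_mul.
Proof. by move=> f g h; apply: val_inj; rewrite /= comp_lfunA. Qed.
Fact aut_mul1 : left_id aut_one aut_mul.
Proof. by move=> f; apply: val_inj; rewrite /= comp_lfun1l. Qed.
Fact aut_mulr1 : right_id aut_one aut_mul.
Proof. by move=> f; apply: val_inj; rewrite /= comp_lfun1r. Qed.
Fact aut_mulV : left_inverse aut_one aut_inv aut_mul.
Proof.
by move=> f; apply: val_inj; rewrite /= lker0_compVf ?aut_lker0.
Qed.
Fact aut_mulrV : right_inverse aut_one aut_inv aut_mul.
Proof.
by move=> f; apply: val_inj; rewrite /= lker0_compfV ?aut_lker0.
Qed.
HB.instance Definition _ :=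
  isGroup.Build field_aut aut_mulA aut_mul1 aut_mulr1 aut_mulV aut_mulrV.

Fact aut_monoid (f : field_aut) : monoid_morphism (val f).
Proof. by apply/kHom_monoid_morphism; rewrite -kAutfE (valP f). Qed.

Fact aut_integral (f : field_aut) (x : ring_of_integers K) :
  val f (val x) \in @integral_elt K.
Proof.
pose fM := GRing.isMonoidMorphism.Build _ _ _ (aut_monoid f).
pose fR : {rmorphism K -> K} := HB.pack (fun_of_lfun (val f)) fM.
have /asboolP[p mp px] := valP x; apply/asboolP; exists p => //.
have -> : map_poly (intr : int -> K) p = map_poly fR (map_poly intr p).
  by rewrite -map_poly_comp; apply: eq_map_poly => z; rewrite -(rmorph_int fR).
exact: (rmorph_root fR).
Qed.
Definition aut_int (f : field_aut) (x : ring_of_integers K) :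
  ring_of_integers K := exist _ (val f (val x)) (aut_integral f x).

Fact aut_intM f x y : aut_int f (x * y) = aut_int f x * aut_int f y.
Proof. by apply: val_inj; rewrite /= (aut_monoid f).2. Qed.
Fact aut_int1 f : aut_int f 1 = 1.
Proof. by apply: val_inj; rewrite /= (aut_monoid f).1. Qed.

Fact aut_unit_subproof f (u : unit_group (ring_of_integers K)) :
  aut_int f (val u) \is a GRing.unit.
Proof.
apply/unitrP; exists (aut_int f (val u)^-1); rewrite -!aut_intM.
by rewrite mulVr ?divrr ?(valP u) // aut_int1.
Qed.
Definition aut_unit f u : unit_group (ring_of_integers K) :=
  exist _ (aut_int f (val u)) (aut_unit_subproof f u).

Fact aut_unit1 u : aut_unit 1%g u = u.
Proof. by do 2!apply: val_inj; rewrite /= id_lfunE. Qed.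
Fact aut_unitM f g u : aut_unit (f * g)%g u = aut_unit f (aut_unit g u).
Proof. by do 2!apply: val_inj; rewrite /= comp_lfunE. Qed.
Fact aut_unitMx f u v :
  aut_unit f (u * v)%g = (aut_unit f u * aut_unit f v)%g.
Proof. by apply: val_inj; rewrite /= aut_intM. Qed.

Definition aut_unit_act : groupAct (unit_group (ring_of_integers K)) field_aut :=
  GroupAct aut_unit1 aut_unitM aut_unitMx.

Definition is_galois_over_Q :=
  separable 1 {:K} /\ splitting_field_axiom K.

End FieldAutomorphisms.

Section Shift.
Variable d : nat.
Local Notation Zd := 'rV[int]_d.

Definition full_shift : topologicalType := {ptws Zd -> bool}.

Definition char_fun (A : set Zd) : full_shift := fun z => `[< A z >].

(* On characteristic functions this is the map A |-> t + A. *)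
Definition translate (t : Zd) (x : full_shift) : full_shift :=
  fun z => x (z - t).

Lemma translateD s t x : translate s (translate t x) = translate (s + t) x.
Proof. by apply/funext => z; rewrite /translate opprD addrA. Qed.
Lemma translate0 x : translate 0 x = x.
Proof. by apply/funext => z; rewrite /translate subr0. Qed.

Lemma translate_cts t : continuous (translate t).
Proof.
move=> x; apply/cvg_sup => z; move: x.
have : continuous (fun x : full_shift => translate t x z).
  exact: (@proj_continuous _ (fun=> bool) (z - t)).
exact: (@continuous_comp_initial _ full_shift).
Qed.

Definition orbit (A : set Zd) : set full_shift :=
  range (fun t => translate t (char_fun A)).

Definition orbit_closure (A : set Zd) : set full_shift := closure (orbit A).

Variable A : set Zd.

Definition system : topologicalType := set_type (orbit_closure A).

Fact translate_stable t (x : system) :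
  translate t (set_val x) \in orbit_closure A.
Proof.
apply/mem_set => U /translate_cts xU.
have /(_ _ xU)[y [[s _ <-] Uy]] := set_mem (valP x).
exists (translate t (translate s (char_fun A))); split => //.
by exists (t + s); rewrite // translateD.
Qed.

Definition system_translate t (x : system) : system :=
  exist _ (translate t (set_val x)) (translate_stable t x).

Fact system_translateK t : cancel (system_translate t) (system_translate (- t)).
Proof. by move=> x; apply: val_inj; rewrite /= translateD addNr translate0. Qed.

Fact system_translateVK t :
  cancel (system_translate (- t)) (system_translate t).
Proof. by move=> x; apply: val_inj; rewrite /= translateD addrN translate0. Qed.

Fact system_translate_cts t : continuous (system_translate t).
Proof.
apply: continuous_comp_initial => x.
have vc : continuous (set_val : system -> full_shift).
  exact: (@initial_continuous system full_shift set_val).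
exact: (continuous_comp (vc x) (@translate_cts t (set_val x))).
Qed.

Definition translation t : homeo system :=
  Homeo (system_translateK t) (system_translateVK t)
        (@system_translate_cts t) (@system_translate_cts (- t)).

Definition translations : set (homeo system) := range translation.

End Shift.

Arguments translation {d} A t.
Arguments translations {d} A.

(* Main.v *)
(** A finite set [F] of integers is admissible when, for every prime ideal P, it
    misses a class modulo P^k. A sieve (convergent since k >= 2) shows that the
    finite patterns of the orbit closure X are exactly the finite admissible sets.

    Let H be a homeomorphism of X with H (t + x) = a t + H x. By compactness H is
    a local rule. Take a prime P of degree one over a large p: then a^-1 (P^k) has
    index p^k, while Q^k has index at least p^k for every Q over p. So one can
    choose well separated points whose images under [a] meet all classes modulo
    P^k but one, and which still form an admissible set. Since the image of this
    set must miss a class modulo P^k, H maps singletons to singletons, and after a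
    translation H x is contained in a x for every x; applied to H^-1 as well this
    gives H x = a x. The same argument shows that a^-1 (P^k) is some Q^k. Modulo
    such powers [a] is a multiple of a ring isomorphism between copies of Z/p^k,
    so a x * a y = a 1 * a (x * y) modulo infinitely many P^k, hence exactly:
    [a] is a unit times a field automorphism. *)

From HB Require Import structures.
Require Import Defs.
From mathcomp Require Import all_boot all_order all_algebra all_fingroup all_field.
From mathcomp Require Import all_classical all_reals all_analysis.
From mathcomp Require Import ring lra zify.

Set Implicit Arguments.
Unset Strict Implicit.
Unset Printing Implicit Defensive.

Import Order.TTheory GRing.Theory Num.Theory.

Local Open Scope classical_set_scope.
Local Open Scope ring_scope.

(** New points are prescribed only modulo the subgroup L = a^-1 (P^k). If Q lies over p and Q^k does
    not contain L, each point can still be moved inside its coset of L off a chosen class modulo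
    Q^k; if Q^k contains L, comparing indices gives Q^k = L. Away from p, the new points share one
    residue at the small primes, and a large prime has more classes than there are points. So only
    Q^k = L can obstruct, and there the prescribed classes must themselves leave one free. Hence
    class 0 is spared in the study of singletons and of inclusions, where a second image point or
    the image point 0 fills the gap; and prescribing all classes forces some Q^k to equal L.

    The arithmetic of O is drawn from a Z-basis: lower bounds for the index of P^k come from
    explicit incongruent elements, upper bounds from heights, and primes of degree one from prime
    divisors of the values of an integer polynomial that kills a generator of K. *)

(** * Products and powers of ideals in a commutative ring *)

Section IdealTheory.
Variable R : comNzRingType.
Implicit Types (I J M P : set R) (a x y : R).

Lemma is_idealD I x y : is_ideal I -> I x -> I y -> I (x + y).
Proof. by move=> [_ h] Ix Iy; rewrite -[x]mul1r; apply: h. Qed.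

Lemma is_idealMl I a x : is_ideal I -> I x -> I (a * x).
Proof. by move=> [I0 h] Ix; rewrite -[_ * _]addr0; apply: h. Qed.

Lemma is_idealMr I a x : is_ideal I -> I x -> I (x * a).
Proof. by move=> hI Ix; rewrite mulrC; apply: is_idealMl. Qed.

Lemma is_idealN I x : is_ideal I -> I x -> I (- x).
Proof. by move=> hI Ix; rewrite -mulN1r; apply: is_idealMl. Qed.

Lemma is_idealB I x y : is_ideal I -> I x -> I y -> I (x - y).
Proof. by move=> hI Ix Iy; apply: is_idealD => //; apply: is_idealN. Qed.

Lemma is_idealBC I x y : is_ideal I -> I (x - y) -> I (y - x).
Proof. by move=> hI; rewrite -(opprB x); apply: is_idealN. Qed.

Lemma setT_ideal : is_ideal (@setT R).
Proof. by []. Qed.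

Lemma ideal_mul_mem I J x y : I x -> J y -> ideal_mul I J (x * y).
Proof.
by move=> Ix Jy; exists 1%N, (fun=> x), (fun=> y); rewrite big_ord1.
Qed.

Lemma ideal_mul_sub I J M :
  M 0 -> (forall x y, M x -> M y -> M (x + y)) ->
  (forall x y, I x -> J y -> M (x * y)) -> ideal_mul I J `<=` M.
Proof.
move=> M0 MD h _ [n [u [v [uv ->]]]]; elim/big_ind: _ => // i _.
by have [] := uv i; apply: h.
Qed.

Lemma ideal_mulD I J x y :
  ideal_mul I J x -> ideal_mul I J y -> ideal_mul I J (x + y).
Proof.
move=> [n [u [v [uv ->]]]] [m [u' [v' [uv' ->]]]].
exists (n + m)%N, (fun i : 'I_(n + m) => match fintype.split i with inl j => u j | inr j => u' j end),
  (fun i : 'I_(n + m) => match fintype.split i with inl j => v j | inr j => v' j end); split.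
  by move=> i; case: (fintype.split i).
rewrite big_split_ord; congr (_ + _); apply: eq_bigr => i _ /=.
  by rewrite (unsplitK (inl i)).
by rewrite (unsplitK (inr i)).
Qed.

Lemma ideal_mul_ideal I J : is_ideal I -> is_ideal (ideal_mul I J).
Proof.
move=> hI; split.
  by exists 0%N, (fun=> 0), (fun=> 0); rewrite big_ord0; split=> // -[].
move=> a x y [n [u [v [uv ->]]]]; apply: ideal_mulD.
exists n, (fun i => a * u i), v; split.
  by move=> i; have [Iu Jv] := uv i; split=> //; apply: is_idealMl.
by rewrite big_distrr; apply: eq_bigr => i _ /=; rewrite mulrA.
Qed.

Lemma ideal_exp_ideal I k : is_ideal I -> is_ideal (ideal_exp I k).
Proof. by case: k => [|k] hI; [exact: setT_ideal|exact: ideal_mul_ideal]. Qed.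

Lemma ideal_expS_sub I k : is_ideal I -> ideal_exp I k.+1 `<=` ideal_exp I k.
Proof.
move=> hI; have [e0 _] := ideal_exp_ideal k hI; apply: ideal_mul_sub => //.
- by move=> x y; apply: is_idealD; apply: ideal_exp_ideal.
by move=> x y _; apply: is_idealMl; apply: ideal_exp_ideal.
Qed.

Lemma ideal_exp_sub I k : is_ideal I -> (0 < k)%N -> ideal_exp I k `<=` I.
Proof.
move=> hI; elim: k => // -[|k] IH _ x.
  have [I0 _] := hI; apply: ideal_mul_sub => //.
    by move=> ? ?; apply: is_idealD.
  by move=> ? ? ? _; apply: is_idealMr.
by move/ideal_expS_sub => h; apply: IH => //; exact: h.
Qed.

Lemma ideal_exp_pow I k x : I x -> ideal_exp I k (x ^+ k).
Proof.
move=> Ix; elim: k => // k IH; rewrite exprS.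
exact: ideal_mul_mem.
Qed.

(* An ideal [P] with [P J = c R] behaves like an invertible fractional ideal:
   [P^k J^k = c^k R]. *)
Lemma ideal_exp_inv_sub P J c k : (forall x y, P x -> J y -> exists z, x * y = c * z) ->
  forall x y, ideal_exp P k x -> ideal_exp J k y -> exists z, x * y = c ^+ k * z.
Proof.
move=> h; elim: k => [|k IH] x y; first by exists (x * y); rewrite mul1r.
move=> Px Jy.
have cD (s : R) : forall u v, (exists z, u * s = c ^+ k.+1 * z) ->
    (exists z, v * s = c ^+ k.+1 * z) -> exists z, (u + v) * s = c ^+ k.+1 * z.
  by move=> u v [z1 e1] [z2 e2]; exists (z1 + z2); rewrite mulrDl e1 e2 mulrDr.
move: Px; apply: (@ideal_mul_sub _ _ [set x | exists z, x * y = c ^+ k.+1 * z]).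
- by exists 0; rewrite mul0r mulr0.
- exact: cD.
move=> p x' Pp Px' /=; rewrite mulrC.
move: Jy; apply: (@ideal_mul_sub _ _ [set y | exists z, y * (p * x') = c ^+ k.+1 * z]).
- by exists 0; rewrite mul0r mulr0.
- exact: cD.
move=> j y' Jj Jy' /=.
have [z1 e1] := h _ _ Pp Jj; have [z2 e2] := IH _ _ Px' Jy'.
exists (z1 * z2); rewrite exprS [RHS]mulrACA -e1 -e2 mulrACA.
by rewrite [j * p]mulrC [y' * x']mulrC.
Qed.

Lemma ideal_exp_inv_mem P J c k : ideal_mul P J c ->
  ideal_mul (ideal_exp P k) (ideal_exp J k) (c ^+ k).
Proof.
move=> hc; elim: k => [|k IH]; first by rewrite expr0 -[1]mulr1; apply: ideal_mul_mem.
have [m [u' [v' [uv' e']]]] := IH; have [n [u [v [uv e]]]] := hc.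
rewrite exprS e' e mulr_suml; elim/big_ind: _ => //.
- by exists 0%N, (fun=> 0), (fun=> 0); rewrite big_ord0; split=> // -[].
- by move=> ? ?; apply: ideal_mulD.
move=> i _; rewrite mulr_sumr; elim/big_ind: _ => //.
- by exists 0%N, (fun=> 0), (fun=> 0); rewrite big_ord0; split=> // -[].
- by move=> ? ?; apply: ideal_mulD.
move=> j _; rewrite mulrACA.
have [Pu Jv] := uv i; have [Pu' Jv'] := uv' j.
by apply: ideal_mul_mem; apply: ideal_mul_mem.
Qed.

(** The cofactor is x P^-k. Since P^-1 = c^-1 J, it is written without fractions as the set of m
    with c^k m in x J^k. *)
Lemma ideal_dvd_principal P J c k x :
  is_ideal P -> is_ideal J -> GRing.lreg c ->
  (forall u v, P u -> J v -> exists z, u * v = c * z) -> ideal_mul P J c ->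
  ideal_exp P k x -> ideal_dvd (ideal_exp P k) (principal_ideal x).
Proof.
move=> hP hJ rc PJ cPJ Px.
have rck : GRing.lreg (c ^+ k) by apply: lregX.
have hPJ := ideal_exp_inv_sub PJ (k := k).
have hJk := ideal_exp_ideal k hJ.
pose M := [set m | exists2 v, ideal_exp J k v & c ^+ k * m = x * v].
exists M.
  split; first by exists 0; rewrite ?mulr0 //; case: hJk.
  move=> a m1 m2 [v1 Jv1 e1] [v2 Jv2 e2]; exists (a * v1 + v2).
    by apply: is_idealD => //; apply: is_idealMl.
  by rewrite !mulrDr mulrCA e1 e2 mulrCA.
apply/seteqP; split.
  move=> _ [a _ <-]; apply: is_idealMl; first exact/ideal_mul_ideal/ideal_exp_ideal.
  have [n [u [v [uv e]]]] := ideal_exp_inv_mem k cPJ.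
  have hm i : {m | c ^+ k * m = x * v i}.
    by have [_ Jv] := uv i; apply: cid; have [z ->] := hPJ _ _ Px Jv; exists z.
  exists n, u, (fun i => sval (hm i)); split.
    by move=> i; have [Pu Jv] := uv i; split=> //; exists (v i) => //; exact: (svalP (hm i)).
  apply: rck; rewrite mulr_sumr mulrC [in LHS]e mulr_sumr; apply: eq_bigr => i _.
  by rewrite [RHS]mulrCA (svalP (hm i)) mulrCA.
apply: ideal_mul_sub.
- by exists 0 => //; rewrite mul0r.
- by move=> _ _ [a _ <-] [a' _ <-]; exists (a + a') => //; rewrite mulrDl.
move=> u m Pu [v Jv e]; have [z ez] := hPJ _ _ Pu Jv.
exists z => //; apply: rck.
by rewrite [RHS]mulrCA e [RHS]mulrCA ez mulrA [RHS]mulrC.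
Qed.

End IdealTheory.

(** * Integrality, nonzero primes and the rational primes below them *)

Section Integers.
Variable K : fieldExtType rat.
Local Notation O := (ring_of_integers K).

Lemma intK_eq0 (n : int) : ((n%:~R : K) == 0) = (n == 0).
Proof. by rewrite -(rmorph_int (in_alg K)) fmorph_eq0 intr_eq0. Qed.

Lemma intO_eq0 (n : int) : ((n%:~R : O) == 0) = (n == 0).
Proof. by rewrite -(inj_eq val_inj) rmorph_int rmorph0 intK_eq0. Qed.

Lemma valO_eq0 (x : O) : (val x == 0) = (x == 0).
Proof. by rewrite -(inj_eq val_inj) rmorph0. Qed.

Lemma natO_eq0 (n : nat) : ((n%:R : O) == 0) = (n == 0)%N.
Proof. by rewrite pmulrn intO_eq0. Qed.

Lemma mulO_eq0 (x y : O) : (x * y == 0) = (x == 0) || (y == 0).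
Proof. by rewrite -!(inj_eq val_inj) rmorphM !rmorph0 mulf_eq0. Qed.

Lemma lregO (x : O) : x != 0 -> GRing.lreg x.
Proof.
move=> x0 y z /eqP; rewrite -subr_eq0 -mulrBr mulO_eq0 (negPf x0) /=.
by rewrite subr_eq0 => /eqP.
Qed.

(** The determinant trick: x is an eigenvalue of an integer matrix, hence a root of its
    characteristic polynomial; [v i0 != 0] makes the eigenvector nonzero. *)
Lemma integral_of_finite_module (x : K) (T : finType) (v : T -> K)
    (a : T -> T -> int) (i0 : T) : v i0 != 0 ->
  (forall i, x * v i = \sum_j v j * (a j i)%:~R) -> x \in @integral_elt K.
Proof.
move=> v0 h; apply/asboolP.
pose A : 'M[int]_#|T| := \matrix_(i, j) a (enum_val i) (enum_val j).
exists (char_poly A); first exact: char_poly_monic.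
rewrite map_char_poly -eigenvalue_root_char; apply/eigenvalueP.
exists (\row_j v (enum_val j)).
  apply/rowP => j; rewrite !mxE h (reindex (@enum_val T xpredT)) /=; last first.
    by apply: onW_bij; apply: enum_val_bij.
  by apply: eq_bigr => i _; rewrite !mxE.
apply/eqP => /rowP/(_ (enum_rank i0)); rewrite !mxE enum_rankK => /eqP.
by rewrite (negPf v0).
Qed.

Lemma exists_int_poly (y : K) :
  exists2 p : {poly int}, p != 0 & (map_poly intr p).[y] = 0.
Proof.
have /polyOver1P[q eq] := minPolyOver 1 y.
have [p [a a0 ep]] := rat_poly_scale q.
have := root_minPoly 1 y; rewrite eq ep => /rootP.
have aK : (a%:~R : rat)^-1 != 0 by rewrite invr_eq0 intr_eq0.
rewrite map_polyZ hornerZ => /eqP; rewrite mulf_eq0 fmorph_eq0 (negPf aK) orFb.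
move=> /eqP e; exists p.
  apply/eqP => p0; have := monic_minPoly 1 y; rewrite eq ep p0.
  by rewrite map_poly0 scaler0 map_poly0 monicE lead_coef0 eq_sym oner_eq0.
rewrite -[RHS]e -map_poly_comp; congr (_.[y]); apply: eq_map_poly => z /=.
by rewrite -(rmorph_int (in_alg K)).
Qed.

(** Let a be the leading coefficient of an integer polynomial of degree n + 1 killing y.
    Multiplication by a y preserves the Z-span of 1, y, ..., y^n, because the polynomial rewrites a
    y^(n+1) in lower powers. *)
Lemma exists_integral_multiple (y : K) :
  exists D : int, D != 0 /\ exists z : O, val z = D%:~R * y.
Proof.
have [p p0 py] := exists_int_poly y.
pose a := lead_coef p; have a0 : a != 0 by rewrite lead_coef_eq0.
exists a; split=> //.
suff yO : a%:~R * y \in @integral_elt K by exists (exist (fun x => x \in @integral_elt K) _ yO).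
case sp : (size p) => [|n]; first by move/eqP: sp; rewrite size_poly_eq0 (negPf p0).
have ep : a%:~R * y ^+ n = - \sum_(i < n) (p`_i)%:~R * y ^+ i.
  apply/eqP; rewrite -subr_eq0 opprK; apply/eqP.
  rewrite -[RHS]py (@horner_coef_wide _ n.+1); last first.
    by rewrite size_map_poly_id0 ?sp // intK_eq0.
  rewrite big_ord_recr /= [LHS]addrC; congr (_ + _).
    by apply: eq_bigr => i _; rewrite coef_map.
  by rewrite coef_map /a /lead_coef sp.
case: n sp ep => [|n] sp ep.
  move/eqP: ep; rewrite expr0 mulr1 big_ord0 oppr0 intK_eq0.
  by rewrite (negPf a0).
apply: (@integral_of_finite_module _ 'I_n.+1 (fun i => y ^+ i)
  (fun j i => if (i == n :> nat) then - p`_j else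
              if (j == i.+1 :> nat) then a else 0) ord0).
  by rewrite expr0 oner_eq0.
move=> i; rewrite -mulrA -exprS; have [ein|nin] := eqVneq (i : nat) n.
  rewrite ein ep -sumrN; apply: eq_bigr => j _.
  by rewrite mulrC -mulrN rmorphN.
have lin : (i.+1 < n.+1)%N by rewrite ltnS ltn_neqAle nin -ltnS ltn_ord.
rewrite (bigD1 (Ordinal lin)) //= eqxx [LHS]mulrC big1 ?addr0 // => j nj.
by rewrite ifN ?mulr0 // (contra _ nj) // => /eqP e; apply/eqP/val_inj.
Qed.

Lemma val_horner (p : {poly int}) (x : O) :
  val (map_poly intr p).[x] = (map_poly intr p).[val x].
Proof.
transitivity (map_poly (val : O -> K) (map_poly intr p)).[val x].
  by rewrite horner_map.
rewrite -map_poly_comp; congr (_.[_]).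
by apply: eq_map_poly => z; exact: (rmorph_int (val : O -> K)).
Qed.

(** The constant term of a polynomial killing x is a multiple of x; factors X are divided out until
    it is nonzero. *)
Lemma exists_int_multiple (x : O) : x != 0 ->
  exists w : O, exists2 c : int, c != 0 & x * w = c%:~R.
Proof.
move=> x0; have [p p0 px] := exists_int_poly (val x).
have {}px : (map_poly intr p).[x] = 0 by apply: val_inj; rewrite val_horner px.
elim/poly_ind: p p0 px => [|p c IH]; first by rewrite eqxx.
rewrite rmorphD rmorphM /= map_polyX map_polyC hornerMXaddC /=.
have [->|c0] := eqVneq c 0.
  rewrite addr0 rmorph0 addr0 => pX /eqP; rewrite mulO_eq0 (negPf x0) orbF => /eqP.
  by apply: IH; apply: contraNneq pX => ->; rewrite mul0r.
move=> _ e; exists (- (map_poly intr p).[x]), c => //.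
by apply/eqP; rewrite mulrN mulrC eq_sym -addr_eq0 addrC e.
Qed.

(** Primes as predicates on sets, so that inverse images and members of indexed families need no
    packed structure. *)
Definition nz_prime (P : set O) :=
  [/\ is_ideal P, ~ P 1, forall x y, P (x * y) -> P x \/ P y
    & exists2 y, P y & y != 0].

Lemma nz_prime_ideal P : nz_prime P -> is_ideal P. Proof. by case. Qed.

Lemma nz_prime_exp_ideal P k : nz_prime P -> is_ideal (ideal_exp P k).
Proof. by move/nz_prime_ideal/ideal_exp_ideal. Qed.
Hint Resolve nz_prime_ideal nz_prime_exp_ideal : core.

Definition lies_over (q : nat) (P : set O) :=
  [/\ prime q, nz_prime P & P q%:R].

Lemma nz_prime_over P : nz_prime P -> exists q, lies_over q P.
Proof.
move=> hP; have [iP P1 Pm [y Py y0]] := hP.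
have [w [c c0 e]] := exists_int_multiple y0.
have n0 : (0 < `|c|)%N by rewrite absz_gt0.
have : P (`|c|%N)%:R.
  have : P (c%:~R) by rewrite -e; apply: is_idealMr.
  by case: (c) => n //; rewrite NegzE rmorphN => /(is_idealN iP); rewrite opprK.
have [n] := ubnP `|c|%N; elim: n `|c|%N n0 => // n IH m m0; rewrite ltnS => mn Pm0.
have [m1|m1] := leqP m 1.
  by case: P1; move: Pm0; rewrite (_ : m = 1)%N //; apply/eqP; rewrite eqn_leq m1.
move: Pm0; rewrite -{1}(divnK (pdiv_dvd m)) natrM => /Pm[Pd|Pp]; last first.
  by exists (pdiv m); split=> //; apply: pdiv_prime.
apply: IH Pd; first by rewrite divn_gt0 ?pdiv_gt0 // dvdn_leq ?pdiv_dvd.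
by apply: leq_trans mn; rewrite ltn_Pdiv // prime_gt1 // pdiv_prime.
Qed.

Lemma over_natE q P n : lies_over q P -> P n%:R <-> (q %| n)%N.
Proof.
move=> [qP [iP P1 Pm _] Pq]; split; last first.
  by move=> /dvdnP[m ->]; rewrite natrM; apply: is_idealMl.
move=> Pn; apply/negPn/negP; rewrite -prime_coprime // => /coprimeP.
move=> /(_ (prime_gt0 qP))[[u v] /= e]; apply: P1.
have -> : 1 = u%:R * q%:R - v%:R * n%:R :> O.
  by rewrite -!natrM -natrB; [rewrite e | rewrite leqNgt; apply/negP; lia].
by apply: is_idealB => //; apply: is_idealMl.
Qed.

Lemma over_intE q P n : lies_over q P -> P n%:~R <-> (q %| `|n|)%N.
Proof.
move=> h; rewrite -(over_natE _ h); have [_ [iP _ _ _] _] := h.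
case: n => n //=; rewrite NegzE rmorphN /=.
by split=> /(is_idealN iP); rewrite ?opprK.
Qed.

End Integers.
#[export] Hint Resolve nz_prime_ideal nz_prime_exp_ideal : core.

(** * Coordinates in a Z-basis, finiteness modulo n, invertibility of primes *)

Section Box.
Variables (K : fieldExtType rat) (d : nat).
Local Notation O := (ring_of_integers K).
Variables (b : 'I_d -> O) (hb : is_Zbasis b).

Definition coords (x : O) : 'rV[int]_d := sval (cid (hb x)).

Lemma coordsK x : lattice_elt b (coords x) = x.
Proof. by rewrite /coords; case: (cid (hb x)) => z [/= ->]. Qed.

Lemma latticeK z : coords (lattice_elt b z) = z.
Proof. by rewrite /coords; case: (cid (hb _)) => z' [/= _ h]; apply: h. Qed.

Lemma lattice_eltD z z' : lattice_elt b (z + z') = lattice_elt b z + lattice_elt b z'.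
Proof. by rewrite -big_split; apply: eq_bigr => i _; rewrite mxE mulrzDr. Qed.

Lemma lattice_eltN z : lattice_elt b (- z) = - lattice_elt b z.
Proof. by rewrite -sumrN; apply: eq_bigr => i _; rewrite mxE mulrNz. Qed.

Lemma lattice_elt0 : lattice_elt b 0 = 0.
Proof. by rewrite /lattice_elt big1 // => i _; rewrite mxE mulr0z. Qed.

Lemma coordsD x y : coords (x + y) = coords x + coords y.
Proof. by rewrite -[RHS]latticeK lattice_eltD !coordsK. Qed.

Lemma coordsN x : coords (- x) = - coords x.
Proof. by rewrite -[RHS]latticeK lattice_eltN !coordsK. Qed.

(** The elements with coordinates in [0, n): representatives modulo n, and later the search region
    of the sieve. *)
Definition box n (f : {ffun 'I_d -> 'I_n}) : O := \sum_i b i *+ f i.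

Lemma box_repr n x : (0 < n)%N -> exists f : {ffun 'I_d -> 'I_n}, exists y, x = box f + n%:R * y.
Proof.
move=> n0; pose z := coords x.
have hlt i : (`|(z 0%R i %% n)%Z| < n)%N.
  by rewrite -ltz_nat gez0_abs ?modz_ge0 ?ltz_pmod //; case: (n) n0.
exists [ffun i => Ordinal (hlt i)], (\sum_i b i *~ (z 0%R i %/ n)%Z).
rewrite -[LHS]coordsK mulr_sumr -big_split; apply: eq_bigr => i _ /=.
rewrite ffunE /= pmulrn gez0_abs ?modz_ge0 //; last by case: (n) n0.
rewrite mulr_natl pmulrn -mulrzA -mulrzDr; congr (_ *~ _).
by rewrite {1}(divz_eq (z 0 i) n) addrC.
Qed.

Lemma card_mod_le (T : finType) n (g : T -> O) : (0 < n)%N ->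
  (forall s t y, g s - g t = n%:R * y -> s = t) -> (#|T| <= n ^ d)%N.
Proof.
move=> n0 gI; pose h t := sval (cid (box_repr (g t) n0)).
have hI : injective h.
  move=> s t; rewrite /h; case: cid => f [y ey] /=; case: cid => f' [y' ey'] /= ff'.
  by apply: (gI s t (y - y')); rewrite ey ey' ff' opprD addrACA subrr add0r mulrBr.
by have := leq_card h hI; rewrite card_ffun !card_ord.
Qed.

Lemma pow_collision n (x : O) : (0 < n)%N ->
  exists i j y, (i < j)%N /\ x ^+ i - x ^+ j = n%:R * y.
Proof.
move=> n0; apply: contrapT => h.
suff : (#|'I_(n ^ d).+1| <= n ^ d)%N by rewrite card_ord ltnn.
apply: (@card_mod_le _ n (fun i : 'I_(n ^ d).+1 => x ^+ i) n0) => s t y e.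
apply/val_inj/eqP/negPn/negP; rewrite neq_ltn => /orP[lt|lt]; apply: h.
  by exists s, t, y.
by exists t, s, (- y); rewrite mulrN -e opprB.
Qed.

(** A finite integral domain is a field: two powers of x agree modulo P, and cancelling exhibits a
    power of x as its inverse. *)
Lemma nz_prime_max (P : set O) x : nz_prime P -> ~ P x -> exists y, P (1 - x * y).
Proof.
move=> hP Px; have [q [qP _ Pq]] := nz_prime_over hP; have [iP P1 Pm _] := hP.
have [i [j [y [lt e]]]] := pow_collision x (prime_gt0 qP).
have : P (x ^+ i * (1 - x ^+ (j - i))).
  by rewrite mulrBr mulr1 -exprD subnKC 1?ltnW // e; apply: is_idealMr.
have Pxn n : ~ P (x ^+ n).
  by elim: n => [|n IH]; rewrite ?expr0 // exprS => /Pm[].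
move=> /Pm[/Pxn//|]; rewrite -(subnSK lt) exprS => h.
by exists (x ^+ (j - i.+1)).
Qed.

(* In the finite ring O/q, an annihilator that is maximal among those contained
   in a prime P is P itself. *)
Lemma exists_annihilator (P : set O) q : lies_over q P ->
  exists c, (forall w, c <> q%:R * w) /\ forall y, P y -> exists w, c * y = q%:R * w.
Proof.
move=> [qP hP Pq]; have [iP P1 Pm _] := hP; have q0 := prime_gt0 qP.
pose Ann c : set O := [set z | exists w, c * z = q%:R * w].
have AnnI c : is_ideal (Ann c).
  split; first by exists 0; rewrite !mulr0.
  move=> a x y [w e] [w' e']; exists (a * w + w').
  by rewrite !mulrDr mulrCA e e' mulrCA.
have Annq c : Ann c q%:R by exists c; rewrite mulrC.
(* Annihilators contain q, so they are unions of classes modulo q; counting these classes reduces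
   maximality to that of a number. *)
pose m c := #|[pred f : {ffun 'I_d -> 'I_q} | `[<Ann c (box f)>]]|.
have Ann_mod c f y : Ann c (box f + q%:R * y) <-> Ann c (box f).
  split=> h; last by apply: is_idealD => //; apply: is_idealMr.
  by rewrite -(addrK (q%:R * y) (box f)); apply: is_idealB => //; apply: is_idealMr.
have m_max c c' : Ann c `<=` Ann c' -> (m c' <= m c)%N -> Ann c' `<=` Ann c.
  move=> sub le x; have [f [y ->]] := box_repr x q0; rewrite !Ann_mod => h.
  have subs : [pred f : {ffun 'I_d -> 'I_q} | `[<Ann c (box f)>]] \subset [pred f | `[<Ann c' (box f)>]].
    by apply/fintype.subsetP => g; rewrite !inE; apply: sub.
  have [_] := subset_leqif_card subs.
  rewrite eqn_leq le andbT subset_leq_card // => /esym/fintype.subsetP/(_ f).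
  by rewrite !inE; apply.
pose good n := `[< exists2 c, Ann c `<=` P & m c = n >].
have ex : exists n, good n.
  exists (m 1); apply/asboolP; exists 1 => // z [w].
  by rewrite mul1r => ->; apply: is_idealMr.
have ub n : good n -> (n <= #|{ffun 'I_d -> 'I_q}|)%N.
  by move=> /asboolP[c _ <-]; apply: max_card.
case: (ex_maxnP ex ub) => n /asboolP[c cP cn] cmax.
have cm c' : Ann c' `<=` P -> (m c' <= m c)%N.
  by move=> h; rewrite cn; apply: cmax; apply/asboolP; exists c'.
exists c; split.
  by move=> w ew; apply/P1/cP; exists w; rewrite mulr1.
(* If Ann (c y) is inside P, it equals Ann c by maximality, so y can be cancelled modulo Ann c. Two
   powers of y agreeing modulo q then put some 1 - y^(j-i) in Ann c, hence in P, although y is in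
   P. *)
move=> y Py; have [sub|] := pselect (Ann (c * y) `<=` P).
  have A z : Ann c (y * z) -> Ann c z.
    move=> [w e]; apply: (m_max c (c * y)); last by exists w; rewrite -mulrA.
      by move=> u [v ev]; exists (v * y); rewrite mulrAC ev mulrA.
    exact: cm.
  have An z i : Ann c (y ^+ i * z) -> Ann c z.
    by elim: i z => [|i IH] z; rewrite ?mul1r // exprS -mulrA => /A/IH.
  have [i [j [z [lt e]]]] := pow_collision y q0.
  have : Ann c (y ^+ i * (1 - y ^+ (j - i))).
    by rewrite mulrBr mulr1 -exprD subnKC 1?ltnW // e; apply: is_idealMr.
  move=> /An/cP; rewrite -(subnSK lt) exprS => h; case: P1.
  rewrite -[1](subrK (y * y ^+ (j - i.+1))); apply: is_idealD => //.
  exact: is_idealMr.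
(* Otherwise c y u vanishes modulo q for some u outside P. Then Ann (c u) is inside P and contains
   Ann c, so they are equal; and y is in Ann (c u). *)
move=> /existsNP[u /not_implyP[[w ew] Pu]].
apply: (m_max c (c * u)); last by exists w; rewrite -ew mulrAC.
  by move=> v [v' ev]; exists (v' * u); rewrite mulrAC ev mulrA.
apply: cm => z [v e]; have /cP/Pm[] // : Ann c (u * z) by exists v; rewrite mulrA.
Qed.

(** If (c / q) P were inside P, a nonzero finitely generated Z-module, c / q would be integral and c
    would lie in q O. *)
Lemma annihilator_not_stable (P : set O) q c : lies_over q P -> (forall w, c <> q%:R * w) ->
  (forall y, P y -> exists w, c * y = q%:R * w) ->
  exists p w, [/\ P p, c * p = q%:R * w & ~ P w].
Proof.
move=> [qP hP Pq] cq cP; have [iP P1 Pm _] := hP; have q0 := prime_gt0 qP.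
apply: contrapT => h.
have {}h p w : P p -> c * p = q%:R * w -> P w.
  by move=> Pp e; apply: contrapT => Pw; apply: h; exists p, w.
have qR0 : (q%:R : O) != 0 by rewrite natO_eq0 -lt0n.
have qK0 : val (q%:R : O) != 0 by rewrite valO_eq0.
(* Generators of P over Z: the q b_i and the representatives modulo q that lie in P. *)
pose T := ('I_d + {f : {ffun 'I_d -> 'I_q} | `[<P (box f)>]})%type.
pose gen (t : T) : O := match t with inl i => q%:R * b i | inr f => box (val f) end.
have Pgen t : P (gen t).
  by case: t => [i|f] /=; [apply: is_idealMr | apply: asboolW; apply: (valP f)].
have span w : P w -> {a : T -> int | w = \sum_t gen t *~ a t}.
  move=> Pw; apply: cid; have [f [y ew]] := box_repr w q0.
  have Pf : `[<P (box f)>].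
    by apply/asboolT; rewrite -(addrK (q%:R * y) (box f)) -ew; apply: is_idealB => //; apply: is_idealMr.
  exists (fun t => match t with inl i => coords y 0 i | inr g => (val g == f : nat)%:Z end).
  rewrite big_sumType ew addrC; congr (_ + _).
    rewrite -{1}(coordsK y) mulr_sumr; apply: eq_bigr => i _ /=.
    by rewrite mulrzAr.
  rewrite (bigD1 (exist (fun f => `[<P (box f)>]) f Pf)) //= eqxx big1 ?addr0 // => g /eqP ng.
  by case: eqP => // e; case: ng; apply: val_inj.
have step t : {w | c * gen t = q%:R * w} by apply: cid; apply: cP.
have Pw t : P (sval (step t)) by apply: h (svalP (step t)).
pose a j t := sval (span _ (Pw t)) j.
have [t0 t00] : exists t, gen t != 0.
  apply: contrapT => /forallNP g0; have [e eq] := span _ Pq.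
  case/eqP: qR0; rewrite eq big1 // => t _; have /negP := g0 t.
  by rewrite negbK => /eqP->; rewrite mul0rz.
have : val c / val (q%:R : O) \in @integral_elt K.
  apply: (@integral_of_finite_module _ _ T (fun t => val (gen t)) a t0).
    by rewrite valO_eq0.
  move=> t; rewrite mulrAC -rmorphM (svalP (step t)) rmorphM mulrAC divff // mul1r.
  rewrite {1}(svalP (span _ (Pw t))) rmorph_sum; apply: eq_bigr => j _.
  by rewrite rmorphMz -mulrzr.
move=> zO; apply: (cq (exist (fun x => x \in @integral_elt K) _ zO)).
by apply: val_inj; rewrite rmorphM /= mulrCA divff ?mulr1.
Qed.

(** The inverse of P is q^-1 J with J = q O + c O. As w = c p / q is outside the maximal ideal P,
    some 1 - w y is in P, and q = (1 - w y) q + (p y) c exhibits q in P J. *)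
Lemma nz_prime_invertible (P : set O) q : lies_over q P -> exists J,
  [/\ is_ideal J, forall x y, P x -> J y -> exists z, x * y = q%:R * z
    & ideal_mul P J q%:R].
Proof.
move=> hq; have [qP hP Pq] := hq; have [iP P1 Pm _] := hP.
have [c [cq cP]] := exists_annihilator hq.
have [p [w [Pp e Pw]]] := annihilator_not_stable hq cq cP.
exists [set x | exists u v, x = u * q%:R + v * c]; split.
- split; first by exists 0, 0; rewrite !mul0r addr0.
  move=> a _ _ [u [v ->]] [u' [v' ->]]; exists (a * u + u'), (a * v + v').
  by ring.
- move=> x _ Px [u [v ->]]; have [z ez] := cP _ Px; exists (x * u + v * z).
  transitivity (q%:R * (x * u) + v * (c * x)); first by ring.
  by rewrite ez; ring.
have [y Py] := nz_prime_max hP Pw.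
have e1 : q%:R = (1 - w * y) * q%:R + (p * y) * c :> O.
  transitivity ((1 - w * y) * q%:R + y * (c * p)); last by ring.
  by rewrite e; ring.
rewrite [X in ideal_mul _ _ X]e1; apply: ideal_mulD; apply: ideal_mul_mem => //.
- by exists 1, 0; rewrite mul1r mul0r addr0.
- exact: is_idealMr.
- by exists 0, 1; rewrite mul1r mul0r add0r.
Qed.

End Box.

(** * Powers of primes: divisibility, incongruent elements, Chinese remainders *)

Section PrimePowers.
Variables (K : fieldExtType rat) (d : nat).
Local Notation O := (ring_of_integers K).
Variables (b : 'I_d -> O) (hb : is_Zbasis b).
Implicit Types (P Q : set O) (x y : O).

Lemma nz_prime_of_prime_idealr (P : prime_idealr O) :
  (exists2 y, P y & y != 0) -> nz_prime [set y | P y].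
Proof.
move=> hy; split=> //=.
- split=> [|a x y Px Py] /=; first exact: (@rpred0 _ P).
  by apply: (@rpredD _ P) => //; apply: (@ring_quotient.idealMr _ P).
- by have /negP := negbT (@ring_quotient.idealr1 _ P).
- move=> x y Pxy; apply/orP; have <- : _ = _ || _ := prime_idealrM P x y.
  exact: Pxy.
Qed.

Lemma prime_idealr_of_nz_prime P : nz_prime P ->
  exists2 P' : prime_idealr O, exists2 y, P' y & y != 0 & [set y | P' y] = P.
Proof.
move=> [iP P1 Pm [y Py y0]]; pose p : O -> bool := fun x => `[<P x>].
have h1 : idealr_closed p.
  split; first by apply/asboolP; case: iP.
    by apply/asboolP.
  by move=> a u v /asboolP Pu /asboolP Pv; apply/asboolP; case: iP => _; apply.
have h2 : prime_idealr_closed p.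
  by move=> u v /asboolP/Pm[]/asboolP pu; apply/orP; [left|right].
pose M1 := isIdealr.Build O p h1; pose M2 := isPrimeIdealrClosed.Build O p h2.
pose P' : prime_idealr O := HB.pack p M1 M2.
exists P'; first by exists y => //; apply/asboolP.
by apply/seteqP; split => x /= /asboolP.
Qed.

(** To contain is to divide: invertibility of P turns membership in P^k into divisibility by P^k.
    From here on only membership is used. *)
Lemma k_freeP k x : k_free k x <-> x != 0 /\ forall P, nz_prime P -> ~ ideal_exp P k x.
Proof.
split=> [[x0 h]|[x0 h]]; split=> // P.
  move=> hP Px; have [P' hy eP] := prime_idealr_of_nz_prime hP.
  apply: (h P' hy); rewrite eP; have [q hq] := nz_prime_over hP.
  have [J [iJ PJ mJ]] := nz_prime_invertible hb hq.
  have q0 : (q%:R : O) != 0 by case: hq => /prime_gt0; rewrite natO_eq0 lt0n.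
  by apply: (ideal_dvd_principal _ iJ (lregO q0)) => //; case: hP.
move=> hy [M iM e]; have hP := nz_prime_of_prime_idealr hy; apply: (h _ hP).
have : principal_ideal x x by exists 1 => //; rewrite mul1r.
rewrite e; have hPk := nz_prime_exp_ideal k hP.
apply: ideal_mul_sub; first by case: hPk.
  by move=> *; apply: is_idealD.
by move=> *; apply: is_idealMr.
Qed.

Lemma exp_prime_mul P k n x q : lies_over q P -> coprime n q ->
  ideal_exp P k (n%:R * x) -> ideal_exp P k x.
Proof.
move=> [qP hP Pq] co h; have iPk := nz_prime_exp_ideal k hP.
have : coprime n (q ^ k) by apply: coprimeXr.
rewrite coprime_sym => /coprimeP; rewrite expn_gt0 prime_gt0 // => /(_ isT)[[u v] /= e].
have -> : x = (u%:R * x) * (q%:R ^+ k) - v%:R * (n%:R * x).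
  transitivity ((u * q ^ k - v * n)%:R * x); first by rewrite e mul1r.
  by rewrite natrB ?natrM ?natrX; [ring | rewrite leqNgt; apply/negP; lia].
by apply: is_idealB => //; apply: is_idealMl => //; apply: ideal_exp_pow.
Qed.

(** If P^k = P^(k+1), multiplying by J^k puts q^k in q^k P, hence 1 in P. *)
Lemma exp_prime_strict P k : nz_prime P ->
  exists2 y, ideal_exp P k y & ~ ideal_exp P k.+1 y.
Proof.
move=> hP; apply: contrapT => h; have [q hq] := nz_prime_over hP.
have [J [iJ PJ mJ]] := nz_prime_invertible hb hq.
have [qP _ Pq] := hq; have [iP P1 Pm _] := hP.
have sub : ideal_exp P k `<=` ideal_exp P k.+1.
  by move=> y Py; apply: contrapT => nPy; apply: h; exists y.
have iPk := nz_prime_exp_ideal k hP.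
have q0 : (q%:R : O) != 0 by case: hq => /prime_gt0; rewrite natO_eq0 lt0n.
have : ideal_mul (ideal_exp P k.+1) (ideal_exp J k) (q%:R ^+ k).
  have [n [u [v [uv ->]]]] := ideal_exp_inv_mem k mJ.
  exists n, u, v; split=> // i; have [Pu Jv] := uv i; split=> //; exact: sub.
suff S : ideal_mul (ideal_exp P k.+1) (ideal_exp J k) `<=`
    [set z | exists2 p, P p & z = q%:R ^+ k * p].
  move=> /S[p Pp e]; apply: P1.
  suff -> : 1 = p by [].
  by apply: (@lregO K (q%:R ^+ k)); rewrite ?expf_neq0 // ?mulr1 // -natrX natO_eq0 expn_eq0 -(natO_eq0 K) (negPf q0).
have D (s : O) : forall u v, (exists2 p, P p & u * s = q%:R ^+ k * p) ->
   (exists2 p, P p & v * s = q%:R ^+ k * p) -> (exists2 p, P p & (u + v) * s = q%:R ^+ k * p).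
  move=> u v [p Pp e] [p' Pp' e']; exists (p + p'); first exact: is_idealD.
  by rewrite mulrDl e e' mulrDr.
apply: ideal_mul_sub.
- by exists 0; [case: iP | rewrite mulr0].
- by move=> x y hx hy; have := D 1 x y; rewrite !mulr1; apply.
move=> x y + Jy.
apply: (@ideal_mul_sub _ _ _ [set x | exists2 p, P p & x * y = q%:R ^+ k * p]).
- by exists 0; [case: iP | rewrite mul0r mulr0].
- exact: D.
move=> p u Pp Pu; have [z ez] := ideal_exp_inv_sub PJ Pu Jy.
by exists (p * z); [apply: is_idealMr | rewrite -mulrA ez mulrCA].
Qed.

(** The index of P^k is at least q^k. A number below q^(k+1) is split into i / q, encoded modulo
    P^k, and a last digit i mod q, encoded as a multiple of some y in P^k outside P^(k+1). *)
Lemma exp_prime_incongruent P q k : lies_over q P ->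
  exists g : nat -> O, forall i j, (i < q ^ k)%N -> (j < q ^ k)%N ->
    ideal_exp P k (g i - g j) -> i = j.
Proof.
move=> hq; have [qP hP Pq] := hq; elim: k => [|k [g hg]].
  by exists (fun=> 0) => -[|i] [|j].
have [y Py nPy] := exp_prime_strict k hP.
have iPk := nz_prime_exp_ideal k hP; have iPk1 := nz_prime_exp_ideal k.+1 hP.
exists (fun i => g (i %/ q)%N + y * (i %% q)%:R) => i j; rewrite expnSr => hi hj h.
have q0 := prime_gt0 qP.
have e1 : (i %/ q = j %/ q)%N.
  apply: hg; rewrite ?ltn_divLR //.
  have -> : g (i %/ q)%N - g (j %/ q)%N =
    (g (i %/ q)%N + y * (i %% q)%:R - (g (j %/ q)%N + y * (j %% q)%:R)) +
    y * ((j %% q)%:R - (i %% q)%:R) by ring.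
  apply: is_idealD => //; last exact: is_idealMr.
  by apply: ideal_expS_sub => //; case: hP.
suff e2 : (i %% q = j %% q)%N by rewrite (divn_eq i q) e1 e2 -divn_eq.
have {}h : ideal_exp P k.+1 (y * (i %% q)%:R - y * (j %% q)%:R).
  by move: h; rewrite e1 opprD addrACA subrr add0r.
have key m n : (m < n)%N -> (n < q)%N ->
    ~ ideal_exp P k.+1 (y * n%:R - y * m%:R).
  move=> mn nq; rewrite -mulrBr -natrB 1?ltnW // mulrC.
  move=> /(exp_prime_mul hq) hh; apply: nPy; apply: hh.
  rewrite coprime_sym prime_coprime // gtnNdvd ?subn_gt0 //.
  exact: leq_ltn_trans (leq_subr _ _) nq.
have [lt|lt|//] := ltngtP (i %% q)%N (j %% q)%N.
  by case: (key _ _ lt (ltn_pmod _ q0)); apply: is_idealBC.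
by case: (key _ _ lt (ltn_pmod _ q0)).
Qed.

Lemma comaximal_exp P Q k : nz_prime P -> nz_prime Q -> P <> Q ->
  exists2 e, ideal_exp P k e & ideal_exp Q k (1 - e).
Proof.
move=> hP hQ PQ; have [iP P1 Pm _] := hP; have [iQ Q1 Qm _] := hQ.
have [x Px Qx] : exists2 x, P x & ~ Q x.
  apply: contrapT => h; apply: PQ; apply/seteqP.
  have PsubQ : P `<=` Q by move=> x Px; apply: contrapT => Qx; apply: h; exists x.
  split=> // x Qx; apply: contrapT => /(nz_prime_max hb hP)[y /PsubQ Qy]; apply: Q1.
  by rewrite -[1](subrK (x * y)); apply: is_idealD => //; apply: is_idealMr.
have [y Qy] := nz_prime_max hb hQ Qx.
have Pu : ideal_exp P k ((x * y) ^+ k) by apply: ideal_exp_pow; apply: is_idealMr.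
have iPk := nz_prime_exp_ideal k hP; have iQk := nz_prime_exp_ideal k hQ.
have Qu : Q (1 - (x * y) ^+ k).
  by rewrite -[1](expr1n _ k) subrXX; apply: is_idealMr.
(* With t = (x y)^k in P^k and 1 - t in Q, the element 1 - (1 - t)^k is a multiple of t and differs
   from 1 by (1 - t)^k. *)
exists (1 - (1 - (x * y) ^+ k) ^+ k); last first.
  by rewrite subKr; apply: ideal_exp_pow.
rewrite -{1}[1](expr1n _ k) subrXX subKr.
exact: is_idealMr.
Qed.

Lemma prime_power_crt k r (Q : 'I_r -> set O) (c : 'I_r -> O) :
  injective Q -> (forall i, nz_prime (Q i)) ->
  exists x, forall i, ideal_exp (Q i) k (x - c i).
Proof.
move=> Qinj hQ.
have h i j : {e | i != j -> ideal_exp (Q j) k e /\ ideal_exp (Q i) k (1 - e)}.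
  apply: cid; have [->|ij] := eqVneq i j; first by exists 0.
  have [|||e h1 h2] := @comaximal_exp (Q j) (Q i) k => //; last by exists e.
  by move=> /Qinj e; rewrite e eqxx in ij.
have iQ i := nz_prime_exp_ideal k (hQ i).
pose e i := \prod_(j | i != j) sval (h i j).
have e1 i : ideal_exp (Q i) k (1 - e i).
  rewrite /e; elim/big_ind: _ => [|x y hx hy|j /(svalP (h i j))[]//].
    by rewrite subrr; case: (iQ i).
  have -> : 1 - x * y = (1 - x) + x * (1 - y) by ring.
  by apply: is_idealD => //; apply: is_idealMl.
have e0 i j : i != j -> ideal_exp (Q j) k (e i).
  move=> ij; rewrite /e (bigD1 j) //=; apply: is_idealMr => //.
  by have [] := svalP (h i j) ij.
exists (\sum_i c i * e i) => j; rewrite (bigD1 j) //=.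
have -> (s : O) : c j * e j + s - c j = s - c j * (1 - e j) by ring.
apply: is_idealB => //; last by apply: is_idealMl.
elim/big_ind: _ => [|x y hx hy|i ij].
- by case: (iQ j).
- exact: is_idealD.
by apply: is_idealMl => //; apply: e0.
Qed.

(** Chinese remainders give q^r elements that are pairwise incongruent modulo q, while O / q has
    only q^d classes. *)
Lemma primes_over_le q r (Q : 'I_r -> set O) :
  prime q -> injective Q -> (forall i, lies_over q (Q i)) -> (r <= d)%N.
Proof.
move=> qP Qinj hQ; have q1 := prime_gt1 qP.
have h (t : {ffun 'I_r -> 'I_q}) :
    {x | forall i, ideal_exp (Q i) 1 (x - (t i)%:R)}.
  by apply: cid; apply: prime_power_crt => // i; case: (hQ i).
have := @card_mod_le _ _ _ hb {ffun 'I_r -> 'I_q} q (fun t => sval (h t)).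
rewrite card_ffun !card_ord leq_exp2l //; apply; first exact: prime_gt0.
move=> s t y e; apply/ffunP => i; apply/val_inj/eqP.
have [_ hP Pq] := hQ i; have iP := nz_prime_ideal hP.
have sub : ideal_exp (Q i) 1 `<=` Q i by apply: ideal_exp_sub.
have hs := sub _ (svalP (h s) i); have ht := sub _ (svalP (h t) i).
have {hs ht e} : Q i ((s i)%:~R - (t i)%:~R).
  have -> : (s i)%:~R - (t i)%:~R =
    (sval (h t) - (t i)%:R) - (sval (h s) - (s i)%:R) + (sval (h s) - sval (h t)).
    by rewrite -!pmulrn; ring.
  rewrite e; apply: is_idealD => //; last exact: is_idealMr.
  exact: is_idealB.
rewrite -rmorphB /= => /(over_intE _ (hQ i)) dv; apply/negPn/negP => ne.
move: dv ne (ltn_ord (s i)) (ltn_ord (t i)) => /=.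
move: (nat_of_ord (s i)) (nat_of_ord (t i)) => m n dv ne mq nq.
have mn : (0 < `|(m%:Z - n%:Z)%R|)%N by lia.
by have := dvdn_leq mn dv; lia.
Qed.

Lemma primes_over q : prime q -> exists r (Q : 'I_r -> set O),
  [/\ (r <= d)%N, injective Q & forall P, lies_over q P <-> exists i, P = Q i].
Proof.
move=> qP.
pose good r := `[< exists Q : 'I_r -> set O, injective Q /\ forall i, lies_over q (Q i) >].
have ex : exists r, good r by exists 0%N; apply/asboolP; exists (fun=> set0); split=> -[].
have ub r : good r -> (r <= d)%N.
  by move=> /asboolP[Q [Qinj hQ]]; apply: primes_over_le hQ.
case: (ex_maxnP ex ub) => r gr rmax; have /asboolP[Q [Qinj hQ]] := gr.
exists r, Q; split=> //; first exact: ub.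
move=> P; split=> [hP|[i ->]//]; apply: contrapT => nP.
have : good r.+1; last by move/rmax; rewrite ltnn.
apply/asboolP; exists (fun i => if unlift ord0 i is Some j then Q j else P); split.
  move=> i j; case: unliftP => [i' ->|->]; case: unliftP => [j' ->|->] //.
  - by move/Qinj->.
  - by move=> e; case: nP; exists i'.
  - by move=> e; case: nP; exists j'.
by move=> i; case: unliftP.
Qed.

End PrimePowers.

(** * Primes of degree one above arbitrarily large p *)

Section DegreeOne.
Variables (K : fieldExtType rat) (d : nat).
Local Notation O := (ring_of_integers K).
Variables (b : 'I_d -> O) (hb : is_Zbasis b).
Implicit Types (P Q : set O) (x y : O) (g h : {poly int}) (p q : nat).

(** Says that the map from Z to O / P^k is onto with kernel p^k Z. *)
Definition degree_one p P k :=
  [/\ lies_over p P, forall x, exists n : int, ideal_exp P k (x - n%:~R)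
    & forall n : int, ideal_exp P k n%:~R -> (p ^ k %| `|n|)%N].

(** The condition u P inside p O, with u outside P, says that p generates P locally; then residues
    modulo P lift p-adically to P^k. *)
Lemma degree_one_of_local_generator p P u k : lies_over p P -> ~ P u ->
  (forall x, P x -> exists y, u * x = p%:R * y) ->
  (forall x, exists n : int, P (x - n%:~R)) -> degree_one p P k.
Proof.
move=> hp nPu uP hZ; have [pP hP Pp] := hp; have [iP P1 Pm _] := hP.
have p0 : (p%:R : O) != 0 by rewrite natO_eq0 -lt0n prime_gt0.
have [v Pv] := nz_prime_max hb hP nPu.
have iPk j := nz_prime_exp_ideal j hP.
(* Modulo any power P^j, each element of P is a multiple of p. With u v = 1 modulo P, write x = v (u
   x) + (1 - u v) x: the first term is divisible by p, and the factor 1 - u v raises the exponent of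
   the remainder. *)
have h1 j x : P x -> exists y r, x = p%:R * y + r /\ ideal_exp P j r.
  elim: j x => [|j IH] x Px; first by exists 0, x; rewrite mulr0 add0r.
  have [y [r [ex Pr]]] := IH x Px; have [z ez] := uP x Px.
  exists (v * z + (1 - u * v) * y), ((1 - u * v) * r); split; last exact: ideal_mul_mem.
  transitivity (v * (u * x) + (1 - u * v) * x); first by ring.
  by rewrite ez ex; ring.
split=> //.
  elim: k => [|j IH] x; first by exists 0.
  have [n Pn] := hZ x; have [y [r [ex Pr]]] := h1 j.+1 _ Pn.
  have [n' Pn'] := IH y; exists (n + p%:Z * n').
  have -> : x - (n + p%:Z * n')%:~R = p%:R * (y - n'%:~R) + r.
    rewrite rmorphD rmorphM /= opprD addrA ex -pmulrn; ring.
  by apply: is_idealD => //; apply: ideal_mul_mem.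
move=> n Pn.
have uPk j x : ideal_exp P j x -> exists y, u ^+ j * x = p%:R ^+ j * y.
  elim: j x => [|j IH] x; first by exists x; rewrite !expr0.
  apply: (@ideal_mul_sub _ _ _ [set x | exists y, u ^+ j.+1 * x = p%:R ^+ j.+1 * y]).
  - by exists 0; rewrite !mulr0.
  - by move=> s t [y e] [y' e']; exists (y + y'); rewrite !mulrDr e e'.
  move=> s t /uP[y e] /IH[y' e']; exists (y * y').
  by rewrite !exprS mulrACA e e' mulrACA.
have nPun N : ~ P (u ^+ N).
  by elim: N => [|N IHN]; rewrite ?expr0 // exprS => /Pm[].
suff key N j (m : int) y : u ^+ N * m%:~R = p%:R ^+ j * y -> (p ^ j %| `|m|)%N.
  by have [y /key] := uPk _ _ Pn.
elim: j m y => [|j IH] m y e; first by rewrite dvd1n.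
have : P (u ^+ N * m%:~R) by rewrite e exprS -mulrA; apply: is_idealMr.
move=> /Pm[/nPun//|] /(over_intE _ hp); rewrite -[p]/`|p%:Z|%N -dvdzE => /dvdzP[m' em].
have e' : u ^+ N * m'%:~R = p%:R ^+ j * y.
  by apply: (lregO p0); rewrite [RHS]mulrA -exprS -e em rmorphM /= -pmulrn; ring.
by rewrite em abszM mulnC expnS dvdn_mul //; apply: IH e'.
Qed.

Variables (theta : O) (htheta : <<1; val theta>>%VS = {:K}%VS).
Local Notation ev g := ((map_poly intr g).[theta] : O).

Lemma evD g h : ev (g + h) = ev g + ev h. Proof. by rewrite rmorphD hornerD. Qed.
Lemma evB g h : ev (g - h) = ev g - ev h. Proof. by rewrite rmorphB !hornerE. Qed.
Lemma evM g h : ev (g * h) = ev g * ev h. Proof. by rewrite rmorphM hornerM. Qed.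
Lemma evC (n : int) : ev n%:P = n%:~R. Proof. by rewrite map_polyC hornerC. Qed.
Lemma evZ (n : int) g : ev (n *: g) = n%:~R * ev g.
Proof. by rewrite -mul_polyC evM evC. Qed.
Lemma evX : ev 'X = theta. Proof. by rewrite map_polyX hornerX. Qed.

(** A common denominator of the basis elements in terms of theta; at primes not dividing m, O and
    Z[theta] look alike. *)
Lemma exists_conductor : exists2 m : int, m != 0 & forall x, exists g, m%:~R * x = ev g.
Proof.
have h i : {ag : int * {poly int} | ag.1 != 0 /\ ag.1%:~R * b i = ev ag.2}.
  apply: cid; have : val (b i) \in <<1; val theta>>%VS by rewrite htheta memvf.
  move=> /Fadjoin_polyP[_ /polyOver1P[q ->] e].
  have [g [a a0 eq]] := rat_poly_scale q; exists (a, g); split=> //=.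
  apply: val_inj; rewrite val_horner rmorphM rmorph_int /= e eq map_polyZ hornerZ /=.
  have aK : (a%:~R : K) != 0 by rewrite intK_eq0.
  have -> : ((a%:~R : rat)^-1)%:A = (a%:~R)^-1 :> K.
    by rewrite -[LHS]/(in_alg K _) fmorphV rmorph_int.
  rewrite mulrA divff // mul1r -map_poly_comp; congr (_.[_]).
  by apply: eq_map_poly => z /=; rewrite -(rmorph_int (in_alg K)).
pose m := \prod_i (sval (h i)).1; exists m.
  by apply/prodf_neq0 => i _; have [] := svalP (h i).
move=> x; rewrite -(coordsK hb x).
exists (\sum_i (coords hb x 0 i * \prod_(j | j != i) (sval (h j)).1) *: (sval (h i)).2).
rewrite rmorph_sum horner_sum mulr_sumr; apply: eq_bigr => i _.
have [_ e] := svalP (h i); rewrite evZ -e /m (bigD1 i) //= !rmorphM /= -mulrzr; ring.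
Qed.

(** A polynomial of least size killing theta; pseudo-division explains the power of the leading
    coefficient. *)
Lemma exists_min_poly : exists f : {poly int}, [/\ (1 < size f)%N, ev f = 0 &
  forall g, ev g = 0 -> exists N h, lead_coef f ^+ N *: g = h * f].
Proof.
have [f0 f00 ef0] := exists_int_poly (val theta).
have {}ef0 : ev f0 = 0 by apply: val_inj; rewrite val_horner.
pose good n := `[< exists g, [/\ g != 0, ev g = 0 & size g = n] >].
have ex : exists n, good n by exists (size f0); apply/asboolP; exists f0.
case: (ex_minnP ex) => n /asboolP[f [fN0 ef sf]] nmin.
have fmin g : ev g = 0 -> (size g < size f)%N -> g = 0.
  move=> eg; rewrite sf; have [-> //|g0] := eqVneq g 0; rewrite ltnNge.
  by rewrite nmin //; apply/asboolP; exists g.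
exists f; split=> //.
  rewrite ltnNge; apply/negP => /size1_polyC fc; move: ef fN0; rewrite fc evC.
  by move/eqP; rewrite intO_eq0 => /eqP->; rewrite eqxx.
move=> g eg; exists (scalp g f), (g %/ f).
have := Pdiv.Idomain.divp_eq g f => e; rewrite e (_ : g %% f = 0) ?addr0 //.
apply: fmin; last by rewrite ltn_modp.
have := congr1 (fun h => ev h) e; rewrite evZ evD evM ef eg !mulr0 add0r => <-.
by [].
Qed.

(** Euclid's argument: with c = f(0) nonzero and s a multiple of B!, f(c s) = c v with v = 1 modulo
    s, so every prime factor of v exceeds B. *)
Lemma exists_prime_divisor_value (f : {poly int}) (B : nat) : (1 < size f)%N ->
  exists p n, [/\ prime p, (B < p)%N & (p%:Z %| f.[n])%Z].
Proof.
move=> sf; pose c := f.[0]; have [c0|c0] := eqVneq c 0.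
  have [p Bp pP] := prime_above B.
  by exists p, 0; rewrite -/c c0 dvdz0.
have f0 : f != 0 by rewrite -size_poly_gt0 ltnW.
have [f1 ef1] : exists f1, f = f1 * 'X + c%:P.
  have /factor_theorem[f1 e] : root (f - c%:P) 0 by rewrite /root !hornerE subrr.
  by exists f1; rewrite -[LHS](subrK c%:P) e subr0.
(* Since f(c s) = c v, a point where G does not vanish makes v different from 0, 1 and -1, so that v
   has a prime factor. *)
pose G := (f - c%:P) * (f + c%:P) * f.
have nz (z : int) : f + z%:P != 0.
  by rewrite -size_poly_gt0 size_polyDl ?(ltnW sf) // (leq_ltn_trans (size_polyC_leq1 _)).
have G0 : G != 0 by rewrite !mulf_neq0 // -polyCN.
have [t Gt] : exists t : nat, G.[c * B`!%:Z * t%:Z] != 0.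
  apply: contrapT => h.
  pose s := [seq c * B`!%:Z * (t : nat)%:Z | t <- iota 0 (size G)].
  have : (size s < size G)%N.
    apply: max_poly_roots => //.
      by apply/allP => _ /mapP[t _ ->]; apply/negPn/negP => nr; apply: h; exists t.
    rewrite map_inj_uniq ?iota_uniq // => t t' /mulfI e.
    suff /e[] : c * B`!%:Z != 0 by [].
    by rewrite mulf_neq0 // -lt0n fact_gt0.
  by rewrite size_map size_iota ltnn.
pose s := B`!%:Z * t%:Z; pose v := 1 + s * f1.[c * s].
have fv : f.[c * s] = c * v by rewrite {1}ef1 hornerD hornerM hornerX hornerC /v; ring.
have v1 : (1 < `|v|)%N.
  have : G.[c * s] != 0 by rewrite /s mulrA.
  apply: contraNT; rewrite -leqNgt => v1.
  have vE : [\/ v = 0, v = 1 | v = -1] by case: (v) v1 => [[|[]]|[]] //; constructor.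
  rewrite /G !(hornerM, hornerD, hornerN, hornerC) fv.
  by case: vE => ->; apply/eqP; ring.
exists (pdiv `|v|), (c * s); split; first exact: pdiv_prime.
  rewrite ltnNge; apply/negP => le.
  have pv : ((pdiv `|v|)%:Z %| v)%Z by rewrite dvdzE /= pdiv_dvd.
  have ps : ((pdiv `|v|)%:Z %| s * f1.[c * s])%Z.
    rewrite dvdz_mulr // dvdz_mulr // dvdzE /= dvdn_fact // pdiv_gt0 le.
    by [].
  have : ((pdiv `|v|)%:Z %| v - s * f1.[c * s])%Z by rewrite rpredB.
  rewrite /v addrK.
  by rewrite dvdzE /= dvdn1 => /eqP e; have := pdiv_prime v1; rewrite e.
by rewrite fv dvdz_mull // dvdzE /= pdiv_dvd.
Qed.

(** A prime p dividing f(n) yields the reduction theta -> n to the field with p elements. It extends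
    to O because p does not divide m, and n is a simple root modulo p because p does not divide D, a
    multiple of f'(theta). *)
Lemma exists_degree_one (B : nat) k : exists p P, (B < p)%N /\ degree_one p P k.
Proof.
have [m m0 hm] := exists_conductor.
have [f [sf ef fmin]] := exists_min_poly.
(* Were it zero, f would divide a nonzero constant multiple of its derivative, which is nonzero in
   characteristic 0 and of smaller size. *)
have df0 : ev f^`() != 0.
  apply/eqP => e; have [N [h eh]] := fmin _ e.
  have f0 : f != 0 by rewrite -size_poly_gt0 ltnW.
  have l0 : lead_coef f ^+ N != 0 by rewrite expf_neq0 // lead_coef_eq0.
  have sd : (size f^`() < size f)%N by apply: lt_size_deriv.
  have d0 : f^`() != 0.
    apply/eqP => /polyP/(_ (size f).-2); rewrite coef_deriv coef0 => /eqP.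
    have -> : (size f).-2.+1 = (size f).-1 by rewrite prednK //; case: (size f) sf => [|[]].
    by rewrite mulrn_eq0 -/(lead_coef f) lead_coef_eq0 (negPf f0) orbF; case: (size f) sf => [|[]].
  have h0 : h != 0 by apply: contraNneq d0 => h0; move/eqP: eh; rewrite h0 mul0r -mul_polyC mulf_eq0 polyC_eq0 (negPf l0).
  have := size_scale f^`() l0; rewrite eh size_mul // => es.
  have := leq_addl (size h).-1 (size f); move: es sd; rewrite -size_poly_gt0 in h0.
  by case: (size h) h0 => // sh _ /= <-; rewrite ltnNge => /negPf->.
have [w [D D0 eD]] := exists_int_multiple df0.
(* The bound makes p larger than the absolute values of m, of the leading coefficient and of D,
   hence prime to all three. *)
have [p [n [pP Bp pn]]] := exists_prime_divisor_value (B + `|m| + `|lead_coef f| + `|D|) sf.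
have l0 : lead_coef f != 0 by rewrite lead_coef_eq0 -size_poly_gt0 ltnW.
have small (z : int) : z != 0 -> (`|z| < p)%N -> ~~ (p%:Z %| z)%Z.
  by move=> z0 zp; rewrite dvdzE /= gtnNdvd // absz_gt0.
have pm : ~~ (p%:Z %| m)%Z by apply: small => //; lia.
have pl : ~~ (p%:Z %| lead_coef f)%Z by apply: small => //; lia.
have pD : ~~ (p%:Z %| D)%Z by apply: small => //; lia.
have pM (z z' : int) : (p%:Z %| z * z')%Z = (p%:Z %| z)%Z || (p%:Z %| z')%Z.
  by rewrite !dvdzE abszM Euclid_dvdM.
have pX (z : int) N : ~~ (p%:Z %| z)%Z -> ~~ (p%:Z %| z ^+ N)%Z.
  move=> pz; elim: N => [|N IH]; first by rewrite expr0 dvdzE /= dvdn1; case: (p) pP => [|[]].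
  by rewrite exprS pM negb_or pz.
have ev0 g : ev g = 0 -> (p%:Z %| g.[n])%Z.
  move=> /fmin[N [h e]]; have := congr1 (horner^~ n) e; rewrite hornerZ hornerM => en.
  have : (p%:Z %| lead_coef f ^+ N * g.[n])%Z by rewrite en dvdz_mull.
  by rewrite pM (negPf (pX _ _ pl)).
(* The kernel of x -> g(n) / m, where m x = g(theta). [PE] shows independence of g. *)
pose P : set O := [set x | exists2 g, m%:~R * x = ev g & (p%:Z %| g.[n])%Z].
have PE x g : P x -> m%:~R * x = ev g -> (p%:Z %| g.[n])%Z.
  move=> [h e ph] eg; have : ev (h - g) = 0 by rewrite evB -e -eg subrr.
  by move/ev0; rewrite !hornerE => /(rpredB ph); rewrite subKr.
have iP : is_ideal P.
  split; first by exists 0; rewrite ?mulr0 ?rmorph0 ?horner0 ?dvdz0.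
  move=> a x y [g eg pg] [h eh ph].
  have [ga ega] := hm a; have [G eG] := hm (a * x + y); exists G => //.
  have : ev (m *: G - ga * g - m *: h) = 0.
    rewrite !evB !evZ evM -eG -ega -eg -eh; ring.
  move/ev0; rewrite !hornerE => h1.
  suff : (p%:Z %| m * G.[n])%Z by rewrite pM (negPf pm).
  have -> : m * G.[n] = (m * G.[n] - ga.[n] * g.[n] - m * h.[n]) + ga.[n] * g.[n] + m * h.[n] by ring.
  by apply: rpredD; [apply: rpredD => //|]; exact: dvdz_mull.
have nP1 : ~ P 1.
  move=> P1; have := PE _ m%:P P1; rewrite evC mulr1 hornerC => /(_ erefl).
  exact/negP.
have hP : nz_prime P.
  split=> // [x y Pxy|].
    have [gx ex] := hm x; have [gy ey] := hm y; have [g eg] := hm (x * y).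
    have pg := PE _ _ Pxy eg.
    have : ev (m *: g - gx * gy) = 0 by rewrite evB evZ evM -eg -ex -ey; ring.
    move/ev0; rewrite !hornerE => h1.
    have : (p%:Z %| gx.[n] * gy.[n])%Z.
      have -> : gx.[n] * gy.[n] = m * g.[n] - (m * g.[n] - gx.[n] * gy.[n]) by ring.
      by apply: rpredB => //; exact: dvdz_mull.
    by rewrite pM => /orP[]; [left; exists gx | right; exists gy].
  exists p%:R; last by rewrite natO_eq0 -lt0n prime_gt0.
  by exists (m * p%:Z)%:P; [rewrite evC rmorphM | rewrite hornerC dvdz_mull].
have hp : lies_over p P.
  by split=> //; exists (m * p%:Z)%:P; [rewrite evC rmorphM | rewrite hornerC dvdz_mull].
have taylor g : exists g1, g = g1 * ('X - n%:P) + g.[n]%:P.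
  have /factor_theorem[g1 e] : root (g - g.[n]%:P) n by rewrite /root !hornerE subrr.
  by exists g1; rewrite -e subrK.
have [f1 ef1] := taylor f.
have f1n : f^`().[n] = f1.[n].
  by rewrite {1}ef1 derivD derivM derivC derivXsubC !hornerE subrr; ring.
exists p, P; split; first by apply: leq_ltn_trans Bp; rewrite -!addnA leq_addr.
(* As f = f1 (X - n) + f(n) kills theta, f1(theta) (theta - n) = - f(n) is in p O, whence f1(theta)
   P is in p O after removing m by Bezout. And f1(theta) is outside P since f1(n) = f'(n) is prime
   to p. *)
apply: (@degree_one_of_local_generator _ _ (ev f1) k hp).
- move=> [g eg pg]; have : ev (m *: f1 - g) = 0 by rewrite evB evZ -eg subrr.
  move/ev0; rewrite !hornerE => h1.
  have : (p%:Z %| m * f1.[n])%Z by rewrite -(subrK g.[n] (m * _)) rpredD.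
  rewrite pM (negPf pm) /= -f1n => h2.
  have [gw ew] := hm w.
  have : ev (f^`() * gw - (m * D)%:P) = 0 by rewrite evB evM evC -ew rmorphM /= -eD; ring.
  move/ev0; rewrite !hornerE => h3.
  have : (p%:Z %| m * D)%Z.
    have -> : m * D = f^`().[n] * gw.[n] - (f^`().[n] * gw.[n] - m * D) by ring.
    by apply: rpredB => //; exact: dvdz_mulr.
  by rewrite pM (negPf pm) (negPf pD).
- move=> x [g eg pg]; have [g1 eg1] := taylor g.
  move: pn pg => /dvdzP[fn efn] /dvdzP[gn egn].
  have h1 : m%:~R * (ev f1 * x) = p%:R * (gn%:~R * ev f1 - fn%:~R * ev g1).
    transitivity (ev f1 * ev g); first by rewrite -eg; ring.
    have := ef; rewrite ef1 evD evM evB evX !evC efn rmorphM /= => h0.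
    rewrite {1}eg1 evD evM evB evX !evC egn rmorphM /= -!pmulrn.
    transitivity (ev g1 * (ev f1 * (theta - n%:~R) + fn%:~R * p%:~R)
      + ev f1 * (gn%:~R * p%:R) - ev g1 * (fn%:~R * p%:R)); first by rewrite -pmulrn; ring.
    by rewrite h0; ring.
  have : coprimez p%:Z m by rewrite /coprimez /gcdz -[_ == _]/(coprime _ _) prime_coprime.
  move=> /coprimezP[[u v] /= e].
  exists (u%:~R * (ev f1 * x) + v%:~R * (gn%:~R * ev f1 - fn%:~R * ev g1)).
  transitivity ((u * p%:Z + v * m)%:~R * (ev f1 * x)); first by rewrite e mul1r.
  rewrite rmorphD !rmorphM /= mulrDl -[v%:~R * _ * _]mulrA h1 -pmulrn; ring.
move=> x; have [g eg] := hm x.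
have : coprimez p%:Z m by rewrite /coprimez /gcdz -[_ == _]/(coprime _ _) prime_coprime.
(* The residue of x is g(n) / m, and v inverts m modulo p. *)
move=> /coprimezP[[u v] /= e]; exists (v * g.[n]); exists (g - (m * v * g.[n])%:P).
  by rewrite evB evC -eg mulrBr !rmorphM /=; ring.
rewrite !hornerE.
have -> : g.[n] - m * v * g.[n] = (u * g.[n]) * p%:Z + g.[n] * (1 - (u * p%:Z + v * m)) by ring.
by rewrite e subrr mulr0 addr0 dvdz_mull.
Qed.

End DegreeOne.

(** * Heights of elements and an upper bound for the index of P^k *)

Section Counting.
Variables (K : fieldExtType rat) (d : nat).
Local Notation O := (ring_of_integers K).
Variables (b : 'I_d -> O) (hb : is_Zbasis b).
Implicit Types (P Q : set O) (x y : O) (p q : nat).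

Lemma rowMzE m (v : 'rV[int]_m) (n : int) i : (v *~ n) 0 i = n * v 0 i.
Proof. by rewrite -scaler_int mxE intz. Qed.

Lemma leq_expn_base m n e : (m <= n)%N -> (m ^ e <= n ^ e)%N.
Proof. by case: e => // e; rewrite leq_exp2r. Qed.

Definition height_le x (h : nat) := forall i, (`|coords hb x 0%R i| <= h)%N.

Lemma height_leD x y h h' : height_le x h -> height_le y h' -> height_le (x + y) (h + h').
Proof.
move=> hx hy i; rewrite coordsD mxE; apply: leq_trans (leq_add (hx i) (hy i)).
by move: (coords hb x 0 i) (coords hb y 0 i) => u v; lia.
Qed.

Lemma coordsMz x (n : int) : coords hb (x *~ n) = coords hb x *~ n.
Proof.
rewrite -[RHS](latticeK hb); congr (coords hb _).
rewrite -{1}(coordsK hb x) /lattice_elt mulrz_suml; apply: eq_bigr => i _.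
by rewrite -mulrzA; congr (_ *~ _); rewrite rowMzE mulrC.
Qed.

Lemma coords_sum (T : finType) (F : T -> O) : coords hb (\sum_t F t) = \sum_t coords hb (F t).
Proof.
rewrite (big_morph (coords hb) (coordsD hb) (_ : _ = 0)) //.
by rewrite -(lattice_elt0 b) latticeK.
Qed.

Lemma height_leMn x h n : height_le x h -> height_le (n%:R * x) (n * h).
Proof.
move=> hx i; rewrite mulr_natl pmulrn coordsMz rowMzE abszM.
by rewrite leq_mul // hx.
Qed.

Lemma height_le_sum (T : finType) (F : T -> O) h :
  (forall t, height_le (F t) h) -> height_le (\sum_t F t) (#|T| * h).
Proof.
move=> hF i; rewrite coords_sum summxE.
apply: (@leq_trans (\sum_(t : T) h)%N); last by rewrite sum_nat_const.
elim/big_ind2: _ => // [m1 n1 m2 n2|t _]; last exact: hF.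
lia.
Qed.

Lemma exists_height x : exists h, height_le x h.
Proof. by exists (\max_i `|coords hb x 0%R i|)%N => i; apply: leq_bigmax. Qed.

Lemma exists_height_seq (s : seq O) : exists h, forall x, x \in s -> height_le x h.
Proof.
elim: s => [|x s [h hs]]; first by exists 0%N.
have [h' hx] := exists_height x; exists (h + h')%N => y; rewrite inE.
case/predU1P=> [->|/hs hy] i; first exact: leq_trans (hx i) (leq_addl _ _).
exact: leq_trans (hy i) (leq_addr _ _).
Qed.

Lemma height_box n (f : {ffun 'I_d -> 'I_n}) : height_le (box b f) n.
Proof.
move=> i; have -> : box b f = lattice_elt b (\row_i (f i)%:Z).
  by apply: eq_bigr => j _; rewrite mxE pmulrn.
by rewrite latticeK mxE /= ltnW.
Qed.

(* The remainder modulo [x O] of an element can be taken in the parallelotope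
   spanned by the [x * b i], so that [h] bounds the index from above. *)
Lemma index_le_height : exists C, (0 < C)%N /\ forall k q P x h,
  lies_over q P -> ideal_exp P k x -> x != 0 -> height_le x h -> (0 < h)%N ->
  (q ^ k <= (C * h) ^ d)%N.
Proof.
pose T := ('I_d * 'I_d)%type.
have [C0 hC0] := exists_height_seq [seq b t.1 * b t.2 | t <- enum {: T}].
have {}hC0 i j : height_le (b i * b j) C0.
  by apply: hC0; apply/mapP; exists (i, j) => //; rewrite mem_enum.
(* The coordinates of a remainder are at most H = d h d C0 in absolute value, hence take 2 H + 1
   values; this is at most C h because h >= 1. *)
exists (2 * (d * (d * C0)) + 1)%N; split=> [|k q P x h hq Px x0 hx h0]; first by lia.
have xb i : height_le (x * b i) (h * (d * C0)).
  rewrite -(coordsK hb x) mulr_suml.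
  have -> : (h * (d * C0) = #|'I_d| * (h * C0))%N by rewrite card_ord mulnCA.
  apply: height_le_sum => j l; rewrite mulrzAl coordsMz rowMzE abszM.
  by rewrite leq_mul // ?hC0.
have [w [c c0 ec]] := exists_int_multiple x0.
pose H := (d * (h * (d * C0)))%N.
have rem y : {t | height_le (y - x * t) H}.
  apply: cid; pose z := coords hb (y * w).
  (* As x w = c, the exact quotient y / x is y w / c. Dividing its numerator coordinatewise by c
     leaves c (y - x t) as a combination of the x b_i with coefficients in [0, |c|). *)
  exists (\sum_i b i *~ (z 0%R i %/ c)%Z).
  have e : (y - x * \sum_i b i *~ (z 0%R i %/ c)%Z) *~ c =
      \sum_i (x * b i) *~ (z 0%R i %% c)%Z.
    rewrite mulrzBl -[y *~ c]mulrzr -ec mulrA [y * x]mulrC -mulrA.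
    rewrite -{1}(coordsK hb (y * w)) -/z -mulrzAr -mulrBr /lattice_elt.
    rewrite mulrz_suml -sumrB mulr_sumr; apply: eq_bigr => i _.
    rewrite -mulrzA -mulrzBr mulrzAr; congr (_ *~ _).
  move=> j; have c1 : (0 < `|c|)%N by rewrite absz_gt0.
  rewrite -(leq_pmul2l c1) -abszM.
  have -> : c * coords hb (y - x * \sum_i b i *~ (z 0%R i %/ c)%Z) 0%R j =
    coords hb ((y - x * \sum_i b i *~ (z 0%R i %/ c)%Z) *~ c) 0%R j.
    by rewrite coordsMz rowMzE.
  rewrite e.
  have -> : (`|c| * H = #|'I_d| * (`|c| * (h * (d * C0))))%N.
    by rewrite card_ord /H mulnCA.
  move: j; apply: height_le_sum => i j; rewrite coordsMz rowMzE abszM.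
  apply: leq_mul; last exact: xb.
  have := ltz_mod (z 0%R i) c0; have := modz_ge0 (z 0%R i) c0; lia.
have [g gI] := exp_prime_incongruent hb k hq.
have [_ hP _] := hq; have iPk := nz_prime_exp_ideal k hP.
pose r i := g i - x * sval (rem (g i)).
have hr i j : (`|(coords hb (r i) 0 j + H%:Z)%R| < 2 * H + 1)%N.
  have := svalP (rem (g i)) j; rewrite -/(r i); lia.
pose F (i : 'I_(q ^ k)) := [ffun j => Ordinal (hr i j)].
have Finj : injective F.
  move=> i i' e; apply/val_inj/gI; [exact: ltn_ord|exact: ltn_ord|].
  have er : r i = r i'.
    rewrite -[LHS](coordsK hb) -[RHS](coordsK hb); congr lattice_elt; apply/rowP => j.
    have := congr1 (fun f : {ffun _ -> 'I_(2 * H + 1)} => val (f j)) e; rewrite !ffunE /=.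
    have := svalP (rem (g i)) j; have := svalP (rem (g i')) j.
    rewrite -!/(r _); lia.
  have e2 : x * (sval (rem (g i)) - sval (rem (g i'))) = g i - g i'.
    move: er; rewrite /r; move: (sval _) (sval _) => t t' er.
    by have := congr1 (fun z => z + x * t') er; rewrite subrK => ->; ring.
  by have := is_idealMr (sval (rem (g i)) - sval (rem (g i'))) iPk Px; rewrite e2.
have := leq_card F Finj; rewrite card_ffun !card_ord => le.
apply: leq_trans le _; apply: leq_expn_base; rewrite /H; nia.
Qed.

End Counting.

(** * The sieve for k-free elements *)

Section Sieve.
Variables (K : fieldExtType rat) (d : nat).
Local Notation O := (ring_of_integers K).
Variables (b : 'I_d -> O) (hb : is_Zbasis b).
Implicit Types (P Q : set O) (x y : O) (p q : nat).

Lemma Zbasis_dim_gt0 : (0 < d)%N.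
Proof.
case: d b hb => // b' hb'; have := @oner_neq0 O.
by rewrite -(coordsK hb' 1) /lattice_elt big_ord0 eqxx.
Qed.

Lemma coords_box n (f : {ffun 'I_d -> 'I_n}) i : coords hb (box b f) 0 i = (f i)%:Z.
Proof.
have -> : box b f = lattice_elt b (\row_i (f i)%:Z).
  by apply: eq_bigr => j _; rewrite mxE pmulrn.
by rewrite latticeK mxE.
Qed.

Lemma box_inj n : injective (@box K d b n).
Proof.
move=> f g e; apply/ffunP => i; apply: val_inj.
by have := coords_box f i; rewrite e coords_box => -[].
Qed.

(** Let h be least with q^k <= (C h)^d. A nonzero element of P^k has some coordinate of size at
    least h, so a cube of side h holds at most one point of S. The alternative [#|S| <= 1] is the
    case h > n of a single cube. *)
Lemma packing C k q P n (S : pred {ffun 'I_d -> 'I_n}) :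
  (0 < C)%N -> (0 < n)%N -> lies_over q P ->
  (forall x h, ideal_exp P k x -> x != 0 -> height_le hb x h -> (0 < h)%N ->
     (q ^ k <= (C * h) ^ d)%N) ->
  (forall s t, S s -> S t -> ideal_exp P k (box b s - box b t)) ->
  (#|S| <= 1)%N \/ (#|S| * q ^ k <= (2 * C * n) ^ d)%N.
Proof.
move=> C0 n0 hq hC hS; have [qP hP Pq] := hq.
pose good h := (0 < h)%N && (q ^ k <= (C * h) ^ d)%N.
have q0 : (0 < q ^ k)%N by rewrite expn_gt0 prime_gt0.
have ex : exists h, good h.
  exists (q ^ k)%N; rewrite /good q0 /=.
  apply: (@leq_trans ((C * q ^ k) ^ 1)%N); first by rewrite expn1 leq_pmull.
  by rewrite leq_pexp2l ?Zbasis_dim_gt0 // muln_gt0 C0.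
case: (ex_minnP ex) => h /andP[h0 hq1] hmin.
have cellP (s : {ffun 'I_d -> 'I_n}) i : (s i %/ h < (n %/ h).+1)%N.
  by rewrite ltnS leq_div2r // ltnW.
pose cell (s : {ffun 'I_d -> 'I_n}) := [ffun i => Ordinal (cellP s i)].
have cell_inj : {in S &, injective cell}.
  move=> s t Ss St e; apply: box_inj; apply/eqP; rewrite -subr_eq0.
  apply/negPn/negP => x0; have := hS _ _ Ss St.
  have hx : height_le hb (box b s - box b t) h.-1.
    move=> i; rewrite coordsD coordsN !mxE !coords_box.
    have := congr1 (fun f : {ffun _ -> 'I__} => val (f i)) e; rewrite !ffunE /=.
    move: (nat_of_ord (s i)) (nat_of_ord (t i)) => u v e'.
    have := divn_eq u h; have := divn_eq v h; have := ltn_pmod u h0; have := ltn_pmod v h0.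
    rewrite e'; lia.
  have [h1|h1] := posnP h.-1.
    case/negP: x0; rewrite -(coordsK hb (_ - _)) -(lattice_elt0 b).
    apply/eqP; congr lattice_elt; apply/rowP => i; have := hx i.
    by rewrite h1 leqn0 absz_eq0 mxE => /eqP.
  move=> /hC/(_ x0 hx h1) le; have := hmin h.-1; rewrite /good h1 le => /(_ isT).
  lia.
have : (#|S| <= (n %/ h).+1 ^ d)%N.
  rewrite -(card_in_image cell_inj); apply: leq_trans (max_card _) _.
  by rewrite card_ffun !card_ord.
have [hn|hn] := leqP h n; last by rewrite divn_small // exp1n; left.
move=> le; right; apply: (leq_trans (leq_mul le hq1)).
rewrite -expnMn; apply: leq_expn_base.
have := leq_trunc_div n h; nia.
Qed.

(** Telescoping: 1 / (q+1)^2 is at most 1 / q - 1 / (q+1). *)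
Lemma sum_inv_square (A B R : nat) : (0 < B)%N -> (B <= R)%N ->
  (B * \sum_(B <= q < R) A %/ q.+1 ^ 2 <= A)%N.
Proof.
move=> B0 BR.
suff : ((\sum_(B <= q < R) A %/ q.+1 ^ 2)%N%:R <= A%:R / B%:R - A%:R / R%:R :> rat).
  move=> h; rewrite -(ler_nat rat) natrM mulrC -ler_pdivlMr ?ltr0n //.
  by apply: le_trans h _; rewrite gerBl divr_ge0 // ler0n.
elim: R BR => [|R IH]; first by rewrite leqn0 => /eqP e; rewrite e in B0.
rewrite leq_eqVlt => /predU1P[->|]; first by rewrite big_geq // subrr.
rewrite ltnS => BR; rewrite big_nat_recr //= natrD.
apply: le_trans (lerD (IH BR) (lexx _)) _.
have R0 : (0 < R)%N by apply: leq_trans BR.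
have Rr : (0 : rat) < R%:R by rewrite ltr0n.
have Rr1 : (0 : rat) < R.+1%:R by rewrite ltr0n.
have : ((A %/ R.+1 ^ 2)%N%:R <= A%:R / (R.+1%:R * R%:R) :> rat).
  rewrite ler_pdivlMr ?mulr_gt0 // -!natrM ler_nat.
  apply: leq_trans (leq_trunc_div A (R.+1 ^ 2)).
  by rewrite leq_mul2l expnS expn1 leq_mul2l leqnSn !orbT.
have -> : A%:R / (R.+1%:R * R%:R) = A%:R / R%:R - A%:R / R.+1%:R :> rat.
  have -> : R.+1%:R = R%:R + 1 :> rat by rewrite -natr1.
  by field; rewrite !gt_eqF // natr1.
move: (A%:R / R%:R) (A%:R / R.+1%:R) (A%:R / B%:R) ((A %/ R.+1 ^ 2)%N%:R) => a1 a2 a3 a4.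
by move=> le; lra.
Qed.

(** A uniform list of d sets for each q; spare indices receive [set0], which lies over no prime. *)
Lemma all_primes_over : exists Qs : nat -> 'I_d -> set O,
  forall q P, lies_over q P -> exists i, P = Qs q i.
Proof.
have h q : {Q : 'I_d -> set O | forall P, lies_over q P -> exists i, P = Q i}.
  apply: cid; have [qP|nqP] := pselect (prime q); last first.
    by exists (fun=> set0) => P [].
  have [r [Q [rd _ hQ]]] := primes_over hb qP.
  exists (fun i => if insub (val i) is Some j then Q j else set0) => P /hQ[i ->].
  by exists (widen_ord rd i) => /=; rewrite insubT /= ?ltn_ord // => lt; congr Q; apply: val_inj.
by exists (fun q => sval (h q)) => q P; apply: (svalP (h q)).
Qed.

Lemma sum_asbool (T : finType) (S : T -> Prop) :
  (\sum_t (`[<S t>] : nat) = #|[pred t | `[<S t>]]|)%N.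
Proof. by rewrite -sum1_card [RHS]big_mkcond; apply: eq_bigr => t _; rewrite inE; case: asbool. Qed.

(** The n^d points of a box are tested. Primes over divisors of M are harmless, since M^k x vanishes
    modulo their k-th powers. By [packing], every other prime ideal, over some q > B, excludes at
    most A / q^2 + 1 points for each f, and by heights only q <= R matter, apart from the one point
    where f + M^k x may vanish. The main terms are small by the choice of B, the terms 1 because R
    has the order of n^(d/2). *)
Lemma sieve k N0 : (2 <= k)%N -> exists B, forall (F : seq O) M, (size F <= N0)%N ->
  (0 < M)%N -> (forall q, prime q -> (q <= B)%N -> (q %| M)%N) ->
  (forall q P f, lies_over q P -> (q %| M)%N -> f \in F -> ~ ideal_exp P k f) ->
  exists x, forall f, f \in F -> k_free k (f + (M ^ k)%:R * x).
Proof.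
move=> k2; have d0 := Zbasis_dim_gt0.
have [C [C0 hC]] := index_le_height hb; have [Qs hQs] := all_primes_over.
(* Since A = (2 C)^d n^d, the main terms, at most N0 d A / B in all, amount to at most a quarter of
   n^d. *)
pose B := (4 * N0 * d * (2 * C) ^ d + 1)%N.
exists B => F M sF M0 hM hF; pose M' := (M ^ k)%N.
have M'0 : (0 < M')%N by rewrite expn_gt0 M0.
have [T0 hT0] := exists_height_seq hb F.
pose R0 := ((C * (T0 + M')) ^ d)%N.
(* n is a square so that R = R0 v^d is R0 times the root of n^d; the size of v makes N0 (1 + d R)
   less than a quarter of n^d. *)
pose v := (4 * N0 * (1 + d * R0) + 1)%N; pose n := (v ^ 2)%N.
pose T := {ffun 'I_d -> 'I_n}.
have v0 : (0 < v)%N by rewrite /v addn1.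
have n0 : (0 < n)%N by rewrite expn_gt0 v0.
pose A := ((2 * C * n) ^ d)%N; pose R := (R0 * v ^ d)%N.
pose X f (s : T) := f + M'%:R * box b s.
apply: contrapT => hbad.
pose bad f q i s := [/\ lies_over q (Qs q i), ~ (q %| M)%N & ideal_exp (Qs q i) k (X f s)].
pose bad0 f s := X f s = 0.
have hs (s : T) : exists2 f, f \in F & bad0 f s \/ exists q i, bad f q i s.
  apply: contrapT => h; apply: hbad; exists (box b s) => f fF; apply/(k_freeP hb).
  split; first by apply/eqP => e; apply: h; exists f => //; left.
  move=> P hP Pf; have [q hq] := nz_prime_over hP; have [i ei] := hQs _ _ hq.
  have iP := nz_prime_exp_ideal k hP.
  have [qM|qM] := boolP (q %| M)%N.
    apply: (hF q P f hq qM fF); rewrite -(addrK (M'%:R * box b s) f).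
    apply: is_idealB => //; apply: is_idealMr => //; rewrite /M' natrX.
    by apply: ideal_exp_pow; apply/(over_natE _ hq).
  apply: h; exists f => //; right; exists q, i; split; rewrite -?ei //.
  exact/negP.
have height_X f s : f \in F -> height_le hb (X f s) ((T0 + M') * n).
  move=> fF i; have := height_leD (hT0 _ fF) (height_leMn M' (height_box hb s)) i.
  move=> le; apply: leq_trans le _; rewrite mulnDl leq_add2r.
  by rewrite leq_pmulr.
have hE : ((C * ((T0 + M') * n)) ^ d <= R ^ 2)%N.
  have -> : ((C * ((T0 + M') * n)) ^ d = R0 * (v ^ d) ^ 2)%N.
    by rewrite mulnA expnMn /n -!expnM [(2 * d)%N]mulnC.
  have R00 : (0 < R0)%N by rewrite expn_gt0 muln_gt0 C0 addn_gt0 M'0 orbT.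
  by rewrite /R expnMn leq_mul2r -[X in (X <= _)%N]expn1 leq_pexp2l ?orbT.
(* Here k >= 2 gives q^2 <= q^k <= R^2. The index q - 1 is the one of the telescoping sum. *)
have q_range f q i s : f \in F -> bad f q i s -> ~ bad0 f s -> (B <= q.-1 < R)%N.
  move=> fF [hq qM Pf] b0; have [qP hP _] := hq; have q0 := prime_gt0 qP.
  apply/andP; split.
    by rewrite -ltnS prednK // ltnNge; apply/negP => le; apply: qM; apply: hM.
  rewrite prednK // -(@leq_exp2r _ _ 2) //; apply: leq_trans hE.
  apply: (@leq_trans (q ^ k)%N); first by rewrite leq_pexp2l.
  apply: (hC _ _ _ _ _ hq Pf); [exact/eqP | exact: height_X |].
  by rewrite muln_gt0 n0 addn_gt0 M'0 orbT.
have cardT : #|T| = (n ^ d)%N by rewrite card_ffun !card_ord.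
have : (#|T| <= \sum_(s : T) \sum_(f <- F) ((`[<bad0 f s>] : nat) +
    \sum_(B <= q < R) \sum_(i < d) (`[<bad f q.+1 i s>] : nat)))%N.
  rewrite -[X in (X <= _)%N]sum1_card; apply: leq_sum => s _.
  have [f fF hfs] := hs s; rewrite (big_rem f) //=; apply: leq_trans (leq_addr _ _).
  have [b0|nb0] := pselect (bad0 f s); first by rewrite asboolT.
  case: hfs => [//|[q [i hb']]]; apply: leq_trans (leq_addl _ _).
  have rg := q_range _ _ _ _ fF hb' nb0.
  have qE : q.-1.+1 = q by case: hb' => -[/prime_gt0/prednK].
  rewrite (bigD1_seq q.-1) ?mem_index_iota ?iota_uniq //=.
  rewrite (bigD1 i) //= qE asboolT //.
rewrite exchange_big /=.
have bound f : f \in F -> (\sum_(s : T) ((`[<bad0 f s>] : nat) +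
    \sum_(B <= q < R) \sum_(i < d) (`[<bad f q.+1 i s>] : nat)) <=
    1 + d * \sum_(B <= q < R) (A %/ q.+1 ^ 2 + 1))%N.
  move=> fF; rewrite big_split /=; apply: leq_add.
    rewrite sum_asbool; apply/card_le1_eqP => s t; rewrite !inE => b0 b1.
    apply: box_inj; have M'O : (M'%:R : O) != 0 by rewrite natO_eq0 -lt0n.
    by apply: (lregO M'O); apply: (addrI f); rewrite [LHS]b1 [RHS]b0.
  rewrite exchange_big big_distrr /=; apply: leq_sum => q _; rewrite exchange_big /=.
  rewrite -[X in (X * _)%N](card_ord d) -sum_nat_const; apply: leq_sum => i _.
  rewrite sum_asbool; have [hq|nq] := pselect (lies_over q.+1 (Qs q.+1 i) /\ ~ (q.+1 %| M)%N); last first.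
    rewrite eq_card0 // => s; rewrite !inE; apply/asboolP => -[h1 h2 _].
    by apply: nq.
  have [h1 h2] := hq; have [qP hP _] := h1; have iP := nz_prime_exp_ideal k hP.
  have [|le|le] := @packing C k q.+1 (Qs q.+1 i) n [pred s | `[<bad f q.+1 i s>]] C0 n0 h1 (fun x h => hC k _ _ x h h1).
  - move=> s t /asboolP[_ _ hs1] /asboolP[_ _ ht1].
    have co : coprime M' q.+1.
      by rewrite coprime_sym prime_coprime //; apply/negP; rewrite Euclid_dvdX // => /andP[].
    apply: (exp_prime_mul h1 co); have -> : M'%:R * (box b s - box b t) = X f s - X f t.
      by rewrite /X; ring.
    exact: is_idealB.
  - exact: leq_trans le (leq_addl _ _).
  apply: leq_trans (leq_addr _ _); rewrite leq_divRL ?expn_gt0 //.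
  apply: leq_trans le; rewrite leq_mul2l; apply/orP; right.
  by rewrite leq_pexp2l.
move=> le1; pose S1 := (\sum_(B <= q < R) A %/ q.+1 ^ 2)%N.
have le2 : (#|T| <= (1 + d * (S1 + R)) * N0)%N.
  apply: leq_trans le1 _; rewrite big_seq.
  apply: (@leq_trans (\sum_(f <- F | f \in F) (1 + d * (S1 + R)))%N).
    apply: leq_sum => f fF; apply: leq_trans (bound f fF) _.
    rewrite leq_add2l leq_mul2l big_split /= leq_add2l sum_nat_const_nat muln1 leq_subr.
    by rewrite orbT.
  by rewrite -big_seq big_const_seq count_predT iter_addn addn0 leq_mul2l sF orbT.
have hB : (B * S1 <= A)%N.
  have [BR|BR] := leqP B R; first by apply: sum_inv_square => //; rewrite /B addn1.
  by rewrite /S1 big_geq ?muln0 // ltnW.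
pose V := (v ^ d)%N; pose c := ((2 * C) ^ d)%N.
have vV : (v <= V)%N by rewrite -[X in (X <= _)%N]expn1 leq_pexp2l.
have NE : (#|T| = V * V)%N by rewrite cardT /n /V -expnD addnn -mul2n -expnM.
have AE : (A = c * (V * V))%N by rewrite /A expnMn -cardT NE.
have c0 : (0 < c)%N by rewrite expn_gt0 muln_gt0 C0.
have {}hB : (4 * N0 * d * S1 <= V * V)%N.
  rewrite -(leq_pmul2l c0) -AE; apply: leq_trans hB.
  by rewrite mulnA leq_mul2r /B -/c mulnC leq_addr orbT.
have vE : (v = 4 * N0 * (1 + d * R0) + 1)%N by [].
have RE : (R = R0 * V)%N by [].
move: le2; rewrite NE RE => le2.
have h1 : (4 * N0 * (1 + d * R0) * V < V * V)%N.
  rewrite ltn_pmul2r; last exact: leq_trans v0 vV.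
  by apply: leq_trans vV; rewrite vE addn1.
have V0 : (0 < V)%N by exact: leq_trans v0 vV.
have h2 : (4 * N0 <= 4 * N0 * V)%N by rewrite leq_pmulr.
have h3 : (4 * (V * V) <= 4 * N0 + 4 * N0 * d * S1 + 4 * N0 * (d * R0) * V)%N.
  apply: (@leq_trans (4 * ((1 + d * (S1 + R0 * V)) * N0)))%N; first by rewrite leq_mul2l le2.
  by apply: eq_leq; ring.
have h4 : (4 * N0 * (1 + d * R0) * V = 4 * N0 * V + 4 * N0 * (d * R0) * V)%N by ring.
lia.
Qed.

End Sieve.

(** * Admissible sets occur as patterns of k-free elements *)

Section Admissible.
Variables (K : fieldExtType rat) (d : nat).
Local Notation O := (ring_of_integers K).
Variables (b : 'I_d -> O) (hb : is_Zbasis b).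
Variables (k : nat) (hk : (2 <= k)%N).
Implicit Types (P Q : set O) (x y : O) (p q : nat).
Hypothesis hdeg : forall B, exists p P, (B < p)%N /\ degree_one p P k.

Definition admissible (F : seq O) := forall P, nz_prime P ->
  exists e, forall f, f \in F -> ~ ideal_exp P k (f - e).

Lemma exp_over_sub q P : lies_over q P -> ideal_exp P k `<=` P.
Proof. by case=> _ hP _; apply: ideal_exp_sub => //; [case: hP | apply: leq_trans hk]. Qed.

Lemma exp_over_pow q P y : lies_over q P -> ideal_exp P k ((q ^ k)%:R * y).
Proof.
move=> [_ hP Pq]; apply: is_idealMr; first exact: nz_prime_exp_ideal.
by rewrite natrX; apply: ideal_exp_pow.
Qed.

Lemma exp_over_dvd q P m y : lies_over q P -> (q %| m)%N -> ideal_exp P k ((m ^ k)%:R * y).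
Proof.
move=> hq /dvdnP[n ->]; rewrite expnMn mulnC natrM -mulrA.
exact: exp_over_pow hq.
Qed.

Lemma over_avoids (x : O) : x != 0 -> exists D, forall q P, (D < q)%N -> lies_over q P -> ~ P x.
Proof.
move=> x0; have [w [c c0 e]] := exists_int_multiple x0; exists `|c|%N => q P Dq hq Px.
have : P c%:~R by rewrite -e; apply: is_idealMr => //; case: hq => _ [].
move=> /(over_intE _ hq) /dvdn_leq; rewrite absz_gt0 c0 => /(_ isT).
by rewrite leqNgt Dq.
Qed.

Lemma over_avoids_seq (s : seq O) : 0 \notin s ->
  exists D, forall q P x, (D < q)%N -> lies_over q P -> x \in s -> ~ P x.
Proof.
elim: s => [|x s IH]; first by exists 0%N.
rewrite inE negb_or eq_sym => /andP[/over_avoids[D hD] /IH[D' hD']].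
exists (D + D')%N => q P y lt hq; rewrite inE => /predU1P[->|ys].
  by apply: hD hq; apply: leq_ltn_trans lt; apply: leq_addr.
by apply: hD' hq ys; apply: leq_ltn_trans lt; apply: leq_addl.
Qed.

(** The integers 0, ..., q - 1 are incongruent, so F cannot meet all their classes; admissibility is
    a condition at small primes only. *)
Lemma miss_large q P (F : seq O) : lies_over q P -> (size F < q)%N ->
  exists e, forall f, f \in F -> ~ ideal_exp P k (f - e).
Proof.
move=> hq sF; have [qP hP Pq] := hq; have iPk := nz_prime_exp_ideal k hP.
apply: contrapT => h.
have hit (j : 'I_q) : {i : 'I_(size F) | ideal_exp P k (nth 0 F i - (j : nat)%:R)}.
  apply: cid; apply: contrapT => nh; apply: h; exists (j : nat)%:R => f fF Pf.
  apply: nh; have lt : (index f F < size F)%N by rewrite index_mem.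
  by exists (Ordinal lt); rewrite /= nth_index.
have inj : injective (fun j => sval (hit j)).
  move=> j j' e; apply/val_inj/eqP/negPn/negP => ne.
  have : ideal_exp P k ((j : nat)%:~R - (j' : nat)%:~R).
    have := is_idealB iPk (svalP (hit j')) (svalP (hit j)); rewrite e -!pmulrn.
    by congr ideal_exp; ring.
  rewrite -rmorphB => /(exp_over_sub hq) /(over_intE _ hq) dv.
  move: dv ne (ltn_ord j) (ltn_ord j') => /=.
  move: (nat_of_ord j) (nat_of_ord j') => m n dv ne mq nq.
  have mn : (0 < `|(m%:Z - n%:Z)%R|)%N by lia.
  by have := dvdn_leq mn dv; lia.
by have := leq_card _ inj; rewrite !card_ord leqNgt sF.
Qed.

Lemma prime_dvd_fact q B : prime q -> (q %| B`!)%N = (q <= B)%N.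
Proof.
move=> qP; apply/idP/idP => [|qB]; last by rewrite dvdn_fact // prime_gt0.
elim: B => [|B IH]; first by rewrite fact0 dvdn1 => /eqP e; rewrite e in qP.
by rewrite factS Euclid_dvdM // => /orP[/dvdn_leq->//|/IH/leqW].
Qed.

Lemma nat_bezout m n : coprime m n -> exists u v : int, u%:~R * m%:R + v%:~R * n%:R = 1 :> O.
Proof.
move=> co; have /coprimezP[[u v] /= e] : coprimez m%:Z n%:Z by [].
by exists u, v; have := congr1 (fun z : int => z%:~R : O) e; rewrite rmorphD !rmorphM.
Qed.

Lemma nat_crt (c : nat -> O) B : exists t, forall q, prime q -> (q <= B)%N ->
  exists y, t - c q = (q ^ k)%:R * y.
Proof.
elim: B => [|B [t ht]]; first by exists 0 => q /prime_gt0; case: q.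
have [qP|nqP] := boolP (prime B.+1); last first.
  exists t => q qP; rewrite leq_eqVlt => /predU1P[e|]; last exact: ht.
  by rewrite -e qP in nqP.
pose M := (B`! ^ k)%N.
have : coprime M (B.+1 ^ k).
  apply: coprimeXl; apply: coprimeXr; rewrite coprime_sym prime_coprime //.
  by rewrite prime_dvd_fact // ltnn.
move=> co; have [u [v e]] := nat_bezout co.
exists (t + M%:R * (u%:~R * (c B.+1 - t))) => q q0P; rewrite leq_eqVlt => /predU1P[->|].
  exists (v%:~R * (t - c B.+1)).
  transitivity ((t - c B.+1) * (1 - u%:~R * M%:R)); first by ring.
  have e2 : 1 - u%:~R * M%:R = v%:~R * (B.+1 ^ k)%:R :> O by apply/eqP; rewrite subr_eq addrC e.
  by rewrite e2; ring.
move=> qB; have [y ey] := ht q q0P qB.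
have [M1 eM] : exists M1, M = (q ^ k * M1)%N.
  have /dvdnP[z ez] : (q %| B`!)%N by rewrite dvdn_fact // prime_gt0.
  by exists (z ^ k)%N; rewrite /M ez expnMn mulnC.
exists (y + M1%:R * (u%:~R * (c B.+1 - t))).
by rewrite addrAC ey eM natrM; ring.
Qed.

(** Chinese remainders merge the free classes at the primes over q into one shift. *)
Lemma exists_adm_shift (F : seq O) q : admissible F -> prime q ->
  exists c, forall P f, lies_over q P -> f \in F -> ~ ideal_exp P k (f + c).
Proof.
move=> hF qP; have [r [Q [_ Qinj hQ]]] := primes_over hb qP.
have hQi i : lies_over q (Q i) by apply/hQ; exists i.
have hP i : nz_prime (Q i) by case: (hQi i).
have h i : {e | forall f, f \in F -> ~ ideal_exp (Q i) k (f - e)} by apply: cid; apply: hF.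
have [x hx] := prime_power_crt hb k (fun i => - sval (h i)) Qinj hP.
exists x => P f /hQ[i ->] fF Pf; apply: (svalP (h i) f fF).
have iPk := nz_prime_exp_ideal k (hP i).
have := is_idealB iPk Pf (hx i); congr ideal_exp; ring.
Qed.

(* Each point of [U] is killed by its own large degree one prime; the sieve
   then keeps [F] alive at all other primes. *)
Lemma admissible_pattern (F U : seq O) : admissible F -> (forall u, u \in U -> u \notin F) ->
  exists t, (forall f, f \in F -> k_free k (f + t)) /\
            (forall u, u \in U -> ~ k_free k (u + t)).
Proof.
move=> hF FU.
have [D hD] : exists D, forall q P f u, (D < q)%N -> lies_over q P ->
    f \in F -> u \in U -> ~ P (f - u).
  have [|D hD] := @over_avoids_seq [seq f - u | f <- F, u <- U].
    apply/negP => /allpairsP[[f u] /= [fF uU /esym/eqP]]; rewrite subr_eq0 => /eqP e.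
    by have := FU u uU; rewrite -e fF.
  by exists D => q P f u Dq hq fF uU; apply: hD hq _ => //; apply/allpairsP; exists (f, u).
pose next B := sval (cid (hdeg (D + B))).
have nextP B : exists P, (D + B < next B)%N /\ lies_over (next B) P.
  by rewrite /next; case: (cid _) => p [P [lt [hp _ _]]] /=; exists P.
pose qq i := iter i.+1 next 0%N.
have qq_lt i j : (i < j)%N -> (qq i < qq j)%N.
  have S i' : (qq i' < qq i'.+1)%N.
    by have [P [lt _]] := nextP (qq i'); apply: leq_ltn_trans lt; apply: leq_addl.
  elim: j => // j IH; rewrite ltnS leq_eqVlt => /predU1P[->//|/IH].
  by move/ltn_trans; apply.
have qq_inj : injective qq.
  by move=> i j e; have [/qq_lt|/qq_lt|//] := ltngtP i j; rewrite e ltnn.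
have qqP i : exists P, (D < qq i)%N /\ lies_over (qq i) P.
  have [P [lt hP]] := nextP (iter i next 0%N); exists P; split=> //.
  by apply: leq_ltn_trans lt; apply: leq_addr.
have [B0 hB0] := sieve hb (size F) hk.
pose B := (B0 + \sum_(i < size U) qq i)%N.
have qqB i : (i < size U)%N -> (qq i <= B)%N.
  move=> iU; apply: leq_trans (leq_addl _ _).
  by rewrite (bigD1 (Ordinal iU)) //= leq_addr.
(* At q = [qq i] the shift is minus the i-th point u of U: u + t falls in q^k O, while f + t is f -
   u modulo q^k and stays outside each P over q because q > D. At any other q an admissible shift is
   taken. *)
have [c hc] : {c : nat -> O & forall q, prime q ->
    (forall P f, lies_over q P -> f \in F -> ~ ideal_exp P k (f + c q)) /\
    (forall i, (i < size U)%N -> q = qq i -> c q = - nth 0 U i)}.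
  suff h q : {c | prime q ->
    (forall P f, lies_over q P -> f \in F -> ~ ideal_exp P k (f + c)) /\
    (forall i, (i < size U)%N -> q = qq i -> c = - nth 0 U i)}.
    by exists (fun q => sval (h q)) => q; apply: (svalP (h q)).
  apply: cid; have [qP|] := boolP (prime q); last by exists 0.
  have [[i [iU ei]]|ni] := pselect (exists i, (i < size U)%N /\ q = qq i).
    exists (- nth 0 U i) => _; split; last first.
      by move=> j jU ej; congr (- nth 0 U _); apply: qq_inj; rewrite -ei -ej.
    move=> P f hP fF /(exp_over_sub hP); apply: hD hP fF _; last exact: mem_nth.
    by rewrite ei; have [P' []] := qqP i.
  have [c hc] := exists_adm_shift hF qP; exists c => _; split=> // i iU ei.
  by case: ni; exists i.
have [t0 ht0] := nat_crt c B.
have B0B : (B0 <= B)%N by apply: leq_addr.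
have [|||q P f hP qM|x hx] := hB0 [seq f + t0 | f <- F] B`!.
- by rewrite size_map.
- exact: fact_gt0.
- by move=> q qP qB; rewrite dvdn_fact // prime_gt0 //= (leq_trans qB).
- move=> /mapP[f' fF ->] Pf; have [qP hP' _] := hP.
  have qB : (q <= B)%N by rewrite -prime_dvd_fact.
  have [y ey] := ht0 q qP qB; have [hc' _] := hc q qP.
  apply: (hc' P f' hP fF); have iPk := nz_prime_exp_ideal k hP'.
  have := is_idealB iPk Pf (exp_over_pow y hP); rewrite -ey.
  by congr ideal_exp; ring.
exists (t0 + (B`! ^ k)%:R * x); split.
  by move=> f fF; rewrite addrA; apply: hx; apply: map_f.
move=> u uU /(k_freeP hb)[_ ku].
have iU : (index u U < size U)%N by rewrite index_mem.
have [P [_ hP]] := qqP (index u U); have [qP hP' _] := hP.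
apply: (ku P hP'); have iPk := nz_prime_exp_ideal k hP'.
have [y ey] := ht0 _ qP (qqB _ iU).
have [_ /(_ _ iU erefl)] := hc _ qP; rewrite nth_index // => cE.
move: ey; rewrite cE opprK => ey; rewrite addrA [u + t0]addrC ey.
apply: is_idealD => //; first exact: exp_over_pow hP.
by apply: exp_over_dvd hP _; rewrite dvdn_fact // prime_gt0 // qqB.
Qed.

End Admissible.

(** * Admissible extensions by separated points in prescribed cosets *)

Section Separated.
Variables (K : fieldExtType rat) (d : nat).
Local Notation O := (ring_of_integers K).
Variables (b : 'I_d -> O) (hb : is_Zbasis b).
Variables (k : nat) (hk : (2 <= k)%N).
Implicit Types (P Q L : set O) (x y : O) (p q : nat) (F W : seq O).

Lemma infinite_avoid (g : nat -> O) W : injective g -> exists w, g w \notin W.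
Proof.
move=> gI; apply: contrapT => h.
have sub : {subset [seq g i | i <- iota 0 (size W).+1] <= W}.
  by move=> _ /mapP[i _ ->]; apply/negPn/negP => ni; apply: h; exists i.
have := uniq_leq_size _ sub; rewrite map_inj_uniq // iota_uniq => /(_ isT).
by rewrite size_map size_iota ltnn.
Qed.

(** A greedy choice: each [G i] has members outside any finite list, in particular outside the
    translates of W and -W by the earlier points. *)
Lemma separated_choice (G : nat -> O -> Prop) N W :
  (forall i W', (i < N)%N -> exists s, G i s /\ s \notin W') ->
  exists s : nat -> O, [/\ forall i, (i < N)%N -> G i (s i),
    forall i, (i < N)%N -> s i \notin W &
    forall i j, (i < N)%N -> (j < N)%N -> i <> j -> s i - s j \notin W].
Proof.
elim: N => [|N IH] h; first by exists (fun=> 0).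
have [|s [sG sW ss]] := IH; first by move=> i W' iN; apply: h; apply: ltnW.
have [t [tG]] := h N (W ++ [seq s i + w | i <- iota 0 N, w <- W] ++
  [seq s i - w | i <- iota 0 N, w <- W]) (ltnSn N).
rewrite !mem_cat !negb_or => /and3P[tW /allpairsP t1 /allpairsP t2].
exists (fun i => if i == N then t else s i); split.
- move=> i; rewrite ltnS leq_eqVlt; case: eqP => [-> _ //|_ /= iN]; exact: sG.
- move=> i; rewrite ltnS leq_eqVlt; case: eqP => [-> _ //|_ /= iN]; exact: sW.
move=> i j; rewrite !ltnS [(i <= N)%N]leq_eqVlt [(j <= N)%N]leq_eqVlt.
case: eqP => [->|_] /=; case: eqP => [->|_] //= iN jN ij; last exact: ss.
  apply/negP => tw; apply: t1; exists (j, t - s j); split=> //=.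
    by rewrite mem_iota.
  by rewrite addrC subrK.
apply/negP => tw; apply: t2; exists (i, s i - t); split=> //=.
  by rewrite mem_iota.
by rewrite subKr.
Qed.

Lemma exp_over_cancel q P n n' y : lies_over q P -> (n < q)%N -> (n' < q)%N -> n != n' ->
  ideal_exp P k (n%:R * y - n'%:R * y) -> ideal_exp P k y.
Proof.
move=> hq; have [qP hP _] := hq; have iPk := nz_prime_exp_ideal k hP.
wlog lt : n n' / (n' < n)%N => [wl nq nq' ne|].
  have [lt|lt|e] := ltngtP n n'; last by rewrite e eqxx in ne.
    by move=> /(is_idealBC iPk); apply: wl => //; rewrite eq_sym.
  exact: wl.
move=> nq nq' _; rewrite -mulrBl -natrB 1?ltnW //; apply: exp_prime_mul hq _.
rewrite coprime_sym prime_coprime //.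
rewrite gtnNdvd ?subn_gt0 //; exact: leq_ltn_trans (leq_subr _ _) nq.
Qed.

(* The p points [l + j m] of a line in a coset of [L] meet each coset of
   [Q^k] not containing the direction [m] at most once. *)
Lemma coset_avoid p r (Q : 'I_r -> set O) L (e : 'I_r -> O) c :
  (r < p)%N -> (forall i, lies_over p (Q i)) ->
  L 0 -> (forall x y, L x -> L y -> L (x + y)) ->
  exists l, L l /\ forall i, (exists2 m, L m & ~ ideal_exp (Q i) k m) ->
    ~ ideal_exp (Q i) k (c + l - e i).
Proof.
move=> rp hQ L0 LD.
have Ln n m : L m -> L (n%:R * m).
  by move=> Lm; elim: n => [|n IH]; rewrite ?mul0r // -addn1 natrD mulrDl mul1r; apply: LD.
have iQ i : is_ideal (ideal_exp (Q i) k) by case: (hQ i) => _ /(nz_prime_exp_ideal k).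
suff S n : (n <= r)%N -> exists l, L l /\ forall i : 'I_r, (i < n)%N ->
    (exists2 m, L m & ~ ideal_exp (Q i) k m) -> ~ ideal_exp (Q i) k (c + l - e i).
  by have [l [Ll hl]] := S r (leqnn r); exists l; split=> // i; apply: hl.
elim: n => [|n IH] nr; first by exists 0; split.
have [l [Ll hl]] := IH (ltnW nr); pose o := Ordinal nr.
have [[m Lm Qm]|no] := pselect (exists2 m, L m & ~ ideal_exp (Q o) k m); last first.
  exists l; split=> // i; rewrite ltnS leq_eqVlt => /predU1P[ei|]; last exact: hl.
  by have -> : i = o by apply: val_inj.
apply: contrapT => h.
have hit (j : 'I_p) : {i : 'I_r | [/\ (i <= n)%N,
    exists2 m, L m & ~ ideal_exp (Q i) k m & ideal_exp (Q i) k (c + (l + (j : nat)%:R * m) - e i)]}.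
  apply: cid; apply: contrapT => nh; apply: h; exists (l + (j : nat)%:R * m).
  split; first by apply: LD => //; apply: Ln.
  by move=> i ni hm Qi; apply: nh; exists i.
have inj : injective (fun j => sval (hit j)).
  move=> j j' ej; apply/val_inj/eqP/negPn/negP => ne.
  have [h1 h2 h3] := svalP (hit j); have [_ _] := svalP (hit j'); rewrite -ej.
  set i := sval (hit j) in h1 h2 h3 *; move=> h4.
  have Qim : ideal_exp (Q i) k m.
    apply: (exp_over_cancel (hQ i) (ltn_ord j) (ltn_ord j') ne).
    by have := is_idealB (iQ i) h3 h4; congr ideal_exp; ring.
  (* Two hits of one coset put m in Q_i^k. This is excluded for the new index n; for an earlier
     index it makes l itself a hit. *)
  move: h1; rewrite leq_eqVlt => /predU1P[ei|iltn].
    by apply: Qm; have <- : i = o by apply: val_inj.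
  apply: (hl i iltn h2); have := is_idealB (iQ i) h3 (is_idealMl (j : nat)%:R (iQ i) Qim).
  by congr ideal_exp; ring.
by have := leq_card _ inj; rewrite !card_ord leqNgt rp.
Qed.

(** Provides a residue that all new points can share at small primes. *)
Lemma exists_adm_point F : admissible k F -> exists x, admissible k (x :: F).
Proof.
case: F => [|f F] hF; last first.
  by exists f => P /hF[e he]; exists e => g; rewrite inE => /predU1P[->|/he//]; apply: he; rewrite mem_head.
exists 0 => P hP; exists 1 => f; rewrite inE => /eqP->; rewrite sub0r.
have iPk := nz_prime_exp_ideal k hP; move=> /(is_idealN iPk); rewrite opprK.
by case: (hP) => iP P1 _ _ /(ideal_exp_sub iP) h; apply/P1/h; apply: leq_trans hk.
Qed.

(** At a prime over p, [coset_avoid] or the free class assumed for Q^k = L applies; over a small q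
    the new points are congruent to [x1]; over a large q [miss_large] applies. The list W keeps the
    points apart. *)
Lemma separated_extension p L F W N (c : nat -> O) :
  prime p -> (d < p)%N -> L 0 -> (forall x y, L x -> L y -> L (x - y)) ->
  (forall y, L ((p ^ k)%:R * y)) ->
  (forall Q, lies_over p Q -> ideal_exp Q k = L \/ exists2 m, L m & ~ ideal_exp Q k m) ->
  (forall Q, lies_over p Q -> ideal_exp Q k = L ->
     exists e, (forall f, f \in F -> ~ L (f - e)) /\ forall i, (i < N)%N -> ~ L (c i - e)) ->
  admissible k F ->
  exists s : nat -> O, [/\ forall i, (i < N)%N -> L (s i - c i),
    forall i, (i < N)%N -> s i \notin W,
    forall i j, (i < N)%N -> (j < N)%N -> i <> j -> s i - s j \notin W &
    admissible k (F ++ mkseq s N)].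
Proof.
move=> pP dp L0 LB Lp hL hmiss hF.
have LN x : L x -> L (- x) by move=> Lx; rewrite -sub0r; apply: LB.
have LD x y : L x -> L y -> L (x + y) by move=> Lx Ly; rewrite -[y]opprK; apply: LB => //; apply: LN.
have [r [Q [rd Qinj hQ]]] := primes_over hb pP.
have hQi i : lies_over p (Q i) by apply/hQ; exists i.
have [x1 hx1] := exists_adm_point hF.
have he i : {e | (forall f, f \in F -> ~ ideal_exp (Q i) k (f - e)) /\
    (ideal_exp (Q i) k = L -> forall j, (j < N)%N -> ~ L (c j - e))}.
  apply: cid; have [eL|nL] := pselect (ideal_exp (Q i) k = L).
    by have [e [e1 e2]] := hmiss _ (hQi i) eL; exists e; rewrite eL.
  by have [_ hP _] := hQi i; have [e he] := hF _ hP; exists e.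
(* Beyond B a prime has more classes than there are points; M collects the remaining primes other
   than p. *)
pose B := (size F + N)%N.
pose M := (\prod_(q < B.+1 | prime q && (q != p :> nat)) q)%N.
have M_dvd q : prime q -> (q <= B)%N -> q <> p -> (q %| M)%N.
  move=> qP qB qp; rewrite /M (bigD1 (Ordinal (qB : (q < B.+1)%N))) /=; last by rewrite qP; apply/eqP.
  exact: dvdn_mulr.
have M_co : coprime (M ^ k) (p ^ k).
  apply: coprimeXl; apply: coprimeXr; rewrite /M; elim/big_ind: _ => [|m n|q /andP[qP qp]].
  - by rewrite coprime1n.
  - by rewrite coprimeMl => -> ->.
  by rewrite prime_coprime // dvdn_prime2.
have M0 : (0 < M)%N by apply: prodn_cond_gt0 => q /andP[/prime_gt0].
pose G i s := [/\ L (s - c i),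
  forall j, (exists2 m, L m & ~ ideal_exp (Q j) k m) -> ~ ideal_exp (Q j) k (s - sval (he j)) &
  exists y, s - x1 = (M ^ k)%:R * y].
have Ginf i W' : (i < N)%N -> exists s, G i s /\ s \notin W'.
  move=> iN; have rp : (r < p)%N by apply: leq_ltn_trans dp.
  have [l [Ll hl]] := coset_avoid (fun j => sval (he j)) (c i) rp hQi L0 LD.
  have [u [v e]] := nat_bezout K M_co.
  (* Congruent to c i + l modulo p^k and to x1 modulo M^k. Adding multiples of p^k M^k keeps both
     and gives infinitely many candidates. *)
  pose s0 := c i + l + (x1 - (c i + l)) * (v%:~R * (p ^ k)%:R).
  pose g (w : nat) := s0 + (p ^ k)%:R * ((M ^ k)%:R * w%:R).
  have gI : injective g.
    move=> w w' /addrI; have h m : (0 < m)%N -> (m%:R : O) != 0 by rewrite natO_eq0 -lt0n.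
    move=> /(lregO (h _ _)); rewrite expn_gt0 prime_gt0 // => /(_ isT).
    move=> /(lregO (h _ _)); rewrite expn_gt0 M0 => /(_ isT) /eqP.
    rewrite !pmulrn -subr_eq0 -rmorphB intO_eq0; lia.
  have [w gw] := infinite_avoid W' gI; exists (g w); split=> //.
  have gE : g w = c i + l + (p ^ k)%:R * ((x1 - (c i + l)) * v%:~R + (M ^ k)%:R * w%:R).
    by rewrite /g /s0; ring.
  split.
  - have -> : g w - c i = l + (p ^ k)%:R * ((x1 - (c i + l)) * v%:~R + (M ^ k)%:R * w%:R).
      by rewrite gE; ring.
    exact: LD.
  - move=> j hm Qj; apply: (hl j hm).
    have [_ hP _] := hQi j; have iP := nz_prime_exp_ideal k hP.
    have := is_idealB iP Qj (exp_over_pow k ((x1 - (c i + l)) * v%:~R + (M ^ k)%:R * w%:R) (hQi j)).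
    by rewrite gE; congr ideal_exp; ring.
  exists ((c i + l - x1) * u%:~R + (p ^ k)%:R * w%:R).
  have e2 : 1 - v%:~R * (p ^ k)%:R = u%:~R * (M ^ k)%:R :> O by apply/eqP; rewrite subr_eq e.
  transitivity ((c i + l - x1) * (1 - v%:~R * (p ^ k)%:R) + (p ^ k)%:R * ((M ^ k)%:R * w%:R)).
    by rewrite /g /s0; ring.
  by rewrite e2; ring.
have [s [sG sW ss]] := separated_choice W Ginf.
exists s; split=> // [i iN|P hP]; first by have [] := sG i iN.
have [q hq] := nz_prime_over hP; have [qP _ _] := hq.
have iPk := nz_prime_exp_ideal k hP.
have [eqp|nqp] := eqVneq q p.
  rewrite eqp in hq; have /hQ[j ej] := hq.
  exists (sval (he j)); have [e1 e2] := svalP (he j); rewrite ej.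
  move=> f; rewrite mem_cat => /orP[|/mapP[i]]; first exact: e1.
  rewrite mem_iota /= => iN ->; have [h1 h2 _] := sG i iN.
  have [eL|nL] := hL _ (hQi j); last exact: h2.
  have LE z : ideal_exp (Q j) k z -> L z by rewrite eL.
  move=> /LE h3; apply: (e2 eL i iN).
  by have := LB _ _ h3 h1; congr L; ring.
have [qB|qB] := leqP q B.
  have [e he'] := hx1 P hP; exists e => f; rewrite mem_cat => /orP[fF|/mapP[i]].
    by apply: he'; rewrite inE fF orbT.
  rewrite mem_iota /= => iN ->; have [_ _ [y ey]] := sG i iN.
  move=> h3; apply: (he' x1); first by rewrite mem_head.
  have := is_idealB iPk h3 (exp_over_dvd k y hq (M_dvd q qP qB _)); rewrite -ey.
  move=> h4; have := h4 (fun e => negP nqp (introT eqP e)); congr ideal_exp; ring.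
by apply: (miss_large hk hq); rewrite size_cat size_mkseq.
Qed.

End Separated.

(** * Cylinders, compactness and local rules in the full shift *)

Section ShiftTopology.
Variable d : nat.
Local Notation Zd := 'rV[int]_d.

Definition cylinder (W : seq Zd) (x : full_shift d) : set (full_shift d) :=
  [set y | forall w, w \in W -> y w = x w].

Lemma nbhs_coordinate (x : full_shift d) w : nbhs x [set y : full_shift d | y w = x w].
Proof.
have c : continuous (fun y : full_shift d => y w).
  exact: (@proj_continuous _ (fun=> bool) w).
have /c : nbhs (x w) [set x w] by rewrite nbhs_principalE.
exact.
Qed.

Lemma nbhs_cylinder W (x : full_shift d) : nbhs x (cylinder W x).
Proof.
elim: W => [|w W IH]; first by apply: filterS filterT => y _ w.
apply: filterS (filterI (nbhs_coordinate x w) IH) => y [/= yw yW] v.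
by rewrite inE => /predU1P[->|/yW].
Qed.

(** The filter generated by the cylinders of x converges to x in each coordinate, hence in the
    product topology. *)
Lemma cylinder_sub_nbhs (x : full_shift d) U : nbhs x U -> exists W, cylinder W x `<=` U.
Proof.
pose F : set_system (full_shift d) := filter_from setT (cylinder^~ x).
have FF : Filter F.
  apply: filter_from_filter; first by exists [::].
  move=> W W' _ _; exists (W ++ W') => // y yW.
  by split=> w wW; apply: yW; rewrite mem_cat wW ?orbT.
have cF : {ptws, F --> x}.
  apply/cvg_sup => t B [_ [[V _ <-] Vx] VB].
  exists [:: t] => // y yt; apply: VB; rewrite /= /proj /= (yt t) ?mem_head //.
by move=> /cF[W _ WU]; exists W.
Qed.

Lemma compact_full_shift : compact [set: full_shift d].
Proof.
have -> : [set: full_shift d] = [set f | forall i, [set: bool] (f i)] by apply/seteqP; split.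
exact: (@tychonoff Zd (fun=> bool) (fun=> setT) (fun=> bool_compact)).
Qed.

Variable A : set Zd.

Lemma compact_orbit_closure : compact (orbit_closure A).
Proof.
apply: subclosed_compact compact_full_shift _ => //.
exact: closed_closure.
Qed.

Lemma system_nbhs (x : system A) (U : set (system A)) : nbhs x U ->
  exists W, forall y : system A, cylinder W (set_val x) (set_val y) -> U y.
Proof.
move=> [V [[V0 oV0 <-] Vx] VU].
have [W hW] := cylinder_sub_nbhs (open_nbhs_nbhs (conj oV0 Vx)).
by exists W => y yW; apply: VU; apply: hW.
Qed.

(* Curtis-Hedlund-Lyndon: compactness makes the window uniform. *)
Lemma finite_window (H : system A -> system A) v : continuous H ->
  exists W : seq Zd, forall x y : system A, (forall w, w \in W -> set_val x w = set_val y w) ->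
    set_val (H x) v = set_val (H y) v.
Proof.
move=> cH.
have loc (x : system A) : exists W : seq Zd, forall y : system A,
    cylinder W (set_val x) (set_val y) -> set_val (H y) v = set_val (H x) v.
  have vc : continuous (set_val : system A -> full_shift d).
    exact: (@initial_continuous (system A) (full_shift d) set_val).
  have := cH x _ (vc (H x) _ (nbhs_coordinate (set_val (H x)) v)).
  by move=> /system_nbhs[W hW]; exists W => y /hW.
pose Wx x := sval (cid (loc x)).
have hWx x : forall y, cylinder (Wx x) (set_val x) (set_val y) -> set_val (H y) v = set_val (H x) v.
  exact: (svalP (cid (loc x))).
apply: contrapT => nW.
have cpt := compact_orbit_closure.
(* If every finite window failed, the failures would generate a proper filter, and its cluster point
   would contradict the window valid near that point. *)
pose bad (W : seq Zd) : set (full_shift d) := [set x0 | exists x y : system A,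
  [/\ set_val x = x0, cylinder W (set_val x) (set_val y) & set_val (H x) v <> set_val (H y) v]].
pose F : set_system (full_shift d) := filter_from setT bad.
have hbad W : exists x0, bad W x0.
  apply: contrapT => h; apply: nW; exists W => x y xy; apply: contrapT => n.
  by apply: h; exists (set_val x), x, y; split=> // w wW; rewrite xy.
have FF : ProperFilter F.
  apply: filter_from_proper.
    apply: filter_from_filter; first by exists [::].
    move=> W W' _ _; exists (W ++ W') => // x0 [x [y [e xy n]]].
    by split; exists x, y; split=> // w wW; apply: xy; rewrite mem_cat wW ?orbT.
  by move=> W _; have [x0] := hbad W; exists x0.
have FX : F (orbit_closure A).
  by exists [::] => // x0 [x [y [<- _ _]]]; apply: set_mem (valP x).
have [x0 [Xx0 cl]] := cpt F FF FX.
pose x : system A := exist _ x0 (mem_set Xx0).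
have Fb : F (bad (Wx x)) by exists (Wx x).
have [z [[y1 [y2 [e1 y12 n]]] zx]] := cl _ _ Fb (nbhs_cylinder (Wx x) x0).
apply: n; rewrite !(hWx x) //.
  by move=> w wW; rewrite y12 // e1 zx.
by rewrite e1.
Qed.

End ShiftTopology.

(** * Configurations as subsets of O; pullbacks of prime powers under additive bijections *)

Section Dynamics.
Variables (K : fieldExtType rat) (d : nat).
Local Notation O := (ring_of_integers K).
Variables (b : 'I_d -> O) (hb : is_Zbasis b).
Variables (k : nat) (hk : (2 <= k)%N).
Implicit Types (P Q : set O) (x y : O) (p q : nat) (F W : seq O).
Hypothesis hdeg : forall B, exists p P, (B < p)%N /\ degree_one p P k.

Local Notation X := (system (k_free_lattice b k)).
Local Notation T t := (@system_translate d (k_free_lattice b k) (coords hb t)).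

(** Reads a configuration as a subset of O, so that the arguments below are free of the basis. *)
Definition mem_sys (u : X) x : bool := (set_val u : full_shift d) (coords hb x).

Lemma mem_sys_inj (u v : X) : (forall x, mem_sys u x = mem_sys v x) -> u = v.
Proof.
move=> e; apply: val_inj; apply/funext => z.
by have := e (lattice_elt b z); rewrite /mem_sys latticeK.
Qed.

Lemma mem_translate t (u : X) x : mem_sys (T t u) x = mem_sys u (x - t).
Proof. by rewrite /mem_sys /= /translate coordsD coordsN. Qed.

(** On a finite window u agrees with a translate z + V. Each f - z is then k-free, so z is a missed
    class modulo every P^k at once. *)
Lemma mem_sys_admissible (u : X) (F : seq O) :
  (forall f, f \in F -> mem_sys u f) -> admissible k F.
Proof.
move=> hF P hP.
have [y [[z _ <-] hy]] := set_mem (valP u) _ (nbhs_cylinder [seq coords hb f | f <- F] (set_val u)).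
exists (lattice_elt b z) => f fF.
have /hF : f \in F by [].
rewrite /mem_sys -hy ?map_f // /translate /char_fun => /asboolP.
rewrite /k_free_lattice /= => /(k_freeP hb)[_ /(_ P hP)].
by rewrite lattice_eltD lattice_eltN coordsK.
Qed.

(** A finite admissible set with nothing else around it is a point of the system: by
    [admissible_pattern], each of its cylinders contains a translate of V. *)
Lemma exists_config (F : seq O) : admissible k F -> {u : X | forall x, mem_sys u x = (x \in F)}.
Proof.
move=> hF; pose c : full_shift d := fun z => lattice_elt b z \in F.
have cX : orbit_closure (k_free_lattice b k) c.
  move=> U /cylinder_sub_nbhs[W hW].
  have [||t [tF tU]] := @admissible_pattern _ _ _ hb k hk hdeg F
    [seq x <- [seq lattice_elt b w | w <- W] | x \notin F] => //.
    by move=> v; rewrite mem_filter => /andP[].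
  exists (translate (- coords hb t) (char_fun (k_free_lattice b k))); split.
    by exists (- coords hb t).
  apply: hW => w wW; rewrite /translate opprK /char_fun /k_free_lattice /=.
  rewrite lattice_eltD coordsK /c; apply/asboolP/idP => [kf|/tF//].
  apply/negPn/negP => nF; apply: (tU (lattice_elt b w)) => //.
  by rewrite mem_filter nF map_f.
by exists (exist _ c (mem_set cX)) => x; exact: (congr1 (fun z => z \in F) (coordsK hb x)).
Qed.

Definition config F (hF : admissible k F) : X := sval (exists_config hF).

Lemma mem_config F (hF : admissible k F) x : mem_sys (config hF) x = (x \in F).
Proof. exact: (svalP (exists_config hF)). Qed.

Lemma admissible0 : @admissible K k [::].
Proof. by move=> P _; exists 0. Qed.

Lemma admissible1 x : admissible k [:: x].
Proof.
move=> P hP; exists (x + 1) => f; rewrite inE => /eqP-> h; have [iP P1 _ _] := hP.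
apply: P1; rewrite -[1]opprK; apply: is_idealN => //.
apply: (ideal_exp_sub iP (k := k)); first exact: leq_trans hk.
by move: h; rewrite opprD addrA subrr add0r.
Qed.

Lemma degree_one_residue p P x : degree_one p P k ->
  exists2 n, (n < p ^ k)%N & ideal_exp P k (x - n%:R).
Proof.
move=> [hp hZ _]; have [pP hP _] := hp; have iPk := nz_prime_exp_ideal k hP.
have pk0 : (0 < p ^ k)%N by rewrite expn_gt0 prime_gt0.
have [n hn] := hZ x; pose m := (n %% (p ^ k)%N)%Z.
have m0 : 0 <= m by rewrite modz_ge0 // -lt0n.
exists `|m|%N; first by rewrite -ltz_nat gez0_abs // ltz_pmod.
rewrite pmulrn gez0_abs //.
have -> : x - m%:~R = x - n%:~R + (p ^ k)%:R * (n %/ (p ^ k)%N)%Z%:~R.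
  have -> : n%:~R = (n %/ (p ^ k)%N)%Z%:~R * (p ^ k)%:R + m%:~R :> O.
    by rewrite {1}(divz_eq n (p ^ k)%N) intrD intrM.
  ring.
by apply: is_idealD => //; apply: exp_over_pow hp.
Qed.

(** The arguments about an equivariant map all end in this contradiction. *)
Lemma full_not_admissible p P (F : seq O) : degree_one p P k ->
  (forall n, (n < p ^ k)%N -> exists2 f, f \in F & ideal_exp P k (f - n%:R)) ->
  ~ admissible k F.
Proof.
move=> hp full hF; have [[pP hP _] _ _] := hp; have iPk := nz_prime_exp_ideal k hP.
have [e he] := hF P hP; have [n nk en] := degree_one_residue e hp.
have [f fF fn] := full n nk; apply: (he f fF).
have := is_idealB iPk fn en; congr ideal_exp; ring.
Qed.

Section Pullback.
Variables (a a' : O -> O) (aD : {morph a : x y / x + y}) (aK : cancel a a') (a'K : cancel a' a).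

Lemma additive_map0 : a 0 = 0.
Proof. by apply: (addrI (a 0)); rewrite -aD !addr0. Qed.

Lemma additive_mapN x : a (- x) = - a x.
Proof. by apply/eqP; rewrite -addr_eq0 -aD addNr additive_map0. Qed.

Lemma additive_mapB x y : a (x - y) = a x - a y.
Proof. by rewrite aD additive_mapN. Qed.

Lemma additive_map_nat n x : a (n%:R * x) = n%:R * a x.
Proof.
elim: n => [|n IH]; first by rewrite !mul0r additive_map0.
by rewrite -addn1 natrD !mulrDl !mul1r aD IH.
Qed.

(** A priori only a subgroup; [equivariant_pullback] will identify it with a prime power. *)
Definition pullback P : set O := [set x | ideal_exp P k (a x)].

(** Index count: the residue of a y modulo P^k separates the cosets of the pullback, so there are at
    most p^k of them, while Q^k has at least p^k cosets. *)
Lemma pullback_sub_eq p P Q : degree_one p P k -> lies_over p Q ->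
  pullback P `<=` ideal_exp Q k -> ideal_exp Q k = pullback P.
Proof.
move=> hp hQ sub; apply/seteqP; split=> // z Qz.
have [hpP _ _] := hp; have [pP hP _] := hpP; have [_ hQ' _] := hQ.
have iPk := nz_prime_exp_ideal k hP; have iQk := nz_prime_exp_ideal k hQ'.
have [g gI] := exp_prime_incongruent hb k hQ.
have hn y : {n : 'I_(p ^ k) | ideal_exp P k (a y - (n : nat)%:R)}.
  by apply: cid; have [n nk h] := degree_one_residue (a y) hp; exists (Ordinal nk).
pose h (i : 'I_(p ^ k)) := sval (hn (g i)).
have h_sub y i : sval (hn y) = h i -> ideal_exp Q k (y - g i).
  move=> e; apply: sub; rewrite /pullback /= additive_mapB.
  have := is_idealB iPk (svalP (hn y)) (svalP (hn (g i))).
  by rewrite -/(h i) e; congr ideal_exp; ring.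
have h_inj : injective h.
  move=> i j e; apply: val_inj; apply: gI; [exact: ltn_ord | exact: ltn_ord |].
  exact: h_sub.
(* As h permutes the residues, z shares its residue with some [g i], and residue 0 belongs to some
   [g i0]. Both [g i] and [g i0] lie in Q^k, so i = i0 and z has residue 0. *)
have [hinv _ hK] := injF_bij h_inj.
have [i ei] : exists i, sval (hn z) = h i by exists (hinv (sval (hn z))).
have Qi : ideal_exp Q k (g i).
  by have := is_idealB iQk Qz (h_sub z i ei); congr ideal_exp; ring.
have pk0 : (0 < p ^ k)%N by rewrite expn_gt0 prime_gt0.
pose o := Ordinal pk0; pose i0 := hinv o.
have ei0 : h i0 = o by rewrite /i0 hK.
have Qi0 : ideal_exp Q k (g i0).
  apply: sub; rewrite /pullback /=; have := svalP (hn (g i0)).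
  by rewrite -/(h i0) ei0 /= subr0.
have e : i = i0.
  by apply: val_inj; apply: gI; [exact: ltn_ord | exact: ltn_ord | exact: is_idealB].
by have := svalP (hn z); rewrite /= ei e ei0 /= subr0.
Qed.

Lemma pullback_dichotomy p P Q : degree_one p P k -> lies_over p Q ->
  ideal_exp Q k = pullback P \/ exists2 m, pullback P m & ~ ideal_exp Q k m.
Proof.
move=> hp hQ; have [sub|] := pselect (pullback P `<=` ideal_exp Q k).
  by left; apply: pullback_sub_eq hp hQ sub.
by move=> /existsNP[m /not_implyP[h1 h2]]; right; exists m.
Qed.

Lemma pullback0 P : is_ideal P -> pullback P 0.
Proof. by move=> iP; rewrite /pullback /= additive_map0; case: (ideal_exp_ideal k iP). Qed.

Lemma pullbackB P x y : is_ideal P -> pullback P x -> pullback P y -> pullback P (x - y).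
Proof.
move=> iP; rewrite /pullback /= additive_mapB.
by apply: is_idealB; apply: ideal_exp_ideal.
Qed.

Lemma pullback_pow p P y : lies_over p P -> pullback P ((p ^ k)%:R * y).
Proof. by move=> hp; rewrite /pullback /= additive_map_nat; apply: exp_over_pow hp. Qed.

(** Class 0 is spared: should the pullback be some Q^k, then e = 0 is missed both by F and by the
    targets a' (i + 1). *)
Lemma exists_nonzero_transversal p P F W : degree_one p P k -> (d < p)%N ->
  admissible k F -> (forall f, f \in F -> ~ pullback P f) ->
  exists s : nat -> O, [/\
    forall i, (i < (p ^ k).-1)%N -> ideal_exp P k (a (s i) - i.+1%:R),
    forall i, (i < (p ^ k).-1)%N -> s i \notin W,
    forall i j, (i < (p ^ k).-1)%N -> (j < (p ^ k).-1)%N -> i <> j -> s i - s j \notin W &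
    admissible k (F ++ mkseq s (p ^ k).-1)].
Proof.
move=> hp dp hF nF; have [hpP _ pdvd] := hp; have [pP hP _] := hpP.
have iP := nz_prime_ideal hP.
have [||||Q hQ e|//|s [s1 s2 s3 s4]] := @separated_extension _ _ _ hb k hk p (pullback P) F W
  (p ^ k).-1 (fun i => a' i.+1%:R) pP dp.
- exact: pullback0.
- by move=> x y; apply: pullbackB.
- by move=> y; apply: pullback_pow.
- by move=> Q; apply: pullback_dichotomy.
- exists 0; split=> [f fF|i iN]; rewrite subr0; first exact: nF.
  rewrite /pullback /= a'K pmulrn => /pdvd /dvdn_leq /= => /(_ isT).
  rewrite leqNgt (_ : (i.+1 < p ^ k)%N) //.
  by rewrite -ltn_predRL.
exists s; split=> // i /s1; rewrite /pullback /= additive_mapB a'K //.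
Qed.

End Pullback.

End Dynamics.

(** * Rigidity of continuous maps that are equivariant along an additive bijection *)

Section EquivariantMaps.
Variables (K : fieldExtType rat) (d : nat).
Local Notation O := (ring_of_integers K).
Variables (b : 'I_d -> O) (hb : is_Zbasis b).
Variables (k : nat) (hk : (2 <= k)%N).
Implicit Types (P Q : set O) (x y : O) (p q : nat) (F W : seq O).
Hypothesis hdeg : forall B, exists p P, (B < p)%N /\ degree_one p P k.

Local Notation X := (system (k_free_lattice b k)).
Local Notation T t := (@system_translate d (k_free_lattice b k) (coords hb t)).
Local Notation msys := (mem_sys hb).
Local Notation config := (config hb hk hdeg).
Local Notation point x := (config (admissible1 hk x)).

Definition equivariant (H : X -> X) (a : O -> O) := forall t u, H (T t u) = T (a t) (H u).

Lemma translate_point t x : T t (point x) = point (x + t).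
Proof.
apply: (mem_sys_inj (hb := hb)) => y; rewrite mem_translate !mem_config !inE.
by rewrite subr_eq.
Qed.

(** The window for coordinate 0 serves every coordinate, since translating by -z before [H] moves a
    z to 0 after it. *)
Lemma equivariant_window H a : {morph a : x y / x + y} -> continuous H -> equivariant H a ->
  exists W, forall u v z, (forall w, w \in W -> msys u (z + w) = msys v (z + w)) ->
    msys (H u) (a z) = msys (H v) (a z).
Proof.
move=> aD cH HT; have [W hW] := finite_window (coords hb 0) cH.
exists [seq lattice_elt b w | w <- W] => u v z uv.
have tr u' : msys (H u') (a z) = msys (H (T (- z) u')) 0.
  by rewrite HT mem_translate sub0r (additive_mapN aD) opprK.
rewrite !tr; apply: hW => w wW; have := uv _ (map_f (lattice_elt b) wW).
have := mem_translate hb (- z) u (lattice_elt b w).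
have := mem_translate hb (- z) v (lattice_elt b w).
rewrite {1 3}/mem_sys latticeK opprK addrC => -> ->.
by rewrite addrC.
Qed.

Section Map.
Variables (a a' : O -> O) (aD : {morph a : x y / x + y}) (aK : cancel a a') (a'K : cancel a' a).
Variables (H : X -> X) (cH : continuous H) (HT : equivariant H a).

(** The image of the empty configuration is invariant under all translations; if nonempty it would
    be all of O, which meets every class. *)
Lemma equivariant_empty x : msys (H (config (@admissible0 K k))) x = false.
Proof.
have Te t : T t (config (@admissible0 K k)) = config (@admissible0 K k).
  by apply: (mem_sys_inj (hb := hb)) => y; rewrite mem_translate !mem_config.
apply/negbTE/negP => hx; have [p [P [_ hp]]] := hdeg 0.
apply: (full_not_admissible (F := [seq n%:R | n <- iota 0 (p ^ k)]) hp).
  move=> n nk; exists n%:R; first by apply: map_f; rewrite mem_iota.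
  have [[_ hP _] _ _] := hp; have [h0 _] := nz_prime_exp_ideal k hP.
  by rewrite subrr.
apply: (mem_sys_admissible (hb := hb) (u := H (config (@admissible0 K k)))) => f _.
have := mem_translate hb (a (a' (x - f))) (H (config (@admissible0 K k))) x.
by rewrite -HT Te a'K subKr => <-.
Qed.

(** When no point of F other than s is seen from s + g, the local rule cannot tell F from the
    singleton of s there. *)
Lemma equivariant_isolated W F (hF : admissible k F) s g :
  (forall u v z, (forall w, w \in W -> msys u (z + w) = msys v (z + w)) ->
    msys (H u) (a z) = msys (H v) (a z)) ->
  s \in F -> (forall w, w \in W -> s + g + w \in F -> s + g + w = s) ->
  msys (H (config hF)) (a (s + g)) = msys (H (point 0)) (a g).
Proof.
move=> hW sF iso.
have -> : msys (H (point 0)) (a g) = msys (H (point s)) (a (s + g)).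
  have <- : T s (point 0) = point s by rewrite translate_point add0r.
  by rewrite HT mem_translate aD addrAC subrr add0r.
apply: hW => w wW; rewrite !mem_config inE; apply/idP/eqP => [/(iso w wW)//|->//].
Qed.

(** Let the image of the singleton 0 contain a f and a x with x <> f. If the a (s_i) cover the
    nonzero classes modulo P^k, the elements a (s_i) + a f miss only the class of a f, and the a
    (s_i) + a x only that of a x. For large P these classes differ, so together all classes are
    met. *)
Lemma equivariant_point (Hinj : injective H) :
  exists f, forall x, msys (H (point 0)) (a x) = (x == f).
Proof.
have [W hW] := equivariant_window aD cH HT.
(* The image of the singleton is confined to a (- W): elsewhere the window shows the empty
   configuration. *)
have win x : msys (H (point 0)) (a x) -> exists2 w, w \in W & x + w = 0.
  move=> hx; apply: contrapT => nw.
  have := equivariant_empty (a x); rewrite -(hW (point 0)) ?hx // => w wW.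
  rewrite !mem_config inE in_nil; apply/negP => /eqP e; apply: nw; by exists w.
have [f hf] : exists f, msys (H (point 0)) (a f).
  apply: contrapT => nf; suff : point 0 = config (@admissible0 K k).
    move=> e; have := mem_config hb hk hdeg (@admissible0 K k) 0.
    by rewrite -e mem_config inE eqxx.
  apply: Hinj; apply: (mem_sys_inj (hb := hb)) => x; rewrite equivariant_empty.
  by apply/negP => hx; apply: nf; exists (a' x); rewrite a'K.
exists f => x; apply/idP/eqP => [hx|->//]; apply: contrapT => xf.
have a'0 : a' 0 = 0 by rewrite -{1}(additive_map0 aD) aK.
have axf : a (x - f) != 0.
  by apply/eqP => e; apply: xf; apply/eqP; rewrite -subr_eq0 -(aK (x - f)) e a'0.
have [D hD] := over_avoids axf.
have [p [P [Dp hp]]] := hdeg (D + d); have [hpP _ _] := hp; have [pP hP _] := hpP.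
have iPk := nz_prime_exp_ideal k hP.
have nPxf : ~ ideal_exp P k (a (x - f)).
  by move/(exp_over_sub hk hpP); apply: hD hpP; apply: leq_ltn_trans Dp; apply: leq_addr.
(* Separation by W - W: if s_j is seen from s_i + g through w, then g = - w' by [win], and s_j - s_i
   = w - w'. *)
have [|//|s [s1 _ s3 sadm]] := @exists_nonzero_transversal _ _ _ hb k hk a a' aD a'K p P [::]
  [seq w - w' | w <- W, w' <- W] hp _ (@admissible0 K k).
  by apply: leq_ltn_trans Dp; apply: leq_addl.
set N := (p ^ k).-1 in s1 s3 sadm; pose G := [seq a (s i + g) | i <- iota 0 N, g <- [:: x; f]].
rewrite cat0s in sadm.
have memG i g : (i < N)%N -> msys (H (point 0)) (a g) -> msys (H (config sadm)) (a (s i + g)).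
  move=> iN hg; rewrite (equivariant_isolated sadm hW) //.
    by apply: map_f; rewrite mem_iota.
  move=> w wW /mapP[j]; rewrite mem_iota /= => jN e.
  rewrite e; have [-> //|ij] := eqVneq j i; have [w' w'W ew] := win g hg.
  have := s3 j i jN iN (fun e => negP ij (introT eqP e)).
  case/negP; apply/allpairsP; exists (w, w'); split=> //=.
  by rewrite -e -{1}[w]subr0 -ew; ring.
apply: (full_not_admissible (F := G) hp); last first.
  apply: (mem_sys_admissible (hb := hb) (u := H (config sadm))) => _ /allpairsP[[i g] /= [iN gg ->]].
  rewrite mem_iota in iN; apply: memG => //.
  by move: gg; rewrite !inE => /orP[]/eqP->.
move=> n nk.
have hit g m : (0 < m)%N -> (m < p ^ k)%N -> g \in [:: x; f] ->
    ideal_exp P k (n%:R - a g - m%:R) -> exists2 f0, f0 \in G & ideal_exp P k (f0 - n%:R).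
  move=> m0 mk gg hm; have iN : (m.-1 < N)%N by rewrite /N; lia.
  exists (a (s m.-1 + g)); first by apply/allpairsP; exists (m.-1, g); rewrite mem_iota.
  have := s1 _ iN; rewrite prednK // aD => h.
  by have := is_idealB iPk h hm; congr ideal_exp; ring.
have [m mk hm] := degree_one_residue (n%:R - a x) hp.
have [m0|m0] := posnP m; last by apply: (hit x m); rewrite ?inE ?eqxx.
have [m' mk' hm'] := degree_one_residue (n%:R - a f) hp.
have [m0'|m0'] := posnP m'; last by apply: (hit f m'); rewrite ?inE ?eqxx ?orbT.
case: nPxf; have := is_idealB iPk hm' hm; rewrite m0 m0' (additive_mapB aD).
by congr ideal_exp; ring.
Qed.

(** If 0 is in H u but not in u, keep the part F of u seen from 0 and add distant s_i with the a
    (s_i) covering the nonzero classes modulo P^k. The image still contains 0 and contains every a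
    (s_i), so it meets all classes. *)
Lemma equivariant_sub : (forall x, msys (H (point 0)) (a x) = (x == 0)) ->
  forall u z, msys (H u) (a z) -> msys u z.
Proof.
move=> H0; have [W hW] := equivariant_window aD cH HT.
suff key u : msys (H u) 0 -> msys u 0.
  move=> u z hz; have := key (T (- z) u).
  by rewrite HT !mem_translate !sub0r (additive_mapN aD) !opprK; apply.
move=> hu; apply/negPn/negP => nu.
pose F := [seq w <- W | msys u w].
have hF : admissible k F.
  by apply: (mem_sys_admissible (hb := hb) (u := u)) => f; rewrite mem_filter => /andP[].
have aF0 : 0 \notin [seq a f | f <- F].
  apply/negP => /mapP[f]; rewrite mem_filter => /andP[fu _] e; case/negP: nu.
  by rewrite (_ : 0 = f) // -(aK f) -e -{2}(additive_map0 aD) aK.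
have [D hD] := over_avoids_seq aF0.
have [p [P [Dp hp]]] := hdeg (D + d); have [hpP _ _] := hp; have [pP hP _] := hpP.
have iPk := nz_prime_exp_ideal k hP.
have nF f : f \in F -> ~ pullback k a P f.
  move=> fF /(exp_over_sub hk hpP); apply: hD hpP (map_f a fF).
  by apply: leq_ltn_trans Dp; apply: leq_addr.
(* The excluded values keep the s_i out of the window at 0, F out of the windows at the s_i, and the
   s_i out of each other's windows. *)
have [|s [s1 s2 s3 sadm]] := @exists_nonzero_transversal _ _ _ hb k hk a a' aD a'K p P F
  (W ++ [seq f - w | f <- F, w <- W] ++ [seq - w | w <- W] ++ W) hp _ hF nF.
  by apply: leq_ltn_trans Dp; apply: leq_addl.
set N := (p ^ k).-1 in s1 s2 s3 sadm.
pose G := 0 :: [seq a (s i) | i <- iota 0 N].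
apply: (full_not_admissible (F := G) hp); last first.
  apply: (mem_sys_admissible (hb := hb) (u := H (config sadm))) => g; rewrite inE => /predU1P[->|].
    rewrite -(additive_map0 aD) (hW _ u) ?(additive_map0 aD) // => w wW.
    rewrite add0r mem_config mem_cat mem_filter wW andbT.
    case: (boolP (msys u w)) => //= _; apply/negP => /mapP[i]; rewrite mem_iota /= => iN e.
    by have := s2 i iN; rewrite mem_cat -e wW.
  move=> /mapP[i]; rewrite mem_iota /= => iN ->; rewrite -[s i]addr0.
  rewrite (equivariant_isolated sadm hW) ?H0 ?eqxx //.
    by rewrite mem_cat map_f ?orbT // mem_iota.
  move=> w wW; rewrite addr0 mem_cat => /orP[wF|/mapP[j]].
    have := s2 i iN; rewrite !mem_cat !negb_or => /and3P[_ /allpairsP nn _].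
    by case: nn; exists (s i + w, w); split=> //=; rewrite addrK.
  rewrite mem_iota /= => jN e; rewrite e; have [-> //|ij] := eqVneq j i.
  have := s3 j i jN iN (fun e => negP ij (introT eqP e)).
  by rewrite -e addrAC subrr add0r mem_cat wW.
move=> n nk; have [n0|n0] := posnP n.
  by exists 0; rewrite ?inE ?eqxx // n0 subrr; case: iPk.
have iN : (n.-1 < N)%N by rewrite /N; lia.
exists (a (s n.-1)); first by rewrite inE map_f ?orbT // mem_iota.
by have := s1 _ iN; rewrite prednK.
Qed.

(** If no Q^k were the pullback, no class would have to be spared: all p^k classes could be targets,
    and the image of an admissible set would meet every class. *)
Lemma equivariant_pullback p P : (forall u z, msys (H u) (a z) = msys u z) ->
  degree_one p P k -> (d < p)%N -> exists2 Q, lies_over p Q & ideal_exp Q k = pullback k a P.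
Proof.
move=> HE hp dp; apply: contrapT => nQ; have [hpP _ _] := hp; have [pP hP _] := hpP.
have iPk := nz_prime_exp_ideal k hP; have iP := nz_prime_ideal hP.
have [||||Q hQ e|//|s [s1 _ _ sadm]] := @separated_extension _ _ _ hb k hk p (pullback k a P) [::] [::]
  (p ^ k) (fun i => a' i%:R) pP dp.
- exact: pullback0.
- by move=> x y; apply: pullbackB.
- by move=> y; apply: pullback_pow.
- by move=> Q; apply: pullback_dichotomy.
- by case: nQ; exists Q.
- exact: admissible0.
rewrite cat0s in sadm.
apply: (full_not_admissible (F := [seq a (s i) | i <- iota 0 (p ^ k)]) hp); last first.
  apply: (mem_sys_admissible (hb := hb) (u := H (config sadm))) => f /mapP[i]; rewrite mem_iota /= => iN ->.
  by rewrite HE mem_config map_f // mem_iota.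
move=> n nk; exists (a (s n)); first by apply: map_f; rewrite mem_iota.
by have := s1 n nk; rewrite /pullback /= (additive_mapB aD) a'K.
Qed.

End Map.

End EquivariantMaps.

(** * From prime power pullbacks to semilinearity *)

Section Multiplicativity.
Variable K : fieldExtType rat.
Local Notation O := (ring_of_integers K).
Variables (k : nat) (hk : (2 <= k)%N).
Variables (a a' : O -> O) (aD : {morph a : x y / x + y}) (aK : cancel a a') (a'K : cancel a' a).

Lemma additive_map_int (z : int) w : a (z%:~R * w) = z%:~R * a w.
Proof.
case: z => z; first by rewrite -!pmulrn (additive_map_nat aD).
by rewrite NegzE rmorphN !mulNr (additive_mapN aD); congr (- _); apply: (additive_map_nat aD).
Qed.

(* Modulo [P^k] the map [a] is multiplication by [a 1] followed by a ring
   isomorphism O/Q^k -> O/P^k, both quotients being Z/p^k. *)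
Lemma mult_of_pullback :
  (forall B, exists p P Q, [/\ (B < p)%N, degree_one p P k, lies_over p Q &
     ideal_exp Q k = pullback k a P]) ->
  forall x y, a x * a y = a 1 * a (x * y).
Proof.
move=> h x y; apply/eqP; rewrite -subr_eq0; apply/negPn/negP => /over_avoids[D hD].
have [p [P [Q [Dp hp hQ eQ]]]] := h D; have [hpP _ pdvd] := hp; have [pP hP _] := hpP.
apply: (hD p P Dp hpP); apply: (exp_over_sub hk hpP).
have iP := nz_prime_exp_ideal k hP; have [_ hQ' _] := hQ; have iQ := nz_prime_exp_ideal k hQ'.
have QE z : ideal_exp Q k z <-> ideal_exp P k (a z) by rewrite eQ.
have [r rk hr] := degree_one_residue (a 1) hp.
have k1 : (k.-1.+1 = k)%N by rewrite prednK //; apply: leq_trans hk.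
(* If p divided r, then p^(k-1) a 1 would be in P^k, so p^(k-1) in Q^k. Since Q^k is an ideal,
   p^(k-1) a' 1 would be in it too, and its image p^(k-1) in P^k. *)
have npr : ~~ (p %| r)%N.
  apply/negP => /dvdnP[r' er].
  have : ideal_exp Q k (p ^ k.-1)%:R.
    apply/QE; rewrite -[_%:R]mulr1 (additive_map_nat aD) -(subrK r%:R (a 1)) mulrDr.
    apply: is_idealD => //; first exact: is_idealMl.
    rewrite -natrM er mulnCA -expnSr k1 mulnC natrM; exact: exp_over_pow hpP.
  move=> /(is_idealMr (a' 1) iQ) /QE; rewrite (additive_map_nat aD) a'K mulr1 pmulrn.
  move=> /pdvd; rewrite dvdn_Pexp2l ?prime_gt1 // -{1}k1 ltnn //.
have co : coprime r (p ^ k) by apply: coprimeXr; rewrite coprime_sym prime_coprime.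
have [u [v e]] := nat_bezout K co.
have [m mk hm] := degree_one_residue (a x) hp.
(* As u inverts r modulo p^k, a x = n a 1 modulo P^k, that is x = n modulo Q^k. Multiplying by y
   inside the ideal Q^k gives a (x y) = n a y modulo P^k. *)
pose n : int := m%:Z * u.
have an := additive_map_int.
have Pxn : ideal_exp P k (a x - n%:~R * a 1).
  have e2 : 1 - u%:~R * r%:R = v%:~R * (p ^ k)%:R :> O by apply/eqP; rewrite subr_eq addrC e.
  have -> : a x - n%:~R * a 1 = (a x - m%:R) + m%:R * (1 - u%:~R * r%:R) - n%:~R * (a 1 - r%:R).
    by rewrite /n intrM -pmulrn; ring.
  apply: is_idealB => //; last exact: is_idealMl.
  apply: is_idealD => //; apply: is_idealMl => //.
  by rewrite e2 mulrC; apply: exp_over_pow hpP.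
have Qxn : ideal_exp Q k (x - n%:~R).
  by apply/QE; rewrite (additive_mapB aD) -[n%:~R]mulr1 an.
have /QE := is_idealMr y iQ Qxn; rewrite mulrBl (additive_mapB aD) an => Pxyn.
have := is_idealB iP (is_idealMr (a y) iP Pxn) (is_idealMr (a 1) iP Pxyn).
by congr ideal_exp; ring.
Qed.

Hypothesis aM : forall x y, a x * a y = a 1 * a (x * y).

Lemma mult_unit : a 1 \is a GRing.unit.
Proof.
apply/unitrP; exists (a (a' 1 * a' 1)).
by rewrite mulrC -aM a'K mulr1.
Qed.

Local Notation s x := ((a 1)^-1 * a x).

(** The map s = a / a 1 is a ring endomorphism of O. It extends to K by y -> s (D y) / D, whatever
    nonzero integer D makes D y integral, and an endomorphism of K over Q is bijective by
    dimension. *)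
Lemma mult_semilinear :
  exists (u : unit_group O) (f : field_aut K), forall x, a x = val u * aut_int f x.
Proof.
have U := mult_unit.
have sM x y : s (x * y) = s x * s y.
  by rewrite mulrACA aM -mulrA (mulrA _ (a 1)) mulVr ?mul1r.
have s1 : s 1 = 1 by rewrite mulVr.
have sD x y : s (x + y) = s x + s y by rewrite aD mulrDr.
have sZ (D : int) x : s (D%:~R * x) = D%:~R * s x.
  by rewrite (additive_map_int) mulrCA.
have vZ (D : int) (w : O) : val (D%:~R * w) = D%:~R * val w by rewrite rmorphM rmorph_int.
have vB (x y : O) : val (x - y) = val x - val y by apply: rmorphB.
have vM (x y : O) : val (x * y) = val x * val y by apply: rmorphM.
have key y (D D' : int) (z z' : O) : val z = D%:~R * y -> val z' = D'%:~R * y ->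
    D%:~R * val (s z') = D'%:~R * val (s z).
  move=> ez ez'; rewrite -!vZ -!sZ; congr (val (_ * a _)).
  by apply: val_inj; rewrite !vZ ez ez' mulrCA.
pose f (y : K) : K := let D := cid (exists_integral_multiple y) in
  (sval D)%:~R^-1 * val (s (sval (cid (svalP D).2))).
have fE y (D : int) (z : O) : D != 0 -> val z = D%:~R * y -> D%:~R * f y = val (s z).
  rewrite /f; case: cid => D' [D'0 hz']; case: cid => z' ez' D0 ez.
  have D'K : (D'%:~R : K) != 0 by rewrite intK_eq0.
  by apply: (mulfI D'K); rewrite mulrCA mulVKf //; apply: key ez ez'.
have fex y : exists (D : int) (z : O), [/\ D != 0, val z = D%:~R * y & D%:~R * f y = val (s z)].
  by have [D [D0 [z ez]]] := exists_integral_multiple y; exists D, z; split=> //; apply: fE.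
have fD : zmod_morphism f.
  move=> x y; have [D [z [D0 ez efx]]] := fex x; have [D' [z' [D'0 ez' efy]]] := fex y.
  have DK : (D%:~R : K) != 0 by rewrite intK_eq0.
  have D'K : (D'%:~R : K) != 0 by rewrite intK_eq0.
  apply: (mulfI DK); apply: (mulfI D'K).
  have -> : D'%:~R * (D%:~R * f (x - y)) = val (s (D'%:~R * z - D%:~R * z')).
    rewrite mulrA -intrM; apply: fE; first by rewrite mulf_neq0.
    by rewrite vB !vZ ez ez' intrM; ring.
  by rewrite (additive_mapB aD) mulrBr !sZ vB !vZ -efx -efy; ring.
have fM : monoid_morphism f.
  split; first by have := fE 1 1 1 isT; rewrite !mul1r rmorph1 s1 rmorph1; apply.
  move=> x y; have [D [z [D0 ez efx]]] := fex x; have [D' [z' [D'0 ez' efy]]] := fex y.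
  have DK : ((D * D')%:~R : K) != 0 by rewrite intK_eq0 mulf_neq0.
  apply: (mulfI DK); rewrite (fE _ _ (z * z')) ?mulf_neq0 //; last first.
    by rewrite vM ez ez' intrM mulrACA.
  by rewrite sM vM -efx -efy intrM mulrACA.
have fl : linear f.
  move=> c x y; have fA z t : f (z + t) = f z + f t.
    have f0 z' : f (- z') = - f z' by rewrite -sub0r fD -{1}(subrr z') fD subrr sub0r.
    by rewrite -{1}[t]opprK fD f0 opprK.
  by rewrite fA (rat_linear fD).
pose fL : {linear K -> K} := HB.pack f (GRing.isLinear.Build rat K K *:%R f fl).
have fK : kAut 1 {:K} (linfun fL).
  rewrite kAutfE; apply/kHom_monoid_morphism.
  by split=> [|x y]; rewrite !lfunE /=; case: fM.
pose g : field_aut K := exist (fun g : 'End(K) => kAut 1 fullv g) _ fK.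
exists (exist (fun x => x \is a GRing.unit) _ U), g => x.
apply: val_inj; rewrite vM.
have -> : val (aut_int g x) = f (val x) by apply: (lfunE fL (val x)).
have := fE (val x) 1 x isT; rewrite !mul1r => /(_ erefl) ->.
by rewrite -vM mulVKr.
Qed.

End Multiplicativity.

(** * Normalisers and centralisers in a group *)

Section GroupFacts.
Variable gT : groupType.
Implicit Types (G : set gT) (x y : gT).
Local Open Scope group_scope.

Lemma normaliser_ofP G x : normaliser_of G x <->
  (forall y, G y -> G (x * y * x^-1)) /\ (forall y, G y -> G (x^-1 * y * x)).
Proof.
split=> [e|[h1 h2]]; last first.
  apply/seteqP; split=> [_ [y Gy <-]|y Gy]; first exact: h1.
  by exists (x^-1 * y * x); [exact: h2 | rewrite !mulgA mulgV mul1g mulgK].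
split=> y Gy; first by rewrite -e; exists y.
by move: Gy; rewrite -{1}e => -[z Gz <-]; rewrite !mulgA mulVg mul1g mulgKV.
Qed.

Lemma normaliser_subgroup G : is_subgroup (normaliser_of G).
Proof.
split.
- by apply/normaliser_ofP; rewrite invg1; split=> y; rewrite mul1g mulg1.
- move=> x y /normaliser_ofP[hx hx'] /normaliser_ofP[hy hy'].
  apply/normaliser_ofP; rewrite invMg; split=> z Gz.
    by have := hx _ (hy _ Gz); rewrite !mulgA.
  by have := hy' _ (hx' _ Gz); rewrite !mulgA.
- by move=> x /normaliser_ofP[hx hx']; apply/normaliser_ofP; rewrite invgK.
Qed.

Lemma centraliser_normal G : is_normal (centraliser_of G) (normaliser_of G).
Proof.
split.
- split=> [y _|x y hx hy z Gz|x hx z Gz].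
  + by rewrite mulg1 mul1g.
  + by rewrite mulgA (hx z Gz) -mulgA (hy z Gz) mulgA.
  + by apply: (mulgI x); rewrite !mulgA -(hx z Gz) mulgK mulgV mul1g.
- move=> x hx; apply/normaliser_ofP; split=> y Gy; first by rewrite -(hx y Gy) mulgK.
  by rewrite -mulgA (hx y Gy) mulgA mulVg mul1g.
move=> x y /normaliser_ofP[_ hx'] hy z Gz.
have := hy _ (hx' _ Gz) => e.
have := congr1 (fun w => x * w * x^-1) e.
by rewrite !mulgA mulgV mul1g mulgK.
Qed.

End GroupFacts.

(** * Units and automorphisms acting on O and on its k-free elements *)

Section SemilinearAction.
Variable K : fieldExtType rat.
Local Notation O := (ring_of_integers K).
Local Notation S := (sdprod_type (aut_unit_act K)).
Implicit Types (g h : S) (x y : O).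

Definition slact g x : O := val g.1 * aut_int g.2 x.

Lemma slactD g x y : slact g (x + y) = slact g x + slact g y.
Proof. by rewrite /slact -mulrDr; congr (_ * _); apply: val_inj; rewrite /= linearD. Qed.

Lemma slactM g h x : slact (g * h)%g x = slact g (slact h x).
Proof.
rewrite /slact /= aut_intM mulrA; congr (_ * _).
by apply: val_inj; rewrite /= comp_lfunE.
Qed.

Lemma slact1 x : slact 1%g x = x.
Proof. by rewrite /slact mul1r; apply: val_inj; rewrite /= id_lfunE. Qed.

Lemma slactK g : cancel (slact g) (slact g^-1%g).
Proof. by move=> x; rewrite -slactM mulVg slact1. Qed.

Lemma slactVK g : cancel (slact g^-1%g) (slact g).
Proof. by move=> x; rewrite -slactM mulgV slact1. Qed.

(** The unit is the value at 1; the automorphism is known on O, which contains an integer multiple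
    of every element of K. *)
Lemma act_faithful g h : (forall x, slact g x = slact h x) -> g = h.
Proof.
case: g h => [u f] [v f'] e.
have euv : u = v by apply: val_inj; have := e 1; rewrite /slact /= !aut_int1 !mulr1.
congr pair => //; apply: val_inj; apply/lfunP => y.
have [D [D0 [z ez]]] := exists_integral_multiple y.
have DK : (D%:~R : K) != 0 by rewrite intK_eq0.
have uU : val u \is a GRing.unit by apply: (valP u).
have := e z; rewrite /slact /= -euv => /(mulrI uU) /(congr1 val) /=.
have lin (w : 'End(K)) : w (D%:~R * y) = D%:~R * w y by rewrite mulrzl raddfMz mulrzl.
rewrite ez !lin.
exact: mulfI.
Qed.

(** Automorphisms permute the primes. The inclusion of powers is checked on products, carried back
    by the inverse of f. *)
Lemma aut_int_prime (f : field_aut K) (P : set O) : nz_prime P ->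
  nz_prime [set x | P (aut_int f x)] /\
  forall k x, ideal_exp P k (aut_int f x) -> ideal_exp [set x | P (aut_int f x)] k x.
Proof.
have fD x y : aut_int f (x + y) = aut_int f x + aut_int f y.
  by apply: val_inj; rewrite /= linearD.
have f0 : aut_int f 0 = 0 by apply: val_inj; rewrite /= linear0.
have fK : cancel (aut_int f) (aut_int f^-1%g).
  by move=> x; apply: val_inj; rewrite /= lker0_lfunK ?aut_lker0.
have fVK : cancel (aut_int f^-1%g) (aut_int f).
  by move=> x; apply: val_inj; rewrite /= lker0_lfunVK ?aut_lker0.
move=> [[P0 iP] P1 Pm [y Py y0]]; split.
  split; rewrite /=.
  - split; rewrite /= ?f0 // => a x z Px Pz; rewrite fD aut_intM; exact: iP.
  - by rewrite aut_int1.
  - by move=> x z; rewrite aut_intM; apply: Pm.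
  exists (aut_int f^-1%g y); first by rewrite /= fVK.
  by apply: contra_neq y0 => e; rewrite -(fVK y) e f0.
elim=> [|k IH] x //.
suff S : ideal_exp P k.+1 `<=` [set y | ideal_exp [set x | P (aut_int f x)] k.+1 (aut_int f^-1%g y)].
  by move/S; rewrite /= fK.
have gD u v : aut_int f^-1%g (u + v) = aut_int f^-1%g u + aut_int f^-1%g v.
  by apply: (can_inj fK); rewrite fD !fVK.
have [h0 _] : is_ideal (ideal_exp [set x | P (aut_int f x)] k.+1).
  apply: ideal_exp_ideal; split; rewrite /= ?f0 // => a u v Pu Pv; rewrite fD aut_intM; exact: iP.
apply: ideal_mul_sub.
- by rewrite /= -[X in aut_int _ X]f0 fK.
- by move=> u v hu hv; rewrite /= gD; apply: ideal_mulD.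
move=> p u Pp Pu; rewrite /= aut_intM; apply: ideal_mul_mem; first by rewrite /= fVK.
by apply: IH; rewrite fVK.
Qed.

Variables (d : nat) (b : 'I_d -> O) (hb : is_Zbasis b) (k : nat).

Lemma act_k_free g x : k_free k x -> k_free k (slact g x).
Proof.
move=> /(k_freeP hb)[x0 hx]; apply/(k_freeP hb); split.
  by apply: contra_neq x0 => e; rewrite -(slactK g x) e (additive_map0 (slactD _)).
move=> P hP; have [hP' sub] := aut_int_prime g.2 hP => h; apply: (hx _ hP'); apply: sub.
rewrite -[aut_int _ _](mulKr (valP g.1)); apply: is_idealMl => //.
exact: nz_prime_exp_ideal.
Qed.

Lemma act_k_freeE g x : k_free k (slact g x) <-> k_free k x.
Proof. by split=> [/(act_k_free g^-1%g)|]; rewrite ?slactK //; apply: act_k_free. Qed.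

End SemilinearAction.

(** * Translations and semilinear homeomorphisms of the system; its normaliser *)

Section PowerFreeSystem.
Variables (K : fieldExtType rat) (d : nat).
Local Notation O := (ring_of_integers K).
Variables (b : 'I_d -> O) (hb : is_Zbasis b).
Variables (k : nat) (hk : (2 <= k)%N).
Implicit Types (x y : O).
Hypothesis hdeg : forall B, exists p (P : set O), (B < p)%N /\ degree_one p P k.

Local Notation V := (k_free_lattice b k).
Local Notation X := (system V).
Local Notation S := (sdprod_type (aut_unit_act K)).
Local Notation tr t := (translation V (coords hb t)).
Local Notation msys := (mem_sys hb).
Local Notation point x := (config hb hk hdeg (admissible1 hk x)).

Lemma msys_tr t (u : X) x : msys (tr t u) x = msys u (x - t).
Proof. exact: mem_translate. Qed.

Lemma trM s t : (tr s * tr t)%g = tr (s + t).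
Proof.
apply: homeoP => u; apply: (mem_sys_inj (hb := hb)) => x.
by rewrite [LHS]msys_tr !msys_tr opprD addrA addrAC.
Qed.

Lemma trP (h : homeo X) : translations V h <-> exists t, h = tr t.
Proof.
split=> [[s _ <-]|[t ->]]; last by exists (coords hb t).
by exists (lattice_elt b s); rewrite latticeK.
Qed.

Lemma tr_point t x : tr t (point x) = point (x + t).
Proof. exact: translate_point. Qed.

Lemma point_inj x y : point x = point y -> x = y.
Proof.
move=> e; apply/eqP; have := mem_config hb hk hdeg (admissible1 hk x) x.
by rewrite e mem_config !inE eqxx.
Qed.

Lemma tr_inj s t : tr s = tr t -> s = t.
Proof.
move=> e; have := tr_point s 0; rewrite e tr_point !add0r.
by move/point_inj.
Qed.

(** Translations are told apart by their effect on the singleton at 0, a point of the system. *)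
Lemma translation_injective : injective (translation V).
Proof.
move=> s s'; rewrite -[s](latticeK hb) -[s'](latticeK hb).
by move/tr_inj->.
Qed.

Definition precomp (B : 'rV[int]_d -> 'rV[int]_d) (u : full_shift d) : full_shift d :=
  fun z => u (B z).

Lemma precomp_cts B : continuous (precomp B).
Proof.
move=> u; apply/cvg_sup => v; move: u.
have : continuous (fun u : full_shift d => precomp B u v).
  exact: (@proj_continuous _ (fun=> bool) (B v)).
exact: (@continuous_comp_initial _ (full_shift d)).
Qed.

Definition act_row (g : S) (z : 'rV[int]_d) := coords hb (slact g (lattice_elt b z)).

(** As g preserves k-freeness, g (s + V) = g s + V: the orbit of V is stable, and its closure by
    continuity. *)
Lemma precomp_stable g (u : X) : precomp (act_row g^-1%g) (set_val u) \in orbit_closure V.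
Proof.
apply/mem_set => U /precomp_cts uU.
have /(_ _ uU)[y [[s _ <-] Uy]] := set_mem (valP u).
exists (precomp (act_row g^-1%g) (translate s (char_fun V))); split=> //.
exists (act_row g s) => //; apply/funext => z.
rewrite /precomp /translate /char_fun /k_free_lattice /=; apply/asbool_equiv_eq.
have <- : slact g (lattice_elt b (act_row g^-1%g z - s)) = lattice_elt b (z - act_row g s).
  rewrite !lattice_eltD !lattice_eltN /act_row !coordsK.
  by rewrite (additive_mapB (@slactD _ g)) slactVK.
by rewrite (act_k_freeE hb).
Qed.

Definition act_fun g (u : X) : X := exist _ (precomp (act_row g^-1%g) (set_val u)) (precomp_stable g u).

Lemma msys_act g u x : msys (act_fun g u) x = msys u (slact g^-1%g x).
Proof. by rewrite -[in RHS](coordsK hb x). Qed.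

Lemma act_funK g : cancel (act_fun g) (act_fun g^-1%g).
Proof.
by move=> u; apply: (mem_sys_inj (hb := hb)) => x; rewrite !msys_act invgK slactK.
Qed.

Lemma act_funVK g : cancel (act_fun g^-1%g) (act_fun g).
Proof.
by move=> u; apply: (mem_sys_inj (hb := hb)) => x; rewrite !msys_act invgK slactVK.
Qed.

Lemma act_fun_cts g : continuous (act_fun g).
Proof.
apply: continuous_comp_initial => x.
have vc : continuous (set_val : X -> full_shift d).
  exact: (@initial_continuous X (full_shift d) set_val).
exact: (continuous_comp (vc x) (@precomp_cts (act_row g^-1%g) (set_val x))).
Qed.

Definition act_homeo g : homeo X :=
  Homeo (act_funK g) (act_funVK g) (@act_fun_cts g) (@act_fun_cts g^-1%g).

Lemma msys_homeo g u x : msys (act_homeo g u) x = msys u (slact g^-1%g x).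
Proof. exact: msys_act. Qed.

Lemma act_homeoM : {morph act_homeo : g h / (g * h)%g}.
Proof.
move=> g h; apply: homeoP => u; apply: (mem_sys_inj (hb := hb)) => x.
by rewrite [RHS]msys_homeo !msys_homeo invMg slactM.
Qed.

Lemma act_homeo1 : act_homeo 1%g = 1%g.
Proof. by apply: (mulgI (act_homeo 1%g)); rewrite -act_homeoM !mulg1. Qed.

Lemma act_homeoV g : act_homeo g^-1%g = (act_homeo g)^-1%g.
Proof. by apply: (mulgI (act_homeo g)); rewrite -act_homeoM !mulgV act_homeo1. Qed.

Lemma act_point g x : act_homeo g (point x) = point (slact g x).
Proof.
apply: (mem_sys_inj (hb := hb)) => y; rewrite msys_homeo !mem_config !inE.
by rewrite (can2_eq (slactVK g) (slactK g)).
Qed.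

Lemma act_homeo_inj : injective act_homeo.
Proof.
move=> g h e; apply: act_faithful => x.
by apply: point_inj; rewrite -!act_point e.
Qed.

Lemma act_homeo_tr g t : (act_homeo g * tr t = tr (slact g t) * act_homeo g)%g.
Proof.
apply: homeoP => u; apply: (mem_sys_inj (hb := hb)) => x.
rewrite [LHS]msys_homeo [RHS]msys_tr msys_tr msys_homeo.
by rewrite (additive_mapB (slactD g^-1%g)) slactK.
Qed.

Lemma normalising_homeo (H : homeo X) (a a' : O -> O) :
  {morph a : x y / x + y} -> cancel a a' -> cancel a' a ->
  (forall t, (H * tr t = tr (a t) * H)%g) ->
  exists t, forall u z, msys ((tr (- t) * H)%g u) (a z) = msys u z.
Proof.
move=> aD aK a'K HT.
have a'D : {morph a' : x y / x + y}.
  by move=> x y; apply: (can_inj aK); rewrite aD !a'K.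
have eqv (h : homeo X) c : (forall t, (h * tr t = tr (c t) * h)%g) -> equivariant hb h c.
  by move=> e t u; have := congr1 (fun h' : homeo X => h' u) (e t).
have [f hf] := equivariant_point hk hdeg aD aK a'K (@homeo_cts _ H) (eqv _ _ HT) (can_inj (@homeoK _ H)).
(* [H1] fixes the singleton at 0, as [equivariant_sub] requires. So does its inverse, equivariant
   along a', which yields the converse inclusion. *)
exists (a f); set H1 := (tr (- a f) * H)%g.
have H1T t : (H1 * tr t = tr (a t) * H1)%g.
  by rewrite /H1 -mulgA HT !mulgA !trM addrC.
have H10 x : msys (H1 (point 0)) (a x) = (x == 0).
  by rewrite [LHS]msys_tr opprK -aD hf -subr_eq0 addrK.
have H1p : H1 (point 0) = point 0.
  apply: (mem_sys_inj (hb := hb)) => x; rewrite -[x]a'K H10 mem_config inE.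
  by rewrite -[in RHS](additive_map0 aD) (inj_eq (can_inj aK)).
have H2T t : (H1^-1 * tr t = tr (a' t) * H1^-1)%g.
  by apply: (mulgI H1); apply: (mulIg H1); rewrite !mulgA mulgV mul1g H1T a'K -!mulgA mulVg !mulg1.
have H20 x : msys ((H1^-1)%g (point 0)) (a' x) = (x == 0).
  have -> : (H1^-1)%g (point 0) = point 0 by rewrite -{1}H1p; apply: homeoK.
  by rewrite mem_config inE (can2_eq a'K aK) (additive_map0 aD).
move=> u z; apply/idP/idP.
  exact: (equivariant_sub aD aK a'K (@homeo_cts _ H1) (eqv _ _ H1T) H10).
move=> uz.
apply: (equivariant_sub a'D a'K aK (@homeo_cts _ H1^-1%g) (eqv _ _ H2T) H20).
by rewrite aK; have -> : (H1^-1)%g (H1 u) = u by apply: homeoK.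
Qed.

Lemma normalising_translations (H : homeo X) : normaliser_of (translations V) H ->
  exists a a' : O -> O, [/\ {morph a : x y / x + y}, cancel a a', cancel a' a &
    forall t, (H * tr t = tr (a t) * H)%g].
Proof.
move=> /normaliser_ofP[h1 h2].
have [a ha] : {a : O -> O | forall t, (H * tr t * H^-1 = tr (a t))%g}.
  suff h t : {s | (H * tr t * H^-1 = tr s)%g}.
    by exists (fun t => sval (h t)) => t; apply: (svalP (h t)).
  by apply: cid; apply/trP/h1/trP; exists t.
have [a' ha'] : {a' : O -> O | forall t, (H^-1 * tr t * H = tr (a' t))%g}.
  suff h t : {s | (H^-1 * tr t * H = tr s)%g}.
    by exists (fun t => sval (h t)) => t; apply: (svalP (h t)).
  by apply: cid; apply/trP/h2/trP; exists t.
exists a, a'; split=> [s t|t|t|t].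
- by apply: tr_inj; rewrite -trM -!ha -trM !mulgA mulgKV.
- by apply: tr_inj; rewrite -ha' -ha !mulgA mulVg mul1g mulgKV.
- by apply: tr_inj; rewrite -ha -ha' !mulgA mulgV mul1g mulgK.
by rewrite -ha mulgKV.
Qed.

(** The case a = id of [normalising_homeo]: up to a translation, H is the identity. *)
Lemma centraliser_translations : centraliser_of (translations V) = translations V.
Proof.
apply/seteqP; split=> [H hH|_ /trP[t ->] _ /trP[s ->]]; last by rewrite !trM addrC.
have [t ht] := @normalising_homeo H id id (fun _ _ => erefl) (fun=> erefl) (fun=> erefl)
  (fun t => esym (hH (tr t) (ex_intro2 _ _ (coords hb t) I erefl))).
apply/trP; exists t; apply: (mulgI (tr (- t))); rewrite trM addNr.
apply: homeoP => u; apply: (mem_sys_inj (hb := hb)) => x.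
by rewrite [LHS]ht msys_tr subr0.
Qed.

Lemma normaliser_decomposition (H : homeo X) : normaliser_of (translations V) H ->
  exists t g, H = (tr t * act_homeo g)%g.
Proof.
move=> /normalising_translations[a [a' [aD aK a'K HT]]].
have [t ht] := normalising_homeo aD aK a'K HT; set H1 := (tr (- t) * H)%g in ht.
have aM : forall x y, a x * a y = a 1 * a (x * y).
  apply: (@mult_of_pullback _ k hk a a' aD a'K) => B.
  have [p [P [Bp hp]]] := hdeg (B + d).
  have [|Q hQ eQ] := equivariant_pullback hk hdeg aD a'K ht hp.
    by apply: leq_ltn_trans Bp; apply: leq_addl.
  by exists p, P, Q; split=> //; apply: leq_ltn_trans Bp; apply: leq_addr.
have [u [f af]] := mult_semilinear aD a'K aM.
exists t, (u, f); apply: (mulgI (tr (- t))); rewrite mulgA trM addNr.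
have -> : tr 0 = 1%g.
  by apply: (mulgI (tr 0)); rewrite trM addr0 mulg1.
rewrite mul1g -/H1; apply: homeoP => v; apply: (mem_sys_inj (hb := hb)) => x.
by rewrite msys_homeo -[x in LHS](slactVK (u, f)) -[RHS]ht af.
Qed.

Lemma normaliser_sdprod :
  is_sdprod (normaliser_of (translations V)) (centraliser_of (translations V)) (range act_homeo).
Proof.
have act_norm g : normaliser_of (translations V) (act_homeo g).
  apply/normaliser_ofP; split=> _ /trP[t ->]; apply/trP.
    by exists (slact g t); rewrite act_homeo_tr mulgK.
  exists (slact g^-1%g t); rewrite -act_homeoV act_homeo_tr -mulgA act_homeoV mulVg mulg1 //.
have [R1 RM RV] := normaliser_subgroup (translations V).
have [Csub CN CJ] := centraliser_normal (translations V).
split=> //.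
- split; first by exists 1%g => //; apply: act_homeo1.
    by move=> _ _ [g _ <-] [h _ <-]; exists (g * h)%g => //; apply: act_homeoM.
  by move=> _ [g _ <-]; exists g^-1%g => //; apply: act_homeoV.
- apply/seteqP; split=> [h|_ ->]; last first.
    by split; [case: Csub | exists 1%g => //; apply: act_homeo1].
  rewrite centraliser_translations => -[/trP[t ->] [g _ e]].
  (* A semilinear homeomorphism fixes the singleton at 0, whereas translation by t moves it to t. *)
  have : tr t (point 0) = point (slact g 0) by rewrite -e act_point.
  rewrite tr_point add0r (additive_map0 (@slactD _ g)) => /point_inj->.
  by apply: (mulgI (tr 0)); rewrite trM addr0 mulg1.
apply/seteqP; split=> [H /normaliser_decomposition[t [g ->]]|_ [x Cx [_ [g _ <-] ->]]].
  exists (tr t); first by rewrite centraliser_translations; apply/trP; exists t.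
  by exists (act_homeo g) => //; exists g.
by apply: RM; [apply: CN | apply: act_norm].
Qed.

End PowerFreeSystem.

(** * Quadratic and cyclotomic fields: splitting and an integral generator *)

Section QuadraticCyclotomic.
Variable K : fieldExtType rat.
Local Notation O := (ring_of_integers K).

Lemma separable_rat : separable 1 {:K}.
Proof.
apply/allP => y _; apply: pcharf0_separable => p.
by rewrite (pchar_lalg K) pchar_num.
Qed.

Lemma splitting_field_of_roots (p : {poly K}) (rs : seq K) :
  p \is a polyOver 1%VS -> p %= \prod_(z <- rs) ('X - z%:P) -> <<1 & rs>>%VS = {:K}%VS ->
  splitting_field_axiom K.
Proof. by move=> hp hrs hK; exists p => //; exists rs. Qed.

Lemma cyclotomic_splitting n : (0 < n)%N -> is_cyclotomic K n -> splitting_field_axiom K.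
Proof.
move=> n0 [xi hxi hK].
apply: (@splitting_field_of_roots ('X^n - 1) [seq xi ^+ i | i <- index_iota 0 n]).
- by rewrite rpredB ?rpred1 // rpredX // polyOverX.
- by rewrite big_map (factor_Xn_sub_1 hxi) eqpxx.
apply/eqP; rewrite eqEsubv subvf /= -hK; apply/FadjoinP; split.
  exact: subv_adjoin_seq.
apply: seqv_sub_adjoin; have [n1|n1] := leqP n 1; last first.
  by apply/mapP; exists 1%N; rewrite ?mem_index_iota // expr1.
(* For n = 1 the only listed root is xi^0, which equals xi. *)
apply/mapP; exists 0%N; rewrite ?mem_index_iota // expr0.
have := prim_expr_order hxi; have -> : n = 1%N by apply/eqP; rewrite eqn_leq n1.
by rewrite expr1.
Qed.

(** In dimension 2 every element outside Q generates K; an integer multiple of it is integral. *)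
Lemma quadratic_generator : is_quadratic K -> exists theta : O, <<1; val theta>>%VS = {:K}%VS.
Proof.
move=> hd.
have [y y1] : exists y : K, y \notin 1%VS.
  apply: contrapT => h; have : ({:K} <= 1)%VS.
    by apply/subvP => y _; apply/negPn/negP => ny; apply: h; exists y.
  by move=> /dimvS; rewrite hd dimv1.
have [D [D0 [z ez]]] := exists_integral_multiple y; exists z.
have DK : (D%:~R : K) != 0 by rewrite intK_eq0.
have z1 : val z \notin 1%VS.
  apply: contra y1 => z1; have -> : y = D%:~R^-1 * val z by rewrite ez mulKf.
  by rewrite rpredM // rpredV rpred_int.
apply/eqP; rewrite eqEdim subvf hd /=.
rewrite ltnNge; apply/negP => le; case/negP: z1.
have /eqP -> : (1 == <<1; val z>>)%VS.
  by rewrite eqEdim dimv1 le subv_adjoin.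
exact: memv_adjoin.
Qed.

(** The minimal polynomial of the generator has degree 2 and a root in K, so the cofactor is linear
    and gives the other root. *)
Lemma quadratic_splitting : is_quadratic K -> splitting_field_axiom K.
Proof.
move=> hd; have [z hz] := quadratic_generator hd; pose t := val z.
have sz : size (minPoly 1 t) = 3%N.
  rewrite size_minPoly; congr _.+1; have := dim_Fadjoin 1 t.
  by rewrite hz hd dimv1 muln1.
have /factor_theorem[q eq] := root_minPoly 1 t.
have mq : q \is monic.
  by rewrite -(monicMr _ (monicXsubC t)) -eq monic_minPoly.
have sq : size q = 2%N.
  have := sz; rewrite eq size_Mmonic ?monic_neq0 ?monicXsubC // size_XsubC addn2 /=.
  by case.
have qE : q = 'X - (- q`_0)%:P.
  rewrite polyCN opprK; apply/polyP => -[|[|i]]; rewrite coefD coefX coefC ?add0r ?addr0 //=.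
    by move: mq; rewrite monicE lead_coefE sq => /eqP.
  by rewrite nth_default // sq.
apply: (@splitting_field_of_roots (minPoly 1 t) [:: t; - q`_0]).
- exact: minPolyOver.
- by rewrite eq {1}qE !big_cons big_nil mulr1 mulrC eqpxx.
apply/eqP; rewrite eqEsubv subvf /= -hz; apply/FadjoinP; split.
  exact: subv_adjoin_seq.
by apply: seqv_sub_adjoin; rewrite mem_head.
Qed.

Lemma cyclotomic_generator n : (0 < n)%N -> is_cyclotomic K n ->
  exists theta : O, <<1; val theta>>%VS = {:K}%VS.
Proof.
move=> n0 [xi hxi hK].
suff xiO : xi \in @integral_elt K by exists (exist (fun x => x \in @integral_elt K) xi xiO).
apply/asboolP; exists ('X^n - 1); first exact: monicXnsubC.
by rewrite rmorphB /= map_polyXn rmorph1 /root !hornerE prim_expr_order ?subrr.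
Qed.

End QuadraticCyclotomic.

Theorem theorem6p2 (K : fieldExtType rat)
    (hK : is_quadratic K \/
          exists n, [/\ (2 < n)%N, n <> 2 %[mod 4] & is_cyclotomic K n])
    (b : 'I_(\dim {:K}) -> ring_of_integers K) (hb : is_Zbasis b)
    (k : nat) (hk : (2 <= k)%N) :
  let V := k_free_lattice b k in
  let G := translations V in
  [/\ is_galois_over_Q K,
      injective (translation V),
      centraliser_of G = G
    & exists E : set (homeo (system V)),
        is_sdprod (normaliser_of G) (centraliser_of G) E /\
        is_isomorphic_to E (sdprod_type (aut_unit_act K))].
Proof.
move=> V G.
have [splitK [theta hth]] : splitting_field_axiom K /\
    exists theta : ring_of_integers K, <<1; val theta>>%VS = {:K}%VS.
  case: hK => [hq|[n [n2 _ hc]]].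
    by split; [apply: quadratic_splitting | apply: quadratic_generator].
  have n0 : (0 < n)%N by apply: leq_trans n2.
  by split; [apply: cyclotomic_splitting hc | apply: cyclotomic_generator hc].
have hdeg B := exists_degree_one hb hth B k.
split.
- by split=> //; apply: separable_rat.
- exact: (translation_injective hb hk hdeg).
- exact: (centraliser_translations hb hk hdeg).
exists (range (act_homeo hb k)); split; first exact: (normaliser_sdprod hb hk hdeg).
exists (act_homeo hb k); split=> //; first exact: act_homeoM.
exact: (act_homeo_inj hk hdeg).
Qed.
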